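(* Let $N\ge2$ and let $p,q\ge1$ be such that $\frac1p+\frac1q=1+\frac1{N-1}$. Let $\Omega:=B_1'\times(0,1)$, where $B_1'$ is the unit ball of $\mathbb R^{N-1}$ centered at the origin, and denote the points of $\Omega$ by $(x',x_N)$. For $n\ge1$ set $a_n(r):=(1-r)^n$ and $$\sigma_n(x):=n^{\frac{N-1}p}\,a_n(|x'|)\,e_N,\qquad\eta_n(x):=n^{\frac{N-1}{p'}}\Big(a_n'(|x'|)\,x_N\,\frac{x'}{|x'|}+a_n(|x'|)\,e_N\Big).$$ Then: $$\operatorname{div}\sigma_n=0,\quad\operatorname{curl}\eta_n=0\quad\text{in }\Omega;$$ $\sigma_n\rightharpoonup0$ weakly in $L^p(\Omega)^N$ if $p>1$, and $\sigma_n\rightharpoonup|S_{N-2}|\,(N-2)!\,\big(\delta_{\{x'=0\}}\otimes1\big)\,e_N$ weakly-$*$ in $\mathcal M(\Omega)^N$ if $p=1$; $\eta_n\rightharpoonup0$ weakly in $L^q(\Omega)^N$ if $q>1$, and $\eta_n\rightharpoonup0$ weakly-$*$ in $\mathcal M(\Omega)^N$ if $q=1$; while $$\sigma_n\cdot\eta_n\rightharpoonup|S_{N-2}|\,\frac{(N-2)!}{2^{N-1}}\,\big(\delta_{\{x'=0\}}\otimes1\big)\quad\text{weakly-}*\text{ in }\mathcal M(\Omega)\qquad(\text{with }|S_0|:=1).$$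
   Context: $p'=p/(p-1)\in[1,\infty]$ is the conjugate exponent (with $\frac{N-1}{p'}=0$ if $p=1$). $e_N$ is the last vector of the canonical basis of $\mathbb R^N$, and $x'$ is identified with $(x',0)\in\mathbb R^N$. $\mathcal M(\Omega)$: bounded Radon measures on $\Omega$. $\delta_{\{x'=0\}}\otimes1$ is the measure $\phi\mapsto\int_0^1\phi(0,x_N)\,dx_N$. $|S_{N-2}|$ is the $(N-2)$-dimensional Hausdorff measure of the unit sphere of $\mathbb R^{N-1}$, with the convention $|S_0|:=1$ for $N=2$.
   Formalization: For N=2 the convention |S_0|:=1 is replaced by |S_0|=2 (counting measure of {-1,1}); with the value 1 the limits are false, since n(1-|t|)^n has integral 2n/(n+1) over (-1,1), tending to 2. *)

(* Defs.v *)
From HB Require Import structures.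
From mathcomp Require Import all_boot all_order all_algebra.
From mathcomp Require Import all_classical all_reals all_analysis.

Set Implicit Arguments.
Unset Strict Implicit.
Unset Printing Implicit Defensive.

Import Order.TTheory GRing.Theory Num.Theory.
Import numFieldNormedType.Exports.

Local Open Scope classical_set_scope.
Local Open Scope ring_scope.

(* The sigma-algebra generated by the coordinates; on R^n it is the Borel
   sigma-algebra. *)
Section measurable_rV.
Context {R : realType} (n : nat).

Let coord (i : 'I_n) (x : 'rV[R]_n) : R := x ord0 i.

Let rV_set0 : g_sigma_preimage coord set0.
Proof. exact: sigma_algebra0. Qed.

Let rV_setC A : g_sigma_preimage coord A -> g_sigma_preimage coord (~` A).
Proof. exact: sigma_algebraC. Qed.

Let rV_bigcup (F : (set _)^nat) : (forall i, g_sigma_preimage coord (F i)) ->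
  g_sigma_preimage coord (\bigcup_i (F i)).
Proof. exact: sigma_algebra_bigcup. Qed.

HB.instance Definition _ := @isMeasurable.Build default_measure_display
  'rV[R]_n (g_sigma_preimage coord) rV_set0 rV_setC rV_bigcup.

End measurable_rV.

Section coordinates.
Context {R : realType}.
Implicit Types d n : nat.

Definition dotv n (x y : 'rV[R]_n) : R := \sum_(i < n) x 0 i * y 0 i.

(* The canonical norm of 'rV[R]_n is the sup norm; this one is Euclidean. *)
Definition enorm n (x : 'rV[R]_n) : R := Num.sqrt (dotv x x).

(* A point x of R^(d+1) is (x', x_N) with x' = xpr x and x_N = xlast x;
   snoc x' t is the point (x', t). *)
Definition xpr d (x : 'rV[R]_d.+1) : 'rV[R]_d := col' ord_max x.
Definition xlast d (x : 'rV[R]_d.+1) : R := x 0 ord_max.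
Definition snoc d (x' : 'rV[R]_d) (t : R) : 'rV[R]_d.+1 :=
  \row_i if unlift ord_max i is Some j then x' 0 j else t.

Lemma snocK d (z : 'rV[R]_d * R) :
  (xpr (snoc z.1 z.2), xlast (snoc z.1 z.2)) = z.
Proof.
case: z => x' t /=; congr pair; last by rewrite /xlast mxE unlift_none.
by apply/rowP => j; rewrite !mxE liftK.
Qed.

Lemma measurable_coord n (i : 'I_n) :
  measurable_fun [set: 'rV[R]_n] (fun x => x ord0 i : R).
Proof.
move=> _ Y mY; rewrite setTI; apply: sub_sigma_algebra => /=.
rewrite -bigcup_seq/=; exists i => /=; first by rewrite mem_index_enum.
by exists Y => //; rewrite setTI.
Qed.

Lemma measurable_to_rV dd (T : measurableType dd) n (f : T -> 'rV[R]_n) :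
  (forall i, measurable_fun setT (fun x => f x ord0 i : R)) ->
  measurable_fun setT f.
Proof.
move=> mf; rewrite -[X in measurable_fun X _]setTI.
apply: measurability => // A.
rewrite -bigcup_seq/= => -[B] [i _ [C mC <-]] <-.
by rewrite !setTI; have := mf i measurableT _ mC; rewrite setTI.
Qed.

Lemma measurable_snoc d :
  measurable_fun setT (fun z : 'rV[R]_d * R => snoc z.1 z.2).
Proof.
apply: measurable_to_rV => i; case: (unliftP ord_max i) => [j|] ->.
  under eq_fun do rewrite mxE liftK.
  exact: (measurableT_comp (measurable_coord j) measurable_fst).
under eq_fun do rewrite mxE unlift_none.
exact: measurable_snd.
Qed.

Lemma measurable_unsnoc d :
  measurable_fun setT (fun x : 'rV[R]_d.+1 => (xpr x, xlast x)).
Proof.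
apply/measurable_fun_pairP; split; last exact: measurable_coord.
apply: measurable_to_rV => i; rewrite /xpr.
rewrite (_ : (fun _ => _) = fun x : 'rV[R]_d.+1 => x ord0 (lift ord_max i)).
  exact: measurable_coord.
by apply/funext => x; rewrite /= mxE.
Qed.

End coordinates.

Section lebesgue.
Context {R : realType}.
Local Notation mu := (@lebesgue_measure R).

Section step.
Variables (d : nat) (m : {sigma_finite_measure set 'rV[R]_d -> \bar R}).

Let f (z : 'rV[R]_d * measurableTypeR R) : 'rV[R]_d.+1 := snoc z.1 z.2.
Let g (x : 'rV[R]_d.+1) : 'rV[R]_d * measurableTypeR R := (xpr x, xlast x).

Let mf : measurable_fun setT f. Proof. exact: measurable_snoc. Qed.
Let mg : measurable_fun setT g. Proof. exact: measurable_unsnoc. Qed.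

Definition leb_step : set 'rV[R]_d.+1 -> \bar R := pushforward (m \x mu)%E f.

Let leb_step0 : leb_step set0 = 0%E.
Proof. by rewrite /leb_step /pushforward preimage_set0 measure0. Qed.

Let leb_step_ge0 A : (0 <= leb_step A)%E.
Proof. exact: measure_ge0. Qed.

Let leb_step_sigma_additive : semi_sigma_additive leb_step.
Proof.
move=> F mF tF mUF; rewrite /leb_step /pushforward preimage_bigcup.
apply: measure_semi_sigma_additive.
- by move=> n; rewrite -[X in measurable X]setTI; exact: mf.
- apply/trivIsetP => /= i j _ _ ij; rewrite -preimage_setI.
  by move/trivIsetP : tF => /(_ _ _ _ _ ij) ->//; rewrite preimage_set0.
- by rewrite -preimage_bigcup -[X in measurable X]setTI; exact: mf.
Qed.

HB.instance Definition _ := isMeasure.Build _ _ _ leb_step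
  leb_step0 leb_step_ge0 leb_step_sigma_additive.

Let leb_step_sigma_finite : sigma_finite setT leb_step.
Proof.
have [F TF Foo] : sigma_finite setT (m \x mu)%E.
  have /sigma_finiteP[A [TA ndA Aoo]] := sigma_finiteT m.
  have /sigma_finiteP[B [TB ndB Boo]] := sigma_finiteT mu.
  exists (fun k => A k `*` B k).
    rewrite -setXTT TA TB predeqE => -[x y]; split.
      move=> [/= [k _ Akx] [l _ Bly]]; exists (maxn k l) => //; split.
      - by move: x Akx; exact/subsetPset/ndA/leq_maxl.
      - by move: y Bly; exact/subsetPset/ndB/leq_maxr.
    by move=> [k _ []/= ? ?]; split; exists k.
  move=> k; have [? ?] := Aoo k; have [? ?] := Boo k; split.
    exact: measurableX.
  by rewrite product_measure1E// lte_mul_pinfty// ge0_fin_numE.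
exists (fun k => g @^-1` F k).
  by rewrite -preimage_bigcup -TF preimage_setT.
move=> k; have [mFk Fkoo] := Foo k; split.
  by rewrite -[X in measurable X]setTI; exact: mg.
rewrite /leb_step /pushforward -comp_preimage.
by rewrite (_ : g \o f = id) ?preimage_id//; apply/funext => z; exact: snocK.
Qed.

HB.instance Definition _ := Measure_isSigmaFinite.Build _ _ _ leb_step
  leb_step_sigma_finite.

End step.

(* Lebesgue measure on R^n, as an iterated product. *)
Fixpoint leb n : {sigma_finite_measure set 'rV[R]_n -> \bar R} :=
  if n is d.+1 then [the {sigma_finite_measure set _ -> \bar R} of leb_step (leb d)]
  else [the {sigma_finite_measure set _ -> \bar R} of \d_(0 : 'rV[R]_0)].

Lemma leb_box n (A : 'I_n -> set R) :
  (forall i, measurable (A i : set (measurableTypeR R))) ->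
  leb n [set x | forall i, A i (x 0 i)] = (\prod_(i < n) mu (A i))%E.
Proof.
elim: n A => [|d IH] A mA.
  by rewrite big_ord0 /= diracE mem_set// => -[].
pose B i := A (widen_ord (leqnSn d) i).
have mB : measurable [set x : 'rV[R]_d | forall i, B i (x 0 i)].
  rewrite (_ : [set _ | _] =
      \bigcap_(i in [set: 'I_d]) (fun x : 'rV[R]_d => x 0 i) @^-1` B i).
    apply: fin_bigcap_measurable => // i _.
    rewrite -[X in measurable X]setTI.
    exact: (@measurable_coord _ _ i measurableT _ (mA _)).
  by apply/seteqP; split => x /= Bx i; [move=> _|]; exact: Bx.
rewrite big_ord_recr/= -(IH B); last by move=> i; exact: mA.
rewrite -[RHS](product_measure1E _ _ mB (mA ord_max)).
rewrite /leb_step /pushforward; congr (_ _).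
apply/seteqP; split => -[x' t] /=.
  move=> Ax; split => [i|]; last by have := Ax ord_max; rewrite mxE unlift_none.
  have := Ax (lift ord_max i); rewrite mxE liftK/= /B.
  by congr (A _ _); apply/val_inj; rewrite /= /bump leqNgt ltn_ord.
move=> [Bx At] i; case: (unliftP ord_max i) => [j|] ->; rewrite mxE.
  rewrite liftK; have := Bx j; rewrite /B/=.
  by congr (A _ _); apply/val_inj; rewrite /= /bump leqNgt ltn_ord.
by rewrite unlift_none.
Qed.

End lebesgue.

Section hausdorff.
Context {R : realType}.

Definition diam n (A : set 'rV[R]_n) : \bar R :=
  ereal_sup [set (enorm (x - y))%:E | x in A & y in A].

(* The empty set has size 0 even for k = 0, where diam A ^+ 0 = 1. *)
Definition hsize n (k : nat) (A : set 'rV[R]_n) : \bar R :=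
  if pselect (A !=set0) then (diam A ^+ k)%E else 0%E.

Definition hausdorff_content n (k : nat) (delta : R) (A : set 'rV[R]_n) :
    \bar R :=
  ereal_inf [set (\sum_(i <oo) hsize k (U i))%E | U in
    [set U : nat -> set 'rV[R]_n |
      A `<=` \bigcup_i U i /\ forall i, (diam (U i) <= delta%:E)%E]].

Definition raw_hausdorff n (k : nat) (A : set 'rV[R]_n) : \bar R :=
  ereal_sup [set hausdorff_content k delta A | delta in [set e : R | 0 < e]].

Definition unit_cube n : set 'rV[R]_n := [set x | forall i, 0 <= x 0 i <= 1].
Arguments unit_cube : clear implicits.

(* The k-dimensional Hausdorff measure, normalised as usual so that it agrees
   with Lebesgue measure on R^k, that is, gives mass 1 to the unit cube of R^k.
   For k = 0 it is the counting measure. *)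
Definition hausdorff n (k : nat) (A : set 'rV[R]_n) : \bar R :=
  ((fine (raw_hausdorff k (unit_cube k)))^-1%:E * raw_hausdorff k A)%E.

(* |S_(d-1)|, for the unit sphere of R^d, d > 0.
   For d = 1 the sphere is {-1, 1} and this is 2, which is the constant for
   which the limits hold: n (1 - |t|)^n dt has mass 2n / (n + 1) on (-1, 1).
   The convention |S_0| := 1 would make them false. *)
Definition sphere_area (d : nat) : R :=
  fine (hausdorff d.-1 [set x : 'rV[R]_d | enorm x = 1]).

End hausdorff.

Section function_spaces.
Context {R : realType} {n : nat}.
Implicit Types (D : set 'rV[R]_n) (f g h phi : 'rV[R]_n -> R)
  (F : 'rV[R]_n -> 'rV[R]_n).

Definition supported_in D phi :=
  exists K, [/\ compact K, K `<=` D & forall x, ~ K x -> phi x = 0].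

Definition partial (i : 'I_n) phi : 'rV[R]_n -> R :=
  fun x => 'D_(delta_mx 0 i) phi x.

Definition smooth phi := forall s : seq 'I_n,
  continuous (foldr partial phi s) /\
  forall i x, derivable (foldr partial phi s) x (delta_mx 0 i).

Definition test_fun D phi := smooth phi /\ supported_in D phi.

(* div F = 0 and curl F = (d_i F_j - d_j F_i)_(i, j) = 0 in D, in the sense of
   distributions. *)
Definition div_free D F := forall phi, test_fun D phi ->
  \int[leb n]_(x in D) (\sum_(i < n) F x 0 i * partial i phi x) = 0.

Definition curl_free D F := forall (i j : 'I_n) phi, test_fun D phi ->
  \int[leb n]_(x in D) (F x 0 j * partial i phi x - F x 0 i * partial j phi x)
    = 0.

Definition in_Lp D (p : R) f := f \_ D \in Lfun (leb n) p%:E.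

(* Weak convergence in L^p(D), 1 < p < oo, with L^p'(D), p' = p / (p - 1), as
   the dual of L^p(D). *)
Definition weak_Lp_cvg D (p : R) (f : nat -> 'rV[R]_n -> R) g :=
  [/\ forall k, in_Lp D p (f k), in_Lp D p g &
      forall h, in_Lp D (p / (p - 1)) h ->
        (\int[leb n]_(x in D) (f k x * h x)) @[k --> \oo] -->
        \int[leb n]_(x in D) (g x * h x)].

Definition weak_LpN_cvg D (p : R) (f : nat -> 'rV[R]_n -> 'rV[R]_n) F :=
  forall i, weak_Lp_cvg D p (fun k x => f k x 0 i) (fun x => F x 0 i).

(* C_0(D), for D open. The values outside D are irrelevant. *)
Definition C0 D phi := {within D, continuous phi} /\
  forall e : R, 0 < e -> exists K, [/\ compact K, K `<=` D &
    forall x, D x -> ~ K x -> `|phi x| < e].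

(* The space M(D) of bounded Radon measures is the dual of C_0(D). A measure is
   given here by the functional phi |-> \int phi dmu; the terms of the sequence
   are the measures f_k dx, with f_k in L^1(D). *)
Definition weakstar_cvg D (f : nat -> 'rV[R]_n -> R)
    (mu : ('rV[R]_n -> R) -> R) :=
  (forall k, in_Lp D 1 (f k)) /\
  forall phi, C0 D phi ->
    (\int[leb n]_(x in D) (f k x * phi x)) @[k --> \oo] --> mu phi.

(* M(D)^n is a product, with the coordinates of mu as component measures. *)
Definition weakstarN_cvg D (f : nat -> 'rV[R]_n -> 'rV[R]_n)
    (mu : 'I_n -> ('rV[R]_n -> R) -> R) :=
  forall i, weakstar_cvg D (fun k x => f k x 0 i) (mu i).

End function_spaces.

(* The ambient space is R^N with N = d + 1, so that d = N - 1. *)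
Section fields.
Context {R : realType}.
Variable d : nat.

Definition Omega : set 'rV[R]_d.+1 :=
  [set x | enorm (xpr x) < 1 /\ 0 < xlast x < 1].

Definition e_N : 'rV[R]_d.+1 := delta_mx 0 ord_max.

(* phi |-> \int_0^1 phi(0, t) dt, i.e. the measure delta_{x' = 0} (x) 1 *)
Definition line_measure (phi : 'rV[R]_d.+1 -> R) : R :=
  \int[@lebesgue_measure R]_(t in `]0, 1[) phi (snoc 0 t).

Definition profile (n : nat) (r : R) : R := (1 - r) ^+ n.

(* (N - 1) / p', with p' the conjugate exponent of p *)
Definition exponent' (p : R) : R :=
  if p == 1 then 0 else d%:R / (p / (p - 1)).

Definition sigma_seq (p : R) (n : nat) (x : 'rV[R]_d.+1) : 'rV[R]_d.+1 :=
  (n%:R `^ (d%:R / p) * profile n (enorm (xpr x))) *: e_N.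

Definition eta_seq (p : R) (n : nat) (x : 'rV[R]_d.+1) : 'rV[R]_d.+1 :=
  n%:R `^ exponent' p *:
    ((derive1 (profile n) (enorm (xpr x)) * xlast x) *:
        snoc ((enorm (xpr x))^-1 *: xpr x) 0
     + profile n (enorm (xpr x)) *: e_N).

End fields.

Arguments Omega : clear implicits.
Arguments e_N {R} d.
Arguments sigma_seq {R} d p n x.
Arguments eta_seq {R} d p n x.

(* Main.v *)
(* With d = N - 1 and w the volume of the unit ball of R^d, the layer cake
   formula shows that n^d times the integral of (1 - |x'|)^n over the ball tends
   to w d! = |S_(d-1)| (d-1)!, and these profiles concentrate at the origin;
   together with Fubini this yields the limits against C_0 functions. That
   sigma_n . eta_n carries the profile with exponent 2n accounts for the factor
   1 / 2^d. The first components of eta_n are odd in x' and therefore vanish in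
   the limit, and the last one is of lower order by a factor n. In L^s, s > 1,
   both sequences are bounded and tend to 0 off the axis, which is negligible.

   Weak derivatives are treated through difference quotients and translation
   invariance, so that no integration by parts across the singular axis is
   needed: eta_n is a multiple of the gradient of u = x_N (1 - |x'|)^n, and for
   all h
     int (u(x + h e_j) - u(x)) (phi(x + h e_i) - phi(x)) dx
       = int (u(x) - u(x - h e_i)) (phi(x) - phi(x - h e_j)) dx.

   The identity |S_(d-1)| = d w for the Hausdorff measure rests on three facts:
   H^k is a multiple of Lebesgue measure on R^k by uniqueness of Haar measure;
   near its pole the gnomonic chart of the sphere is almost an isometry and
   turns spherical cones into almost Euclidean ones; and reflections carry any
   point of the sphere to the pole. *)

Require Import Defs.
From HB Require Import structures.
From mathcomp Require Import all_boot all_order all_algebra.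
From mathcomp Require Import all_classical all_reals all_analysis.
From mathcomp Require Import measurable_realfun.
From mathcomp Require Import ring lra zify.

Set Implicit Arguments.
Unset Strict Implicit.
Unset Printing Implicit Defensive.

Import Order.TTheory GRing.Theory Num.Theory.
Import numFieldNormedType.Exports.

Local Open Scope classical_set_scope.
Local Open Scope ring_scope.

(** * Lebesgue measure on R^n *)

(** The normalisation of [hausdorff] divides by the raw measure c of the unit cube. Haar uniqueness
    gives raw H^k = c leb on R^k, and the same c reappears as a factor in the raw area of the
    sphere, so it cancels: all that has to be known is 0 < c < oo. Haar uniqueness speaks of
    measures, whereas raw H^k starts as an outer measure; since the sigma-algebra of R^n is
    generated by the coordinates, Caratheodory's criterion is checked on coordinate half-spaces.

    The chart gives the area of a spherical piece of diameter at most d up to a factor (1 - d)^m,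
    with m depending only on the dimension. Such multiplicative errors survive summation over
    countably many disjoint pieces, and then d tends to 0.

    For divergence and curl, the profile and the potential of eta_n are taken on all of R^N, without
    a cut-off at the boundary of the cylinder, although 1 - |x'| is unbounded and changes sign
    there. The test function localises: with steps of size at most 1 everything happens in cubes of
    half-side at most 3, where crude bounds suffice for dominated convergence. *)

Definition push_measure d d' (T1 : measurableType d) (T2 : measurableType d')
    (R : realType) (m : {measure set T1 -> \bar R}) (f : T1 -> T2)
    (mf : measurable_fun [set: T1] f) : {measure set T2 -> \bar R} :=
  measure_function_pushforward__canonical__measure_function_Measure m mf.

Section lebesgue_affine.
Context {R : realType}.
Local Notation mu := (@lebesgue_measure R).

(** By uniqueness of Lebesgue measure it suffices to compare half-open intervals. For a < 0 the
    preimage is closed at the other end, which does not change its length. *)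
Lemma lebesgue_measure_affine (a b : R) (A : set (measurableTypeR R)) :
  a != 0 -> measurable A ->
  mu A = (`|a|%:E * mu ((fun x : R => (a * x + b)%R) @^-1` A))%E.
Proof.
move=> a0 mA.
have mf : measurable_fun [set: measurableTypeR R]
    (fun x : measurableTypeR R => (a * x + b)%R : measurableTypeR R).
  by apply: measurable_funD => //; apply: measurable_funM.
pose m := mscale (NngNum (normr_ge0 a))
(push_measure mu mf).
have H := @lebesgue_measure_unique R m.
rewrite (H _ A mA)//.
move=> X [[c d] /= cd <-]; rewrite /m/= /mscale/= /pushforward.
rewrite lebesgue_measure_itv/= lte_fin.
have [a_gt0|a_le0] := ltP 0 a.
  rewrite (_ : _ @^-1` _ = `](c - b) / a, (d - b) / a]%classic).
    rewrite lebesgue_measure_itv/= lte_fin.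
    rewrite ltr_pM2r ?invr_gt0// ltrD2r; case: ifPn => _; last by rewrite mule0.
    rewrite -!EFinB -EFinM gtr0_norm//; congr EFin; field.
    exact: lt0r_neq0.
  apply/seteqP; split => x /=; rewrite !in_itv/= => /andP[h1 h2].
    rewrite ltr_pdivrMr// ler_pdivlMr// mulrC; lra.
  move: h1 h2; rewrite ltr_pdivrMr// ler_pdivlMr// mulrC; lra.
have a_lt0 : a < 0 by rewrite lt_neqAle a0.
rewrite (_ : _ @^-1` _ = `[(d - b) / a, (c - b) / a[%classic).
  rewrite lebesgue_measure_itv/= lte_fin.
  rewrite ltr_nM2r ?invr_lt0// ltrD2r; case: ifPn => _; last by rewrite mule0.
  rewrite -!EFinB -EFinM ltr0_norm//; congr EFin; field.
  exact: ltr0_neq0.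
apply/seteqP; split => x /=; rewrite !in_itv/= => /andP[h1 h2].
  rewrite ltr_ndivlMr// ler_ndivrMr// mulrC; lra.
move: h1 h2; rewrite ltr_ndivlMr// ler_ndivrMr// mulrC; lra.
Qed.

End lebesgue_affine.

Section boxes.
Context {R : realType} (n : nat).
Local Notation mu := (@lebesgue_measure R).
Local Notation V := 'rV[R]_n.

Definition box (A : 'I_n -> set R) : set V := [set x | forall i, A i (x 0 i)].

Lemma measurable_box (A : 'I_n -> set R) :
  (forall i, measurable (A i : set (measurableTypeR R))) -> measurable (box A).
Proof.
move=> mA; rewrite (_ : box A =
    \bigcap_(i in [set: 'I_n]) (fun x : V => x 0 i) @^-1` A i).
  apply: fin_bigcap_measurable => // i _.
  rewrite -[X in measurable X]setTI.
  exact: (@measurable_coord _ _ i measurableT _ (mA _)).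
by apply/seteqP; split => x /= Bx i; [move=> _|]; exact: Bx.
Qed.

Definition boxes : set (set V) :=
  [set B | exists2 A, forall i, measurable (A i : set (measurableTypeR R)) & B = box A].

Lemma setI_closed_boxes : setI_closed boxes.
Proof.
move=> _ _ [A mA ->] [B mB ->]; exists (fun i => A i `&` B i) => [i|].
  exact: measurableI.
apply/seteqP; split => x /=; first by move=> [? ?] i; split.
by move=> AB; split => i; have [] := AB i.
Qed.

Lemma measurable_boxes : (@measurable _ V) = <<s boxes >>.
Proof.
apply/seteqP; split => [|]; last first.
  apply: smallest_sub; first exact: sigma_algebra_measurable.
  by move=> _ [A mA ->]; exact: measurable_box.
apply: smallest_sub; first exact: smallest_sigma_algebra.
move=> B; rewrite -bigcup_seq/= => -[i _ [C mC <-]].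
apply: sub_gen_smallest.
exists (fun j => if j == i then C else setT) => [j|]; first by case: ifP.
rewrite setTI; apply/seteqP; split => x /=.
  by move=> Cx j; case: eqP => // ->.
by move=> /(_ i); rewrite eqxx.
Qed.

Definition cube (k : nat) := box (fun=> `[- k%:R, k%:R]%classic).

Lemma bigcup_cube : \bigcup_k cube k = [set: V].
Proof.
apply/seteqP; split => // x _.
have [M HM] : exists M : R, forall i, `|x 0 i| <= M.
  exists (\sum_i `|x 0 i|) => i; rewrite (bigD1 i)//= lerDl.
  by apply: sumr_ge0 => *.
exists (Num.truncn M).+1 => //; rewrite /cube /box/= => i; rewrite in_itv/= -ler_norml.
by rewrite (le_trans (HM i))// ltW// truncnS_gt.
Qed.

Lemma leb_cube k : leb n (cube k) = ((2 * k%:R) ^+ n)%:E.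
Proof.
rewrite [LHS](@leb_box _ _ (fun=> `[- k%:R, k%:R]%classic))//=.
under eq_bigr do rewrite lebesgue_measure_itv/= lte_fin.
rewrite (eq_bigr (fun=> (2 * k%:R)%:E)); last first.
  move=> _ _; case: ifPn; first by move=> _; rewrite -EFinB; congr EFin; ring.
  rewrite -leNgt => k0; congr EFin.
  by rewrite (_ : k%:R = 0) ?mulr0//; apply/eqP; rewrite eq_le ler0n andbT; lra.
by rewrite prodEFin prodr_const card_ord.
Qed.

(** Boxes are stable under intersection and generate the sigma-algebra, and the cubes exhaust the
    space with finite measure. *)
Lemma leb_unique (m : {measure set V -> \bar R}) :
  (forall A : 'I_n -> set R,
     (forall i, measurable (A i : set (measurableTypeR R))) ->
     m (box A) = (\prod_(i < n) mu (A i))%E) ->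
  forall B, measurable B -> m B = leb n B.
Proof.
move=> mE; apply: (@measure_unique _ _ _ boxes cube measurable_boxes setI_closed_boxes _ bigcup_cube).
- by move=> k; exists (fun=> `[- k%:R, k%:R]%classic).
- by move=> _ [A mA ->]; rewrite mE//; apply/esym/leb_box.
- move=> k; rewrite mE// -(leb_box (A := fun=> `[- k%:R, k%:R]%classic))//.
  by rewrite [X in (X < _)%E]leb_cube ltry.
Qed.

Lemma measurable_rV_affine (a : R) (b : V) :
  measurable_fun [set: V] (fun x : V => a *: x + b).
Proof.
apply: measurable_to_rV => i; under eq_fun do rewrite !mxE.
apply: measurable_funD => //; apply: measurable_funM => //.
exact: measurable_coord.
Qed.

Lemma leb_affine (a : R) (b : V) (B : set V) : a != 0 -> measurable B ->
  leb n B = ((`|a| ^+ n)%:E * leb n ((fun x : V => (a *: x + b)%R) @^-1` B))%E.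
Proof.
move=> a0 mB; have mf := measurable_rV_affine a b.
pose m := mscale (NngNum (exprn_ge0 n (normr_ge0 a))) (push_measure (leb n) mf).
apply/esym; apply: (leb_unique (m := m)) => // A mA.
rewrite /m /= /mscale/= /pushforward.
rewrite (_ : (fun x : V => a *: x + b) @^-1` _ =
    [set x : V | forall i, ((fun t => a * t + b 0 i) @^-1` A i) (x 0 i)]); last first.
  by apply/seteqP; split => x /= h i; have := h i; rewrite !mxE.
rewrite [X in (_ * X)%E](@leb_box _ _ (fun i => (fun t => a * t + b 0 i) @^-1` A i)); last first.
  move=> i; rewrite -[X in measurable X]setTI.
  suff mfi : measurable_fun [set: measurableTypeR R]
    (fun t : measurableTypeR R => a * t + b 0 i : measurableTypeR R) by exact: mfi.
  by apply: measurable_funD => //; apply: measurable_funM.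
under [RHS]eq_bigr => i _ do rewrite (lebesgue_measure_affine (b 0 i) a0 (mA i)).
rewrite big_split/=; congr (_ * _)%E.
by rewrite prodEFin prodr_const card_ord.
Qed.

Lemma leb_translate (b : V) (B : set V) : measurable B ->
  leb n ((fun x : V => x + b) @^-1` B) = leb n B.
Proof.
move=> mB; rewrite (leb_affine b (oner_neq0 R) mB) normr1 expr1n mul1e.
by congr (leb n _); apply/seteqP; split => x /=; rewrite scale1r.
Qed.

Lemma leb_scale (a : R) (B : set V) : 0 < a -> measurable B ->
  leb n ((fun x : V => a^-1 *: x) @^-1` B) = ((a ^+ n)%:E * leb n B)%E.
Proof.
move=> a0 mB; have a'0 : a^-1 != 0 by rewrite invr_eq0 gt_eqF.
rewrite (leb_affine 0 a'0 mB) gtr0_norm ?invr_gt0// muleA -EFinM exprVn.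
rewrite divff ?expf_neq0 ?gt_eqF// mul1e.
by congr (leb n _); apply/seteqP; split => x /=; rewrite addr0.
Qed.

Lemma leb_oppr (B : set V) : measurable B -> leb n (-%R @^-1` B) = leb n B.
Proof.
move=> mB; have N10 : -1 != 0 :> R by rewrite oppr_eq0 oner_eq0.
rewrite (leb_affine 0 N10 mB) normrN1 expr1n mul1e.
by congr (leb n _); apply/seteqP; split => x /=; rewrite addr0 scaleN1r.
Qed.

End boxes.

Section euclidean_norm.
Context {R : realType} {n : nat}.
Implicit Types (x y z : 'rV[R]_n) (a : R).

Lemma dotvC x y : dotv x y = dotv y x.
Proof. by apply: eq_bigr => i _; rewrite mulrC. Qed.

Lemma dotvDl x y z : dotv (x + y) z = dotv x z + dotv y z.
Proof. by rewrite -big_split; apply: eq_bigr => i _; rewrite mxE mulrDl. Qed.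

Lemma dotvZl a x y : dotv (a *: x) y = a * dotv x y.
Proof. by rewrite /dotv mulr_sumr; apply: eq_bigr => i _; rewrite mxE mulrA. Qed.

Lemma dotvDr x y z : dotv z (x + y) = dotv z x + dotv z y.
Proof. by rewrite dotvC dotvDl !(dotvC z). Qed.

Lemma dotvZr a x y : dotv x (a *: y) = a * dotv x y.
Proof. by rewrite dotvC dotvZl dotvC. Qed.

Lemma dotvNl x y : dotv (- x) y = - dotv x y.
Proof. by rewrite -scaleN1r dotvZl mulN1r. Qed.

Lemma dotvNr x y : dotv x (- y) = - dotv x y.
Proof. by rewrite dotvC dotvNl dotvC. Qed.

Lemma dotv_ge0 x : 0 <= dotv x x.
Proof. by apply: sumr_ge0 => i _; rewrite -expr2 sqr_ge0. Qed.

Lemma sqr_enorm x : enorm x ^+ 2 = dotv x x.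
Proof. by rewrite sqr_sqrtr// dotv_ge0. Qed.

Lemma enorm_ge0 x : 0 <= enorm x.
Proof. exact: sqrtr_ge0. Qed.

Lemma ler_coord_enorm x i : `|x 0 i| <= enorm x.
Proof.
rewrite -sqrtr_sqr ler_wsqrtr// /dotv (bigD1 i)//= -expr2 lerDl.
by apply: sumr_ge0 => j _; rewrite -expr2 sqr_ge0.
Qed.

Lemma enorm_eq0 x : (enorm x == 0) = (x == 0).
Proof.
apply/eqP/eqP => [x0|->]; last first.
  by rewrite /enorm /dotv big1 ?sqrtr0// => i _; rewrite mxE mul0r.
apply/rowP => i; rewrite mxE; apply/eqP; rewrite -normr_eq0 eq_le normr_ge0 andbT.
by rewrite -x0 ler_coord_enorm.
Qed.

Lemma enorm0 : enorm (0 : 'rV[R]_n) = 0.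
Proof. by apply/eqP; rewrite enorm_eq0. Qed.

Lemma enorm_gt0 x : (0 < enorm x) = (x != 0).
Proof. by rewrite lt_def enorm_ge0 andbT enorm_eq0. Qed.

Lemma enormZ a x : enorm (a *: x) = `|a| * enorm x.
Proof.
by rewrite /enorm dotvZl dotvZr mulrA -expr2 sqrtrM ?sqr_ge0// sqrtr_sqr.
Qed.

Lemma enormN x : enorm (- x) = enorm x.
Proof. by rewrite -scaleN1r enormZ normrN1 mul1r. Qed.

Lemma enorm_distC x y : enorm (x - y) = enorm (y - x).
Proof. by rewrite -opprB enormN. Qed.

Lemma dotv_cauchy_schwarz x y : dotv x y <= enorm x * enorm y.
Proof.
have [->|y0] := eqVneq y 0.
  by rewrite enorm0 mulr0 /dotv big1// => i _; rewrite mxE mulr0.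
have c0 : 0 < dotv y y by rewrite -sqr_enorm exprn_gt0// enorm_gt0.
(* This square expands to a - b^2 / c, the squared length of the part of x orthogonal to y. *)
have := dotv_ge0 (x - (dotv x y / dotv y y) *: y).
rewrite dotvDl !dotvDr !dotvNl !dotvNr !dotvZl !dotvZr (dotvC y x).
set a := dotv x x; set b := dotv x y; set c := dotv y y => h.
have {h} bac : b ^+ 2 <= a * c.
  rewrite -subr_ge0 -(pmulr_lge0 _ (_ : 0 < c^-1)) ?invr_gt0//.
  move: h; rewrite le_eqVlt => /orP[/eqP|]; [move=> h|move=> h].
  - rewrite (_ : (a * c - _) / c = a - b ^+ 2 / c); last first.
      by field; rewrite gt_eqF.
    by rewrite [X in _ <= X](_ : _ = 0)// h; field; rewrite gt_eqF.
  - by apply/ltW; apply: lt_le_trans h _; rewrite le_eqVlt; apply/orP; left;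
      apply/eqP; field; rewrite gt_eqF.
apply: le_trans (ler_norm _) _; rewrite -(@ler_pXn2r _ 2)// ?nnegrE ?mulr_ge0 ?enorm_ge0//.
by rewrite real_normK ?num_real// exprMn !sqr_enorm.
Qed.

Lemma ler_enormD x y : enorm (x + y) <= enorm x + enorm y.
Proof.
rewrite -(@ler_pXn2r _ 2)// ?nnegrE ?addr_ge0 ?enorm_ge0//.
rewrite sqrrD !sqr_enorm dotvDl !dotvDr (dotvC y x).
have := dotv_cauchy_schwarz x y; lra.
Qed.

Lemma ler_enormB x y : enorm x - enorm y <= enorm (x - y).
Proof. by rewrite lerBlDr (le_trans _ (ler_enormD _ _))// subrK. Qed.

Lemma ler_dist_enorm x y : `|enorm x - enorm y| <= enorm (x - y).
Proof.
by rewrite ler_norml ler_enormB andbT lerNl opprB enorm_distC ler_enormB.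
Qed.

Lemma ler_enorm_sum x : enorm x <= \sum_i `|x 0 i|.
Proof.
have s0 : 0 <= \sum_i `|x 0 i| by apply: sumr_ge0.
rewrite -(@ler_pXn2r _ 2)// ?nnegrE ?enorm_ge0// sqr_enorm expr2 mulr_suml.
apply: ler_sum => i _; rewrite -expr2 -real_normK ?num_real// expr2 ler_wpM2l//.
by rewrite (bigD1 i)//= lerDl sumr_ge0.
Qed.

Lemma measurable_enorm : measurable_fun [set: 'rV[R]_n] (@enorm R n).
Proof.
have ms : measurable_fun setT (Num.sqrt : R -> R).
  by apply: continuous_measurable_fun; exact: sqrt_continuous.
apply: (measurableT_comp ms).
rewrite [X in measurable_fun _ X](_ : _ =
    fun x : 'rV[R]_n => \sum_(i < n) x 0 i * x 0 i)//.
by apply: measurable_sum => i; apply: measurable_funM; exact: measurable_coord.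
Qed.

Lemma measurable_eball (r : R) : measurable [set x : 'rV[R]_n | enorm x < r].
Proof.
rewrite (_ : [set _ | _] = (@enorm R n) @^-1` `]-oo, r[).
  by rewrite -[X in measurable X]setTI; apply: measurable_enorm.
by apply/seteqP; split => x /=; rewrite in_itv.
Qed.

End euclidean_norm.

(** * Uniqueness of translation-invariant measures *)

Section haar.
Context {R : realType} {n : nat}.
Local Notation V := 'rV[R]_n.

Lemma measurable_rVD : measurable_fun setT (fun z : V * V => z.1 + z.2).
Proof.
apply: measurable_to_rV => i; under eq_fun do rewrite mxE.
apply: measurable_funD.
  exact: (measurableT_comp (measurable_coord i) measurable_fst).
exact: (measurableT_comp (measurable_coord i) measurable_snd).
Qed.

Lemma measurable_rVN : measurable_fun setT (-%R : V -> V).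
Proof.
apply: measurable_to_rV => i; under eq_fun do rewrite mxE.
exact: (measurableT_comp _ (measurable_coord i)).
Qed.

Lemma measurable_rVB : measurable_fun setT (fun z : V * V => z.2 - z.1).
Proof.
apply: measurable_to_rV => i; under eq_fun do rewrite !mxE.
apply: measurable_funB.
  exact: (measurableT_comp (measurable_coord i) measurable_snd).
exact: (measurableT_comp (measurable_coord i) measurable_fst).
Qed.

(** Tonelli for an indicator: the product measure built from the other family of sections takes the
    same values on rectangles, so the two coincide. *)
Lemma product_measure12 d1 d2 (T1 : measurableType d1) (T2 : measurableType d2)
    (m1 : {sigma_finite_measure set T1 -> \bar R})
    (m2 : {sigma_finite_measure set T2 -> \bar R}) (E : set (T1 * T2)) :
  measurable E ->
  (\int[m1]_x m2 (xsection E x) = \int[m2]_y m1 (ysection E y))%E.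
Proof.
move=> mE; apply: (product_measure_unique (m' := (m1 \x^ m2)%E)) => // A B mA mB.
exact: product_measure2E.
Qed.

(* Tonelli applied to {(x, y) | x \in A, y - x \in Q}, after the substitution
   x |-> x + y in the inner integral. *)
Lemma haar_unique (mu : {sigma_finite_measure set V -> \bar R}) :
  (forall (b : V) (B : set V), measurable B -> mu ((fun x : V => x + b) @^-1` B) = mu B) ->
  forall A Q, measurable A -> measurable Q ->
    (mu A * leb n Q = mu (-%R @^-1` Q) * leb n A)%E.
Proof.
move=> muT A Q mA mQ.
have mNQ : measurable (-%R @^-1` Q : set V).
  by rewrite -[X in measurable X]setTI; exact: measurable_rVN.
pose E := [set z : V * V | A z.1 /\ Q (z.2 - z.1)].
pose F := [set z : V * V | Q (- z.1) /\ A (z.1 + z.2)].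
have mE : measurable E.
  apply: measurableI.
    by rewrite -[X in measurable X]setTI; exact: measurable_fst.
  by rewrite -[X in measurable X]setTI; exact: measurable_rVB.
have mF : measurable F.
  apply: measurableI.
    by rewrite -[X in measurable X]setTI; exact: (measurableT_comp measurable_rVN measurable_fst).
  by rewrite -[X in measurable X]setTI; exact: measurable_rVD.
transitivity (\int[mu]_x leb n (xsection E x))%E.
  rewrite muleC -integral_cst// integral_mkcond; apply: eq_integral => x _.
  rewrite patchE; case: ifPn => xA.
    rewrite -(leb_translate (- x) mQ); congr (leb n _).
    apply/seteqP; split => y; rewrite /xsection/= inE /E/=.
      by split => //; rewrite inE in xA.
    by case.
  rewrite (_ : xsection _ _ = set0) ?measure0//; apply/seteqP; split => // y.
  by rewrite /xsection/= inE /E/= => -[]; rewrite notin_setE in xA.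
rewrite product_measure12//.
transitivity (\int[leb n]_y mu (ysection F y))%E.
  apply: eq_integral => y _; rewrite -(muT y (ysection E y)); last exact: measurable_ysection.
  congr (mu _); apply/seteqP; split => x; rewrite /ysection/= !inE /E /F/=.
    by rewrite opprD addrCA subrr addr0 => -[? ?]; split.
  by rewrite opprD addrCA subrr addr0 => -[? ?]; split.
rewrite -product_measure12// muleC -integral_cst// [RHS]integral_mkcond.
apply: eq_integral => x _; rewrite patchE; case: ifPn => xQ.
  rewrite -(leb_translate x mA); congr (leb n _).
  apply/seteqP; split => y; rewrite /xsection/= inE /F/= addrC.
    by case.
  by split => //; rewrite inE in xQ.
rewrite (_ : xsection _ _ = set0) ?measure0//; apply/seteqP; split => // y.
by rewrite /xsection/= inE /F/= => -[]; rewrite notin_setE in xQ.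
Qed.

End haar.

Section sigma_finite_pack.
Context d (T : measurableType d) (R : realType).
Variables (mu : {measure set T -> \bar R}) (sf : sigma_finite setT mu).

(** A copy of [mu] that carries the proof [sf], so that the sigma-finite structure expected by
    [haar_unique] can be attached to it. *)
Definition sigma_finite_fun of sigma_finite setT mu : set T -> \bar R := mu.

HB.instance Definition _ := isMeasure.Build _ _ _ (sigma_finite_fun sf)
  (measure0 mu) (measure_ge0 mu) (@measure_semi_sigma_additive _ _ _ mu).

HB.instance Definition _ := Measure_isSigmaFinite.Build _ _ _
  (sigma_finite_fun sf) sf.

Definition sigma_finite_pack : {sigma_finite_measure set T -> \bar R} :=
  sigma_finite_fun sf.

End sigma_finite_pack.

Section haar_const.
Context {R : realType} {n : nat}.
Local Notation V := 'rV[R]_n.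

Lemma measurable_cube k : measurable (@cube R n k).
Proof. exact: measurable_box. Qed.

Lemma sigma_finite_cube (mu : {measure set V -> \bar R}) :
  (forall k, (mu (cube k) < +oo)%E) -> sigma_finite setT mu.
Proof.
move=> muoo; exists (@cube R n); first by rewrite bigcup_cube.
by move=> k; split; [exact: measurable_cube|exact: muoo].
Qed.

Lemma haar_unique_sigma_finite (mu : {measure set V -> \bar R}) :
  sigma_finite setT mu ->
  (forall (b : V) (B : set V), measurable B -> mu ((fun x : V => x + b) @^-1` B) = mu B) ->
  forall A Q, measurable A -> measurable Q ->
    (mu A * leb n Q = mu (-%R @^-1` Q) * leb n A)%E.
Proof. by move=> sf; exact: (@haar_unique _ _ (sigma_finite_pack sf)). Qed.

Definition eball (r : R) : set V := [set x : V | enorm x < r].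

Lemma eball_sub_cube : eball 1 `<=` cube 1.
Proof.
move=> x; rewrite /eball/= => x1 i /=.
by rewrite in_itv/= -ler_norml (le_trans (ler_coord_enorm _ _))// ltW.
Qed.

Lemma leb_eball_fin : leb n (eball 1) \is a fin_num.
Proof.
rewrite ge0_fin_numE//; apply: (@le_lt_trans _ _ (leb n (cube 1))).
  by apply: le_measure; rewrite ?inE;
    [exact: measurable_eball|exact: measurable_cube|exact: eball_sub_cube].
by rewrite leb_cube ltry.
Qed.

Lemma leb_eball_gt0 : (0 < leb n (eball 1))%E.
Proof.
pose a : R := n.+1%:R^-1.
have a0 : 0 < a by rewrite invr_gt0.
apply: (@lt_le_trans _ _ (leb n (box (fun=> `]-a, a[%classic)))).
  rewrite [X in (_ < X)%E](@leb_box _ _ (fun=> `]-a, a[%classic))//.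
  under eq_bigr do rewrite lebesgue_measure_itv/= lte_fin.
  rewrite (_ : - a < a); last by lra.
  by rewrite prodEFin lte_fin prodr_gt0// => *; lra.
apply: le_measure; rewrite ?inE; [exact: measurable_box|exact: measurable_eball|].
move=> x xa; rewrite /eball/=; apply: le_lt_trans (ler_enorm_sum _) _.
apply: (@le_lt_trans _ _ (\sum_(i < n) a)).
  apply: ler_sum => i _; have := xa i; rewrite /= in_itv/= => /andP[? ?].
  by rewrite ler_norml !ltW.
by rewrite sumr_const card_ord -mulr_natl /a ltr_pdivrMr// mul1r ltr_nat.
Qed.

(** The pushforward under T is again translation invariant, hence a multiple of Lebesgue measure;
    the unit ball is preserved by T and has positive finite measure, so the multiple is 1. Additive
    involutions cover the reflections used on the sphere. *)
Lemma leb_isometry (T : V -> V) : {morph T : x y / x + y} -> involutive T ->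
  (forall x, enorm (T x) = enorm x) -> measurable_fun setT T ->
  forall A, measurable A -> leb n (T @^-1` A) = leb n A.
Proof.
move=> TD TK Tn mT A mA.
have TpreE (B : set V) : measurable B -> measurable (T @^-1` B).
  by move=> mB; rewrite -[X in measurable X]setTI; exact: mT.
have := @haar_unique_sigma_finite (push_measure (leb n) mT) _ _ A (eball 1) mA (measurable_eball 1).
have -> : push_measure (leb n) mT (-%R @^-1` eball 1) = leb n (eball 1).
  rewrite /= /pushforward; congr (leb n _).
  by apply/seteqP; split => x; rewrite /eball/= enormN Tn.
rewrite muleC => H.
apply: (inc_inj (lee_pmul2l leb_eball_fin leb_eball_gt0)).
apply: H.
    exists (fun k => T @^-1` cube k).
      by rewrite -preimage_bigcup bigcup_cube preimage_setT.
    move=> k; split; first by apply: TpreE; exact: measurable_cube.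
    rewrite /= /pushforward -comp_preimage (_ : T \o T = id) ?preimage_id; last first.
      by apply/funext => x /=; rewrite TK.
    by rewrite leb_cube ltry.
  move=> b B mB; rewrite /= /pushforward -(leb_translate (T b) (TpreE _ mB)).
  by congr (leb n _); apply/seteqP; split => x /=; rewrite TD TK.
Qed.

End haar_const.

(** * Open sets and continuous functions are Borel *)

Section borel.
Context {R : realType} {n : nat}.
Local Notation V := 'rV[R]_n.

(** For a fixed radius these boxes form a countable cover of the space. They serve to write open
    sets as countable unions, and later to cut the sphere into small pieces. *)
Definition rat_box (q : 'rV[rat]_n) (r : R) : set V :=
  box (fun i => `]ratr (q 0 i) - r, ratr (q 0 i) + r[%classic).

Lemma measurable_rat_box q r : measurable (rat_box q r).
Proof. exact: measurable_box. Qed.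

Lemma rat_box_cover (r : R) (x : V) : 0 < r -> exists q, rat_box q r x.
Proof.
move=> r0.
have h i : exists q : rat, `|x 0 i - ratr q| < r.
  have [q] := @rat_in_itvoo _ (x 0 i - r) (x 0 i + r) ltac:(lra).
  by rewrite in_itv/= => /andP[? ?]; exists q; rewrite ltr_norml; lra.
have [f fP] := choice h.
exists (\row_i f i) => i /=; rewrite mxE in_itv/=; have := fP i.
by rewrite ltr_norml; lra.
Qed.

Lemma rat_box_dist (q : 'rV[rat]_n) (r : R) (x y : V) : rat_box q r x ->
  rat_box q r y -> forall i, `|x 0 i - y 0 i| < r *+ 2.
Proof.
move=> qx qy i; have := qx i; have := qy i; rewrite /= !in_itv/= ltr_norml.
by move=> /andP[? ?] /andP[? ?]; apply/andP; split; rewrite mulr2n; lra.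
Qed.

Lemma open_measurable_rV (A : set V) : open A -> measurable A.
Proof.
move=> oA.
pose F (p : 'rV[rat]_n * nat) : set V := rat_box p.1 p.2.+1%:R^-1.
rewrite (_ : A = \bigcup_p (if `[< F p `<=` A >] then F p else set0)); last first.
  apply/seteqP; split => x; last by move=> [p _]; case: asboolP => // pA; exact: pA.
  move=> Ax; have /nbhs_ballP[e /= e0 eA] : nbhs x A by exact: open_nbhs_nbhs.
  (* Two points of a box of radius 1 / (k + 1) differ by less than 2 / (k + 1) < e in each
     coordinate, so a box containing x stays in the ball. *)
  pose k := Num.truncn (2 * e^-1).
  have ke : 2 * k.+1%:R^-1 < e.
    rewrite ltr_pdivrMr// -ltr_pdivrMl// mulrC.
    by rewrite truncnS_gt.
  have k0 : 0 < k.+1%:R^-1 :> R by rewrite invr_gt0 ltr0Sn.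
  have [q qx] := rat_box_cover x k0.
  exists (q, k) => //; case: asboolP => // -[] y qy.
  apply: eA; split => // i j; rewrite (ord1 i) /ball/=; apply: lt_trans ke.
  by have := rat_box_dist qx qy j; rewrite -[_ *+ 2]mulr_natl.
apply: countable_bigcupT_measurable => // p.
by case: ifP => // _; exact: measurable_rat_box.
Qed.

Lemma continuous_on_measurable (D : set V) (f : V -> R) : open D ->
  {within D, continuous f} -> measurable_fun D f.
Proof.
move=> oD; rewrite continuous_open_subspace// => cf.
apply: (measurability _ (RGenOpens.measurableE R)) => // _ [_ [a [b ->]] <-].
apply: open_measurable_rV; have := @itv_open _ R a b.
move: (X in open X) => U oU; rewrite openE => x [Dx fx]; rewrite /interior.
apply: filterI; first exact: open_nbhs_nbhs.
apply: cf; first by rewrite inE.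
by apply: open_nbhs_nbhs; split.
Qed.

Lemma continuous_measurable_rV (f : V -> R) : continuous f -> measurable_fun setT f.
Proof.
by move=> cf; apply: continuous_on_measurable; [exact: openT|exact/continuous_subspaceT].
Qed.

End borel.

(** * Hausdorff measure and Lebesgue measure *)

Section double_series.
Context {R : realType}.
Local Open Scope ereal_scope.

(** Serves to merge countably many countable covers into one; the terms are nonnegative, so the
    order of summation is irrelevant. *)
Lemma nneseries_uncurry (a : nat -> nat -> \bar R) (e : nat -> nat * nat) :
  injective e -> range e = setT -> (forall i j, 0 <= a i j) ->
  \sum_(i <oo) a (e i).1 (e i).2 = \sum_(i <oo) \sum_(j <oo) a i j.
Proof.
move=> einj esurj a0.
transitivity (\esum_(i in range e) (fun z => a z.1 z.2) i).
  by rewrite -[in RHS]set_true esum_pred_image// => x y _ _ /einj.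
rewrite esurj.
pose J : nat -> set (nat * nat) := fun i => [set (i, j) | j in setT].
rewrite (_ : setT = \bigcup_k J k); last first.
  by rewrite predeqE => -[x b]; split => // _; exists x => //; exists b.
rewrite esum_bigcupT//=; last first.
  apply/trivIsetP => i j _ _ ij.
  rewrite predeqE => -[n m] /=; split => //= -[] [_] _ [<-{n} _].
  by move=> [m' _] [] /esym/eqP; rewrite (negbTE ij).
rewrite -(image_id [set: nat]) -fun_true esum_pred_image//; last first.
  by move=> n _; exact: esum_ge0.
apply: eq_eseriesr => /= j _.
rewrite -(esum_pred_image (fun z => a z.1 z.2) (pair j) predT)//=; last first.
  by move=> ? ? _ _; exact: (@can_inj _ _ _ snd).
by congr esum; rewrite predeqE => -[x b]; split; move=> [i _ <-]; exists i.
Qed.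

End double_series.

(** * Hausdorff outer measure: subadditivity, separated sets, Lipschitz images *)

Section hausdorff_outer.
Context {R : realType}.
Local Open Scope ereal_scope.

Lemma lee_expe (x y : \bar R) n : 0 <= x -> x <= y -> x ^+ n <= y ^+ n.
Proof.
move=> x0 xy; elim: n => [//|n IH]; rewrite !expeS.
by apply: lee_pmul => //; exact: expe_ge0.
Qed.

Lemma expe_mul (x y : \bar R) n : (x * y) ^+ n = x ^+ n * y ^+ n.
Proof. by elim: n => [|n IH]; rewrite ?mule1// !expeS IH muleACA. Qed.

Section size.
Context {n : nat}.
Implicit Types A B : set 'rV[R]_n.

Lemma le_diam A x y : A x -> A y -> (enorm (x - y))%:E <= diam A.
Proof. by move=> Ax Ay; apply: ereal_sup_ubound; exists x => //; exists y. Qed.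

Lemma diam_le A (r : \bar R) :
  (forall x y, A x -> A y -> (enorm (x - y))%:E <= r) -> diam A <= r.
Proof. by move=> Ar; apply: ge_ereal_sup => _ [x Ax [y Ay <-]]; exact: Ar. Qed.

Lemma diam_ge0 A : A !=set0 -> 0 <= diam A.
Proof. by move=> [x Ax]; have := le_diam Ax Ax; rewrite subrr enorm0. Qed.

Lemma subset_diam A B : A `<=` B -> diam A <= diam B.
Proof. by move=> AB; apply: diam_le => x y /AB Bx /AB; exact: le_diam. Qed.

Lemma hsize0 k : hsize k (set0 : set 'rV[R]_n) = 0.
Proof. by rewrite /hsize; case: pselect => // -[]. Qed.

Lemma hsizeE k A : A !=set0 -> hsize k A = diam A ^+ k.
Proof. by rewrite /hsize; case: pselect. Qed.

Lemma hsize_ge0 k A : 0 <= hsize k A.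
Proof.
by rewrite /hsize; case: pselect => // A0; apply: expe_ge0; exact: diam_ge0.
Qed.

Lemma subset_hsize k A B : A `<=` B -> hsize k A <= hsize k B.
Proof.
move=> AB; have [->|/set0P A0] := eqVneq A set0; first by rewrite hsize0 hsize_ge0.
have B0 : B !=set0 by case: A0 => x /AB; exists x.
by rewrite !hsizeE// lee_expe ?diam_ge0// subset_diam.
Qed.

Definition hcover (delta : R) A (U : nat -> set 'rV[R]_n) :=
  A `<=` \bigcup_i U i /\ forall i, diam (U i) <= delta%:E.

Lemma hausdorff_content_le k delta A U : hcover delta A U ->
  hausdorff_content k delta A <= \sum_(i <oo) hsize k (U i).
Proof. by move=> AU; apply: ereal_inf_lbound; exists U. Qed.

Lemma hausdorff_content_ge k delta A (r : \bar R) :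
  (forall U, hcover delta A U -> r <= \sum_(i <oo) hsize k (U i)) ->
  r <= hausdorff_content k delta A.
Proof. by move=> h; apply: le_ereal_inf_tmp => _ [U AU <-]; exact: h. Qed.

Lemma hausdorff_content_ge0 k delta A : 0 <= hausdorff_content k delta A.
Proof.
by apply: hausdorff_content_ge => U _; apply: nneseries_ge0 => *; exact: hsize_ge0.
Qed.

Lemma raw_hausdorff_ge k delta A : (0 < delta)%R ->
  hausdorff_content k delta A <= raw_hausdorff k A.
Proof. by move=> d0; apply: ereal_sup_ubound; exists delta. Qed.

Lemma raw_hausdorff_le k A (r : \bar R) :
  (forall delta : R, (0 < delta)%R -> hausdorff_content k delta A <= r) ->
  raw_hausdorff k A <= r.
Proof. by move=> h; apply: ge_ereal_sup => _ [delta d0 <-]; exact: h. Qed.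

Lemma raw_hausdorff_ge0 k A : 0 <= raw_hausdorff k A.
Proof. exact: le_trans (hausdorff_content_ge0 _ _ _) (raw_hausdorff_ge k A ltr01). Qed.

Lemma raw_hausdorff0 k : raw_hausdorff k (set0 : set 'rV[R]_n) = 0.
Proof.
apply/eqP; rewrite eq_le raw_hausdorff_ge0 andbT.
apply: raw_hausdorff_le => delta d0.
apply: le_trans (hausdorff_content_le k (U := fun=> set0) _) _.
  by split => // i; apply: diam_le.
by rewrite eseries0// => i _ _; exact: hsize0.
Qed.

Lemma subset_raw_hausdorff k A B : A `<=` B -> raw_hausdorff k A <= raw_hausdorff k B.
Proof.
move=> AB; apply: raw_hausdorff_le => delta d0.
apply: le_trans (raw_hausdorff_ge k B d0).
apply: hausdorff_content_ge => U [BU Ud]; apply: hausdorff_content_le.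
by split => //; exact: subset_trans BU.
Qed.

(** At a fixed mesh [delta], near-optimal covers of the sets [A m] with errors e / 2^(m+1) are
    merged into one cover of the union. *)
Lemma raw_hausdorff_subadd k (A : nat -> set 'rV[R]_n) :
  raw_hausdorff k (\bigcup_i A i) <= \sum_(i <oo) raw_hausdorff k (A i).
Proof.
apply: raw_hausdorff_le => delta d0.
(* Near-optimal covers exist only when the contents are finite, so an infinite term is treated
   apart. *)
have [[i ioo]|] := pselect (exists i, raw_hausdorff k (A i) = +oo).
  rewrite (eseries_pinfty _ _ ioo) ?leey// => m _.
  by rewrite -ltNye (lt_le_trans _ (raw_hausdorff_ge0 _ _)).
rewrite -forallNE => Aoo.
suff add2e (e : {posnum R}) : hausdorff_content k delta (\bigcup_i A i) <=
    \sum_(i <oo) raw_hausdorff k (A i) + e%:num%:E.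
  by apply/lee_addgt0Pr => _/posnumP[].
rewrite (le_trans _ (epsilon_trick _ _ _))//; last first.
  by move=> m; exact: raw_hausdorff_ge0.
pose P m (B : (set 'rV[R]_n)^nat) := hcover delta (A m) B /\
  \sum_(j <oo) hsize k (B j) <= raw_hausdorff k (A m) + (e%:num / (2 ^ m.+1)%:R)%:E.
have [G PG] : {G : ((set 'rV[R]_n)^nat)^nat & forall m, P m (G m)}.
  apply: (@choice _ _ P) => m; rewrite /P.
  have cfin : hausdorff_content k delta (A m) \is a fin_num.
    rewrite ge0_fin_numE ?hausdorff_content_ge0//.
    apply: le_lt_trans (raw_hausdorff_ge k _ d0) _.
    by rewrite ltey; apply/eqP; exact: Aoo.
  have en1 : (0 < e%:num / (2 ^ m.+1)%:R)%R by [].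
  have [x [B AB <-] h] := lb_ereal_inf_adherent en1 cfin.
  exists B; split => //; apply: le_trans (ltW h) _.
  by rewrite leeD2r//; exact: raw_hausdorff_ge.
have /card_esym/ppcard_eqP[f] := card_nat2.
apply: le_trans (hausdorff_content_le k (U := fun i => G (f i).1 (f i).2) _) _.
  split => [x [i _ /(PG i).1.1[j _ Gx]]|i]; last exact: (PG _).1.2.
  by exists (f^-1%FUN (i, j)) => //; rewrite invK ?inE.
rewrite (nneseries_uncurry (a := fun i j => hsize k (G i j))) => [|//||*]; last 2 first.
- exact: image_eq.
- exact: hsize_ge0.
apply: lee_nneseries => [i _ _|i _].
  by apply: nneseries_ge0 => *; exact: hsize_ge0.
exact: (PG i).2.
Qed.

HB.instance Definition _ (k : nat) := isOuterMeasure.Build R 'rV[R]_n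
  (raw_hausdorff k) (raw_hausdorff0 k) (raw_hausdorff_ge0 k)
  (@subset_raw_hausdorff k) (@raw_hausdorff_subadd k).

(** A set of diameter less than r cannot meet both A and B, so a fine cover of the union splits into
    a cover of A and a cover of B. *)
Lemma raw_hausdorff_separated k (r : R) A B : (0 < r)%R ->
  (forall x y, A x -> B y -> (r <= enorm (x - y))%R) ->
  raw_hausdorff k A + raw_hausdorff k B <= raw_hausdorff k (A `|` B).
Proof.
move=> r0 ABr.
have key (d1 d2 : R) : (0 < d1)%R -> (0 < d2)%R ->
    hausdorff_content k d1 A + hausdorff_content k d2 B <= raw_hausdorff k (A `|` B).
  (* Half of r makes the mesh strictly smaller than the gap; the other two terms make the cover
     admissible for both contents. *)
  move=> d10 d20; pose delta := (Num.min (r / 2) (Num.min d1 d2))%R.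
  have dr : (delta < r)%R by rewrite /delta gt_min; apply/orP; left; lra.
  have d0 : (0 < delta)%R by rewrite /delta !lt_min d10 d20 !andbT divr_gt0.
  apply: le_trans (raw_hausdorff_ge k _ d0).
  apply: hausdorff_content_ge => U [ABU Ud].
  apply: (@le_trans _ _ (\sum_(i <oo) (hsize k (U i `&` A) + hsize k (U i `&` B)))).
    rewrite nneseriesD; [|by move=> *; exact: hsize_ge0..].
    apply: leeD; apply: hausdorff_content_le; split.
    - by move=> x Ax; have [i _ Ux] := ABU x (or_introl Ax); exists i.
    - move=> i; apply: le_trans (subset_diam (@subIsetl _ _ _)) _.
      by apply: le_trans (Ud i) _; rewrite lee_fin /delta !ge_min lexx !orbT.
    - by move=> x Bx; have [i _ Ux] := ABU x (or_intror Bx); exists i.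
    - move=> i; apply: le_trans (subset_diam (@subIsetl _ _ _)) _.
      by apply: le_trans (Ud i) _; rewrite lee_fin /delta !ge_min lexx !orbT.
  apply: lee_nneseries => [i _ _|i _]; first by rewrite adde_ge0 ?hsize_ge0.
  have [UA0|/set0P[x [Ux Ax]]] := eqVneq (U i `&` A) set0.
    by rewrite UA0 hsize0 add0e; apply: subset_hsize; exact: subIsetl.
  rewrite (_ : U i `&` B = set0).
    by rewrite hsize0 adde0; apply: subset_hsize; exact: subIsetl.
  apply/seteqP; split => // y [Uy By].
  have := le_trans (le_diam Ux Uy) (Ud i); rewrite lee_fin => h.
  by have := le_lt_trans (le_trans (ABr _ _ Ax By) h) dr; rewrite ltxx.
have [->|/eqP Boo] := eqVneq (raw_hausdorff k (A `|` B)) +oo; first by rewrite leey.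
have fin (X : set 'rV[R]_n) : X `<=` A `|` B -> forall d : R, (0 < d)%R ->
    hausdorff_content k d X \is a fin_num.
  move=> XAB d d0; rewrite ge0_fin_numE ?hausdorff_content_ge0//.
  apply: le_lt_trans (raw_hausdorff_ge k _ d0) _.
  by apply: le_lt_trans (subset_raw_hausdorff _ XAB) _; rewrite ltey; apply/eqP.
have rfin (X : set 'rV[R]_n) : X `<=` A `|` B -> raw_hausdorff k X \is a fin_num.
  move=> XAB; rewrite ge0_fin_numE ?raw_hausdorff_ge0//.
  by apply: le_lt_trans (subset_raw_hausdorff _ XAB) _; rewrite ltey; apply/eqP.
have sA : A `<=` A `|` B by left.
have sB : B `<=` A `|` B by right.
(* The suprema over d1 and d2 are taken one after the other, with the remaining term moved to the
   right-hand side; finiteness makes the subtraction legitimate. *)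
rewrite -leeBrDr ?rfin//; apply: raw_hausdorff_le => d1 d10.
rewrite leeBrDr ?rfin// addeC -leeBrDr ?fin//; apply: raw_hausdorff_le => d2 d20.
by rewrite leeBrDr ?fin// addeC; exact: key.
Qed.

End size.

(** The images of the pieces of a cover of A cover f(A) with diameters multiplied by at most L; mesh
    d for the image thus corresponds to mesh d / L for A. The pieces are first cut down to A, where
    the Lipschitz bound holds. *)
Lemma raw_hausdorff_lipschitz m n k (f : 'rV[R]_m -> 'rV[R]_n) (L : R) (A : set 'rV[R]_m) :
  (0 < L)%R ->
  (forall x y, A x -> A y -> (enorm (f x - f y) <= L * enorm (x - y))%R) ->
  raw_hausdorff k (f @` A) <= (L ^+ k)%:E * raw_hausdorff k A.
Proof.
move=> L0 fL; apply: raw_hausdorff_le => d d0.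
have L'0 : (0 < L^-1 * d)%R by rewrite mulr_gt0// invr_gt0.
have Lk0 : (0 < L ^+ k)%R by exact: exprn_gt0.
apply: (@le_trans _ _ ((L ^+ k)%:E * hausdorff_content k (L^-1 * d) A)); last first.
  by rewrite lee_pmul2l// raw_hausdorff_ge.
rewrite -lee_pdivrMl//; apply: hausdorff_content_ge => U [AU Ud].
rewrite lee_pdivrMl// -nneseriesZl//; last by move=> *; exact: hsize_ge0.
have dfU i : diam (f @` (U i `&` A)) <= L%:E * diam (U i `&` A).
  apply: diam_le => _ _ [x [Ux Ax] <-] [y [Uy Ay] <-].
  apply: (@le_trans _ _ (L%:E * (enorm (x - y))%:E)); first by rewrite -EFinM lee_fin fL.
  by rewrite lee_pmul2l// le_diam.
apply: le_trans (hausdorff_content_le k (U := fun i => f @` (U i `&` A)) _) _.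
  split=> [_ [x Ax <-]|i].
    by have [i _ Ux] := AU x Ax; exists i => //; exists x.
  apply: le_trans (dfU i) _; rewrite -lee_pdivlMl// -EFinM.
  by apply: le_trans (subset_diam (@subIsetl _ _ _)) _; exact: Ud.
apply: lee_nneseries => [i _ _|i _]; first exact: hsize_ge0.
apply: (@le_trans _ _ ((L ^+ k)%:E * hsize k (U i `&` A))); last first.
  by rewrite lee_pmul2l// subset_hsize.
have [->|/set0P UA0] := eqVneq (U i `&` A) set0; first by rewrite image_set0 !hsize0 mule0.
have fUA0 : f @` (U i `&` A) !=set0 by case: UA0 => x ?; exists (f x); exists x.
by rewrite !hsizeE// EFin_expe -expe_mul lee_expe// diam_ge0.
Qed.

End hausdorff_outer.

(** * Caratheodory measurability of Borel sets *)

Section hausdorff_borel.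
Context {R : realType} {n : nat} (k : nat).
Local Open Scope ereal_scope.
Local Notation H := (@raw_hausdorff R n k).

(** The gap r may shrink with m, since each step of the induction separates [S m] only from the
    finitely many sets before it. *)
Lemma raw_hausdorff_sum_separated (S : nat -> set 'rV[R]_n) (X : set 'rV[R]_n) :
  (forall m, exists2 r : R, (0 < r)%R & forall l x y, (l < m)%N -> S l x -> S m y ->
    (r <= enorm (x - y))%R) ->
  (forall l, S l `<=` X) ->
  forall m, \sum_(l < m) H (S l) <= H X.
Proof.
move=> sep SX m.
suff : \sum_(l < m) H (S l) <= H (\bigcup_(l in `I_m) S l).
  by move=> h; apply: le_trans h _; apply: subset_raw_hausdorff => x [l _ /SX].
elim: m => [|m IH]; first by rewrite big_ord0 raw_hausdorff_ge0.
rewrite big_ord_recr/=; have [r r0 sepr] := sep m.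
apply: (@le_trans _ _ (H (\bigcup_(l in `I_m) S l) + H (S m))); first exact: leeD2r.
apply: le_trans (raw_hausdorff_separated (r := r) _ r0 _) _.
  by move=> x y [l /= lm Sx] Sy; exact: sepr lm Sx Sy.
apply: subset_raw_hausdorff => x [[l /= lm Sx]|Sx]; last by exists m => /=.
by exists l => //=; rewrite ltnS ltnW.
Qed.

(* Caratheodory's criterion: the slabs between the levels t + 1/(l+1) with l of
   a given parity are separated, so the total measure of all slabs is finite and
   what is left above t below a low level is negligible. *)
Lemma halfspace_caratheodory (i : 'I_n) (t : R) :
  H.-caratheodory [set x : 'rV[R]_n | (t < x ord0 i)%R].
Proof.
pose lev (l : nat) : R := (l.+1%:R^-1)%R.
have lev0 l : (0 < lev l)%R by rewrite invr_gt0 ltr0Sn.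
have levS (l m : nat) : (l < m)%N -> (lev m < lev l)%R.
  by move=> lm; rewrite ltf_pV2 ?posrE ?ltr0Sn// ltr_nat.
have levW (l m : nat) : (l <= m)%N -> (lev m <= lev l)%R.
  by move=> lm; rewrite lef_pV2 ?posrE ?ltr0Sn// ler_nat.
have dist (x y : 'rV[R]_n) : (x ord0 i - y ord0 i <= enorm (x - y))%R.
  have := ler_coord_enorm (x - y) i; rewrite !mxE; apply: le_trans.
  exact: ler_norm.
apply: le_caratheodory_measurable => X; set A := [set x | _].
have [Xoo|Xoo] := eqVneq (H X) +oo; first by rewrite [leRHS]Xoo leey.
suff : H (X `&` A) + H (X `&` ~` A) <= H X by exact.
have Xfin : H X \is a fin_num.
  by rewrite ge0_fin_numE ?raw_hausdorff_ge0// ltey.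
pose S l := X `&` [set x | (t + lev l.+1 < x ord0 i <= t + lev l)%R].
have SX l : S l `<=` X by move=> x [].
have sepS p m : exists2 r : R, (0 < r)%R & forall l x y, (l < m)%N ->
    S (l.*2 + p)%N x -> S (m.*2 + p)%N y -> (r <= enorm (x - y))%R.
  case: m => [|m]; first by exists 1%R.
  (* The gap is the height of the skipped slab, the one with index 2 m + p + 1. *)
  exists (lev (m.*2 + p).+1 - lev (m.*2 + p).+2)%R; first by rewrite subr_gt0 levS.
  move=> l x y lm [_ /= /andP[xl _]] [_ /= /andP[_ yl]].
  apply: le_trans (dist x y).
  have := levW (l.*2 + p).+1 (m.*2 + p).+1 ltac:(lia).
  by move: yl; rewrite doubleS !addSn; lra.
have evenodd m : \sum_(l < m.*2) H (S l) =
    \sum_(l < m) H (S (l.*2 + 0)%N) + \sum_(l < m) H (S (l.*2 + 1)%N).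
  elim: m => [|m IH]; first by rewrite !big_ord0 adde0.
  by rewrite doubleS !big_ord_recr/= IH -addeA addeACA addn0 addn1.
have Sfin : \sum_(l <oo) H (S l) < +oo.
  apply: (@le_lt_trans _ _ (H X + H X)); last by rewrite -ge0_fin_numE ?adde_ge0 ?raw_hausdorff_ge0// fin_numD Xfin.
  apply: lime_le; first by apply: is_cvg_nneseries => *; exact: raw_hausdorff_ge0.
  apply: nearW => m; rewrite big_mkord.
  apply: (@le_trans _ _ (\sum_(l < m.*2) H (S l))).
    apply: (@lee_sum_nneg_ord _ (fun l => H (S l)) xpredT); last by lia.
    by move=> *; exact: raw_hausdorff_ge0.
  have half p : \sum_(l < m) H (S (l.*2 + p)%N) <= H X.
    by apply: (@raw_hausdorff_sum_separated (fun l => S (l.*2 + p)%N)) => // l; exact: SX.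
  by rewrite evenodd leeD.
have step j : H (X `&` A) + H (X `&` ~` A) <= H X + \sum_(j <= l <oo) H (S l).
  pose Aj := X `&` [set x | (t + lev j < x ord0 i)%R].
  have XA : H (X `&` A) <= H Aj + \sum_(j <= l <oo) H (S l).
    apply: (@le_trans _ _ (H (Aj `|` \bigcup_(l in ~` `I_j) S l))).
      apply: subset_raw_hausdorff => x [Xx]; rewrite /A/= => tx.
      have [|xj] := ltP (t + lev j)%R (x ord0 i); first by left.
      right.
      have ex : exists m, (t + lev m < x ord0 i)%R.
        exists (Num.truncn (x ord0 i - t)^-1); rewrite -ltrBrDl.
        by rewrite -[ltRHS]invrK ltf_pV2 ?posrE ?ltr0Sn ?invr_gt0 ?subr_gt0// truncnS_gt.
      have jm : (j < ex_minn ex)%N.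
        case: ex_minnP => m tm _; rewrite ltnNge; apply/negP => /levW h.
        by move: tm; rewrite ltNge => /negP; apply; lra.
      (* If m is the first index whose level lies below x, then x lies in the slab m - 1, since slab
         l reaches from level l + 1 up to level l. *)
      exists (ex_minn ex).-1; first by rewrite /=; lia.
      move: jm; case: ex_minnP => -[//|m] tm minm jm /=; split => //=.
      rewrite tm/= leNgt; apply/negP => /minm; lia.
    apply: le_trans (outer_measureU2 H _ _) _.
    by rewrite leeD2l// (outer_measure_sigma_subadditive_tail H).
  apply: (@le_trans _ _ (H Aj + H (X `&` ~` A) + \sum_(j <= l <oo) H (S l))).
    by rewrite addeAC leeD2r.
  apply: leeD2r; apply: le_trans (raw_hausdorff_separated (r := lev j) _ (lev0 j) _) _.
    move=> x y [_ /= xj] [_ /negP]; rewrite -leNgt => yt.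
    by apply: le_trans (dist x y); lra.
  by apply: subset_raw_hausdorff => x [] [].
have tail : \sum_(j <= l <oo) H (S l) @[j --> \oo] --> 0.
  by apply: nneseries_tail_cvg => // *; exact: raw_hausdorff_ge0.
have tail' : H X + \sum_(j <= l <oo) H (S l) @[j --> \oo] --> H X.
  rewrite -[X in _ --> X]adde0.
  by apply: cvgeD; [exact: fin_num_adde_defr|exact: cvg_cst|exact: tail].
rewrite -(cvg_lim _ tail')//; apply: lime_ge; first by apply/cvg_ex; exists (H X).
by apply: nearW => j; exact: step.
Qed.

(** The Caratheodory sets form a sigma-algebra, and the Borel sets are generated by the preimages of
    rays under the coordinates. *)
Lemma borel_caratheodory (A : set 'rV[R]_n) : measurable A -> H.-caratheodory A.
Proof.
move: A; suff sub : (@measurable _ 'rV[R]_n) `<=` H.-cara.-measurable by exact: sub.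
apply: smallest_sub; first exact: sigma_algebra_measurable.
move=> B; rewrite -bigcup_seq/= => -[i _ [C mC <-]].
suff mf : measurable_fun [set: caratheodory_type H]
  (fun x : caratheodory_type H => (x : 'rV[R]_n) ord0 i : R) by exact: mf.
apply: (measurability _ (RGenOInfty.measurableE R)) => // _ [_ [t ->] <-].
rewrite setTI (_ : _ @^-1` _ = [set x : 'rV[R]_n | (t < x ord0 i)%R]).
  exact: halfspace_caratheodory.
by apply/seteqP; split => x /=; rewrite in_itv/= andbT.
Qed.

Let raw_hausdorff_sigma_additive :
  semi_sigma_additive (H : set 'rV[R]_n -> \bar R).
Proof.
move=> F mF tF mUF.
apply: (@caratheodory_measure_sigma_additive _ _ H) => // [i|].
  exact/borel_caratheodory.
exact/borel_caratheodory.
Qed.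

HB.instance Definition _ := isMeasure.Build _ _ _ H
  (raw_hausdorff0 k) (raw_hausdorff_ge0 k) raw_hausdorff_sigma_additive.

End hausdorff_borel.

(** * The k-dimensional Hausdorff measure of R^k *)

Section hausdorff_lebesgue.
Context {R : realType} (k : nat).
Local Open Scope ereal_scope.
Local Notation V := 'rV[R]_k.
Local Notation H := (@raw_hausdorff R k k).
Local Notation Q := (@unit_cube R k).

Lemma unit_cubeE : Q = box (fun=> `[0%R, 1%R]%classic).
Proof. by apply/seteqP; split => x /= h i; have := h i; rewrite /= in_itv. Qed.

Lemma measurable_unit_cube : measurable Q.
Proof. by rewrite unit_cubeE; exact: measurable_box. Qed.

Lemma leb_unit_cube : leb k Q = 1.
Proof.
rewrite unit_cubeE [LHS](@leb_box _ _ (fun=> `[0%R, 1%R]%classic))//.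
by rewrite big1// => i _; rewrite lebesgue_measure_itv/= lte_fin ltr01 sube0.
Qed.

(** The cube is cut into (m + 1)^k cells of side s = 1 / (m + 1); each has diameter at most k s, and
    the k-th powers add up to k^k whatever m is. *)
Lemma hausdorff_content_unit_cube (delta : R) : (0 < delta)%R ->
  hausdorff_content k delta Q <= (k%:R ^+ k)%:E.
Proof.
move=> d0; pose m := Num.truncn (k%:R / delta).
have m0 : (0 < m.+1%:R :> R)%R by rewrite ltr0Sn.
have md : (k%:R / m.+1%:R <= delta)%R.
  by rewrite ler_pdivrMr// mulrC -ler_pdivrMr// ltW// truncnS_gt.
pose s : R := (m.+1%:R^-1)%R.
pose cell (f : {ffun 'I_k -> 'I_m.+1}) : set V :=
  [set x | forall i, ((f i)%:R * s <= x ord0 i <= (f i)%:R * s + s)%R].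
have dcell f : diam (cell f) <= (k%:R * s)%:E.
  apply: diam_le => x y xf yf; rewrite lee_fin; apply: le_trans (ler_enorm_sum _) _.
  apply: (@le_trans _ _ (\sum_(i < k) s)%R).
    apply: ler_sum => i _; rewrite !mxE.
    have /andP[x1 x2] := xf i; have /andP[y1 y2] := yf i.
    by rewrite ler_norml; apply/andP; split; lra.
  by rewrite sumr_const card_ord mulr_natl.
have cellQ x : Q x -> exists f, cell f x.
  (* The minimum with m puts the points with a coordinate equal to 1 into the last cell. *)
  move=> Qx; exists [ffun i => inord (minn m (Num.truncn (x ord0 i * m.+1%:R)))] => i.
  have /andP[x0 x1] := Qx i.
  have xm0 : (0 <= x ord0 i * m.+1%:R)%R by rewrite mulr_ge0// ltW.
  rewrite ffunE inordK ?ltnS ?geq_minl// -[X in (_ + X)%R]mul1r -mulrDl /s.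
  rewrite ler_pdivrMr// (ler_pdivlMr _ _ m0); apply/andP; split.
    by move: xm0; rewrite -truncn_le; apply: le_trans; rewrite ler_nat geq_minr.
  rewrite natr1; case: (leqP m (Num.truncn (x ord0 i * m.+1%:R))) => [_|_].
    by rewrite -[leRHS]mul1r ler_wpM2r// ltW.
  by rewrite ltW// truncnS_gt.
pose M := #|{ffun 'I_k -> 'I_m.+1}|.
(* The finite family is continued by empty sets, whose [hsize] is 0 even for k = 0. *)
pose U j : set V := if insub j is Some j' then cell (enum_val (j' : 'I_M)) else set0.
apply: le_trans (hausdorff_content_le k (U := U) _) _.
  split=> [x /cellQ[f fx]|j]; rewrite /U.
    by exists (enum_rank f) => //; rewrite valK enum_rankK.
  case: insubP => [j' _ _|_]; last by apply: diam_le.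
  by apply: le_trans (dcell _) _; rewrite lee_fin.
rewrite (nneseries_split _ M) ?add0n; last by move=> *; exact: hsize_ge0.
rewrite [X in _ + X]eseries0 ?adde0; last first.
  by move=> j Mj _; rewrite /U insubF ?hsize0// ltnNge Mj.
rewrite big_mkord; apply: (@le_trans _ _ (\sum_(j < M) ((k%:R * s) ^+ k)%:E)).
  apply: lee_sum => j _; rewrite /U valK EFin_expe /hsize; case: pselect => c0.
    by rewrite lee_expe ?diam_ge0//; exact: dcell.
  by rewrite -EFin_expe lee_fin exprn_ge0// mulr_ge0// invr_ge0 ltW.
rewrite sumEFin lee_fin sumr_const card_ord /M card_ffun !card_ord.
rewrite -[leLHS]mulr_natl natrX -exprMn /s mulrCA divff ?mulr1//.
Qed.

Lemma raw_hausdorff_unit_cube_fin : H Q \is a fin_num.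
Proof.
rewrite ge0_fin_numE ?raw_hausdorff_ge0//.
apply: le_lt_trans (ltry ((k%:R : R) ^+ k)).
by apply: raw_hausdorff_le => delta; exact: hausdorff_content_unit_cube.
Qed.

(** A set of diameter r lies in a box of side 2 r around any of its points, so its k-th power size
    is at least 2^(-k) times the volume of that box. Since the boxes cover the unit cube, every
    cover has total size at least 2^(-k). *)
Lemma raw_hausdorff_unit_cube_gt0 : 0 < H Q.
Proof.
apply: lt_le_trans (raw_hausdorff_ge k Q ltr01).
apply: (@lt_le_trans _ _ ((2 ^+ k)^-1%:E)); first by rewrite lte_fin invr_gt0 exprn_gt0.
apply: hausdorff_content_ge => U [QU Ud].
rewrite -[leLHS]mule1 lee_pdivrMl ?exprn_gt0//.
rewrite -leb_unit_cube -nneseriesZl; last by move=> *; exact: hsize_ge0.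
have /choice[c cP] : forall i, exists c : V, U i !=set0 -> U i c.
  by move=> i; have [[x Ux]|] := pselect (U i !=set0); [exists x|exists 0%R].
have dfin i : U i !=set0 -> diam (U i) = (fine (diam (U i)))%:E.
  move=> Ui; rewrite fineK// ge0_fin_numE ?diam_ge0//.
  exact: le_lt_trans (Ud i) (ltry _).
pose r i := fine (diam (U i)).
pose B i : set V := if pselect (U i !=set0) then
  box (fun j => `[(c i ord0 j - r i)%R, (c i ord0 j + r i)%R]%classic) else set0.
have mB i : measurable (B i).
  by rewrite /B; case: pselect => ?; [exact: measurable_box|exact: measurable0].
have UB i : U i `<=` B i.
  move=> x Ux; have Ui : U i !=set0 by exists x.
  rewrite /B; case: pselect => // ? j; rewrite /= in_itv/= -ler_distlC.
  have h : (enorm (c i - x) <= r i)%R.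
    by rewrite -lee_fin -(dfin _ Ui) le_diam//; exact: cP.
  apply: le_trans h.
  by have := ler_coord_enorm (c i - x) j; rewrite !mxE.
apply: (@le_trans _ _ (leb k (\bigcup_i B i))).
  apply: le_measure; rewrite ?inE; [exact: measurable_unit_cube|exact: bigcupT_measurable|].
  by apply: subset_trans QU _; apply: subset_bigcup => i _; exact: UB.
apply: le_trans (@measure_sigma_subadditive _ _ _ (leb k) _ B mB _ _) _ => //.
  exact: bigcupT_measurable.
apply: lee_nneseries => // i _; rewrite /B; case: pselect => Ui; last first.
  by rewrite measure0 mule_ge0// ?hsize_ge0// lee_fin exprn_ge0.
rewrite [leLHS](@leb_box _ _ (fun j => `[(c i ord0 j - r i)%R, (c i ord0 j + r i)%R]%classic))//.
have ri0 : (0 <= r i)%R by rewrite fine_ge0// diam_ge0.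
rewrite hsizeE// dfin// -/(r i) -EFin_expe -EFinM -exprMn.
under eq_bigr do rewrite lebesgue_measure_itv/= lte_fin.
rewrite (eq_bigr (fun=> (2 * r i)%:E)); last first.
  move=> j _; case: ifPn => [_|]; first by rewrite -EFinB; congr EFin; ring.
  by rewrite -leNgt => ?; congr EFin; lra.
by rewrite prodEFin prodr_const card_ord.
Qed.

Lemma raw_hausdorff_isometry m n j (f : 'rV[R]_m -> 'rV[R]_n) (A : set 'rV[R]_m) :
  (forall x y, A x -> A y -> enorm (f x - f y) = enorm (x - y)) ->
  raw_hausdorff j (f @` A) <= raw_hausdorff j A.
Proof.
move=> fA; rewrite -[leRHS]mul1e -[1%R](expr1n _ j).
by apply: raw_hausdorff_lipschitz => // x y Ax Ay; rewrite mul1r fA.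
Qed.

(* Haar uniqueness applied to the k-dimensional Hausdorff measure of R^k. *)
Lemma raw_hausdorff_leb (A : set V) : measurable A -> H A = H Q * leb k A.
Proof.
move=> mA.
have := @haar_unique_sigma_finite R k [the measure _ _ of H] _ _ A Q mA measurable_unit_cube.
rewrite leb_unit_cube mule1 => ->.
- congr (_ * _); apply/eqP; rewrite eq_le; apply/andP; split.
    rewrite (_ : -%R @^-1` Q = -%R @` Q).
      by apply: raw_hausdorff_isometry => x y _ _; rewrite -opprD enormN.
    apply/seteqP; split => x /=; first by exists (- x)%R => //; rewrite opprK.
    by case=> y Qy <-; rewrite opprK.
  rewrite -[X in H X <= _](_ : -%R @` (-%R @^-1` Q) = Q).
    by apply: raw_hausdorff_isometry => x y _ _; rewrite -opprD enormN.
  apply/seteqP; split => x /=; first by case=> y Qy <-.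
  by exists (- x)%R => //; rewrite ?opprK.
- apply: sigma_finite_cube => j.
  (* The image of the unit cube is a cube with sides from -j to j + 1, which contains [cube j]; the
     ratio 2 j + 1 is positive also for j = 0. *)
  pose f (x : V) : V := ((2 * j%:R + 1) *: x - const_mx j%:R)%R.
  have L0 : (0 < 2 * j%:R + 1 :> R)%R by rewrite ltr_wpDl// mulr_ge0.
  apply: (@le_lt_trans _ _ (H (f @` Q))).
    apply: subset_raw_hausdorff => x xj.
    exists ((2 * j%:R + 1)^-1 *: (x + const_mx j%:R))%R; last first.
      by rewrite /f scalerA divff ?gt_eqF// scale1r addrK.
    move=> i; have := xj i; rewrite /= in_itv/= !mxE => /andP[x1 x2].
    by rewrite mulrC ler_pdivlMr// ler_pdivrMr// mul0r mul1r; lra.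
  apply: le_lt_trans (raw_hausdorff_lipschitz k (L := (2 * j%:R + 1)%R) L0 _) _.
    move=> x y _ _; rewrite /f opprB addrA subrK -scalerBr enormZ.
    by rewrite gtr0_norm.
  by rewrite lte_mul_pinfty// -ge0_fin_numE ?raw_hausdorff_ge0// raw_hausdorff_unit_cube_fin.
- move=> b B mB /=; apply/eqP; rewrite eq_le; apply/andP; split.
    rewrite (_ : (fun x => x + b)%R @^-1` B = (fun x => x - b)%R @` B).
      by apply: raw_hausdorff_isometry => x y _ _; rewrite opprB addrA subrK.
    apply/seteqP; split => x /=; first by exists (x + b)%R => //; rewrite addrK.
    by case=> y By <-; rewrite subrK.
  rewrite -[X in H X <= _](_ : (fun x => x + b)%R @` ((fun x => x + b)%R @^-1` B) = B).
    by apply: raw_hausdorff_isometry => x y _ _; rewrite opprD addrACA subrr addr0.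
  apply/seteqP; split => x /=; first by case=> y By <-.
  by exists (x - b)%R => //=; rewrite subrK.
Qed.

End hausdorff_lebesgue.

(** * The area of the sphere and the volume of the ball *)

Section ftc_everywhere.
Context {R : realType}.
Local Notation mu := (@lebesgue_measure R).

Lemma integral_is_derive (F f : R -> R) (a b : R) : a <= b -> continuous f ->
  (forall x : R, is_derive x 1 F (f x)) ->
  (\int[mu]_(x in `]a, b[) (f x)%:E = (F b - F a)%:E)%E.
Proof.
move=> ab cf dF.
have cF : continuous F.
  by move=> x; apply: differentiable_continuous; apply/derivable1_diffP; exact: ex_derive.
have mf (A : set R) : measurable_fun A (EFin \o f).
  apply/measurable_EFinP; apply: measurable_funTS.
  exact: continuous_measurable_fun.
move: ab; rewrite le_eqVlt => /predU1P[->|ab].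
  by rewrite subrr set_itvoo0 integral_set0.
rewrite -(@integral_itv_bndoo _ _ _ _ true false)//.
rewrite (continuous_FTC2 (F := F))// ?EFinB//.
- exact: continuous_subspaceT.
- split.
  + by move=> x _; exact: ex_derive.
  + by apply: cvg_at_right_filter; exact: cF.
  + by apply: cvg_at_left_filter; exact: cF.
- by move=> x _; rewrite derive1E derive_val.
Qed.

Lemma integral_exprn (k : nat) (a : R) : 0 <= a ->
  (\int[mu]_(x in `]0%R, a[) (x ^+ k)%:E = (a ^+ k.+1 / k.+1%:R)%:E)%E.
Proof.
move=> a0; pose F (x : R) := k.+1%:R^-1 * x ^+ k.+1.
have dF (x : R) : is_derive x 1 F (x ^+ k).
  have := is_deriveZ k.+1%:R^-1 (is_deriveX k.+1 (is_derive_id x (1 : R))).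
  rewrite fctE => h; apply: is_derive_eq h _.
  by rewrite /GRing.scale/= mulr1 mulrA mulVf ?mul1r.
rewrite (@integral_is_derive F (fun x => x ^+ k) _ _ a0 _ dF); last exact: exprn_continuous.
by rewrite /F expr0n/= mulr0 subr0 mulrC.
Qed.

Lemma is_derive_onemXn (n : nat) (x : R) :
  is_derive x 1 (fun y : R => (1 - y) ^+ n.+1) (- (n.+1%:R * (1 - x) ^+ n)).
Proof.
have := is_deriveX n.+1 (is_deriveB (is_derive_cst (1 : R) x (1 : R)) (is_derive_id x (1 : R))).
rewrite fctE => h; apply: is_derive_eq h _.
by rewrite sub0r scalerN /GRing.scale/= mulr1.
Qed.

Lemma integral_onemXn (n : nat) (a : R) : a <= 1 ->
  (\int[mu]_(x in `]a, 1%R[) (n.+1%:R * (1 - x) ^+ n)%:E = ((1 - a) ^+ n.+1)%:E)%E.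
Proof.
move=> a1; pose F (x : R) := - (1 - x) ^+ n.+1.
have dF (x : R) : is_derive x 1 F (n.+1%:R * (1 - x) ^+ n).
  by apply: is_derive_eq (is_deriveN (is_derive_onemXn n x)) _; rewrite opprK.
rewrite (@integral_is_derive F (fun x => n.+1%:R * (1 - x) ^+ n) _ _ a1 _ dF).
  by rewrite /F subrr expr0n/= oppr0 sub0r opprK.
move=> x; apply: cvgM; first exact: cvg_cst.
apply: (cvg_comp (fun x : R => 1 - x) (fun x : R => x ^+ n)); last exact: exprn_continuous.
by apply: cvgB; [exact: cvg_cst|exact: cvg_id].
Qed.

End ftc_everywhere.

Section snoc_theory.
Context {R : realType} {k : nat}.
Implicit Types (z w : 'rV[R]_k) (s t : R) (x y : 'rV[R]_k.+1).

Lemma xpr_snoc z t : xpr (snoc z t) = z.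
Proof. by have [] := snocK (z, t). Qed.

Lemma xlast_snoc z t : xlast (snoc z t) = t.
Proof. by have [] := snocK (z, t). Qed.

Lemma snoc_ordmax z t : snoc z t 0 ord_max = t.
Proof. exact: xlast_snoc. Qed.

Lemma snoc_lift z t j : snoc z t 0 (lift ord_max j) = z 0 j.
Proof. by rewrite mxE liftK. Qed.

Lemma snoc_eta x : snoc (xpr x) (xlast x) = x.
Proof.
by apply/rowP => i; case: (unliftP ord_max i) => [j|] ->;
  rewrite ?snoc_lift ?snoc_ordmax// mxE.
Qed.

Lemma snocD z w s t : snoc (z + w) (s + t) = snoc z s + snoc w t.
Proof.
by apply/rowP => i; rewrite [RHS]mxE; case: (unliftP ord_max i) => [j|] ->;
  rewrite ?snoc_lift ?snoc_ordmax// mxE.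
Qed.

Lemma snocZ a z t : snoc (a *: z) (a * t) = a *: snoc z t.
Proof.
by apply/rowP => i; rewrite [RHS]mxE; case: (unliftP ord_max i) => [j|] ->;
  rewrite ?snoc_lift ?snoc_ordmax// mxE.
Qed.

Lemma snocN z t : snoc (- z) (- t) = - snoc z t.
Proof. by rewrite -[- z]scaleN1r -[- t]mulN1r snocZ scaleN1r. Qed.

Lemma snocB z w s t : snoc (z - w) (s - t) = snoc z s - snoc w t.
Proof. by rewrite snocD snocN. Qed.

Lemma xprB x y : xpr (x - y) = xpr x - xpr y.
Proof. by apply/rowP => i; rewrite !mxE. Qed.

Lemma xprZ a x : xpr (a *: x) = a *: xpr x.
Proof. by apply/rowP => i; rewrite !mxE. Qed.

Lemma xlastB x y : xlast (x - y) = xlast x - xlast y.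
Proof. by rewrite /xlast !mxE. Qed.

Lemma xlastZ a x : xlast (a *: x) = a * xlast x.
Proof. by rewrite /xlast !mxE. Qed.

Lemma dotv_snoc z w s t : dotv (snoc z s) (snoc w t) = dotv z w + s * t.
Proof.
rewrite /dotv (bigD1 ord_max)//= !snoc_ordmax addrC; congr (_ + _).
rewrite (reindex_omap (lift ord_max) (unlift ord_max))/=.
  apply: eq_big => [j|j _]; last by rewrite !snoc_lift.
  by rewrite liftK eqxx andbT eq_sym neq_lift.
by move=> i; case: unliftP => [j|] ->//; rewrite eqxx.
Qed.

Lemma enorm_snoc z t : enorm (snoc z t) ^+ 2 = enorm z ^+ 2 + t ^+ 2.
Proof. by rewrite !sqr_enorm dotv_snoc. Qed.

Lemma enorm_snoc0 z : enorm (snoc z 0) = enorm z.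
Proof. by rewrite /enorm dotv_snoc mulr0 addr0. Qed.

Lemma ler_enorm_snoc z t : enorm z <= enorm (snoc z t).
Proof.
by rewrite -(@ler_pXn2r _ 2)// ?nnegrE ?enorm_ge0// enorm_snoc lerDl sqr_ge0.
Qed.

Lemma ler_xpr_enorm x : enorm (xpr x) <= enorm x.
Proof. by rewrite -{2}(snoc_eta x) ler_enorm_snoc. Qed.

Lemma ler_xlast_enorm x : `|xlast x| <= enorm x.
Proof. exact: ler_coord_enorm. Qed.

Lemma e_NE : e_N k = snoc 0 1 :> 'rV[R]_k.+1.
Proof.
apply/rowP => i; case: (unliftP ord_max i) => [j|] ->.
  by rewrite snoc_lift !mxE eqxx/= eq_sym (negbTE (neq_lift _ _)).
by rewrite snoc_ordmax mxE !eqxx.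
Qed.

Lemma enorm_e_N : enorm (e_N k : 'rV[R]_k.+1) = 1.
Proof.
apply/eqP; rewrite -(@eqrXn2 _ 2)// ?enorm_ge0// e_NE enorm_snoc enorm0.
by rewrite expr0n/= add0r.
Qed.

Lemma leb_slice (B : set 'rV[R]_k.+1) : measurable B ->
  (leb k.+1 B = \int[@lebesgue_measure R]_t leb k [set z | B (snoc z t)])%E.
Proof.
move=> mB; rewrite /= /leb_step /pushforward.
have mpre : measurable ((fun z : 'rV[R]_k * measurableTypeR R => snoc z.1 z.2) @^-1` B).
  by rewrite -[X in measurable X]setTI; exact: measurable_snoc.
transitivity (\int[@lebesgue_measure R]_t leb k (ysection
    ((fun z : 'rV[R]_k * measurableTypeR R => snoc z.1 z.2) @^-1` B) t))%E.
  exact: product_measure12.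
apply: eq_integral => t _; congr (leb k _).
by apply/seteqP; split => z; rewrite /ysection/= inE.
Qed.

End snoc_theory.

(** * Reflections and radial projection *)

Section householder.
Context {R : realType} {n : nat}.
Implicit Types x p e : 'rV[R]_n.

(** The reflection in the hyperplane orthogonal to p - e, and the identity for p = e. It exchanges p
    and e when they have the same length. *)
Definition householder p e x : 'rV[R]_n :=
  x - (2 * dotv (p - e) x / dotv (p - e) (p - e)) *: (p - e).

Lemma householderD p e : {morph householder p e : x y / x + y}.
Proof.
move=> x y; rewrite /householder dotvDr mulrDr mulrDl scalerDl opprD.
by rewrite addrACA.
Qed.

Lemma householder_dot p e x : dotv (householder p e x) (householder p e x) = dotv x x.
Proof.
rewrite /householder; move: (p - e) => v.
have [v0|v0] := eqVneq v 0; first by rewrite v0 !scaler0 subr0.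
have vv : dotv v v != 0 by rewrite -sqr_enorm sqrf_eq0 enorm_eq0.
rewrite dotvDl !dotvDr !dotvNl !dotvNr !dotvZl !dotvZr (dotvC x v).
by field.
Qed.

Lemma enorm_householder p e x : enorm (householder p e x) = enorm x.
Proof. by rewrite /enorm householder_dot. Qed.

Lemma householderK p e : involutive (householder p e).
Proof.
move=> x; rewrite /householder; move: (p - e) => v.
have [v0|v0] := eqVneq v 0; first by rewrite v0 !scaler0 !subr0.
have vv : dotv v v != 0 by rewrite -sqr_enorm sqrf_eq0 enorm_eq0.
rewrite dotvDr dotvNr dotvZr -addrA -opprD -scalerDl.
set a := 2 * dotv v x / _; rewrite [X in X *: _](_ : _ = 0) ?scale0r ?subr0//.
by rewrite /a; field.
Qed.

Lemma householder_map p e : enorm p = 1 -> enorm e = 1 -> householder p e p = e.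
Proof.
move=> p1 e1; rewrite /householder; set v := p - e.
have [v0|v0] := eqVneq v 0.
  by rewrite v0 scaler0 subr0; apply/eqP; rewrite -subr_eq0 -/v v0.
have vv : dotv v v != 0 by rewrite -sqr_enorm sqrf_eq0 enorm_eq0.
have pp : dotv p p = 1 by rewrite -sqr_enorm p1 expr1n.
have ee : dotv e e = 1 by rewrite -sqr_enorm e1 expr1n.
rewrite (_ : 2 * dotv v p = dotv v v).
  by rewrite divff// scale1r /v opprB addrCA subrr addr0.
by rewrite /v !dotvDl !dotvDr !dotvNl !dotvNr (dotvC e p) pp ee; ring.
Qed.

Lemma measurable_householder p e : measurable_fun setT (householder p e).
Proof.
apply: measurable_to_rV => i; under eq_fun do rewrite !mxE.
apply: measurable_funB; first exact: measurable_coord.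
apply: measurable_funM => //; apply: measurable_funM => //; apply: measurable_funM => //.
by apply: measurable_sum => j; apply: measurable_funM => //; exact: measurable_coord.
Qed.

End householder.

Section normalization.
Context {R : realType} {n : nat}.
Implicit Types (x y : 'rV[R]_n) (A : set 'rV[R]_n).

Definition nrm x : 'rV[R]_n := (enorm x)^-1 *: x.

Lemma enorm_nrm x : x != 0 -> enorm (nrm x) = 1.
Proof.
by move=> x0; rewrite enormZ ger0_norm ?invr_ge0 ?enorm_ge0// mulVf// enorm_eq0.
Qed.

Lemma nrmZ a x : 0 < a -> nrm (a *: x) = nrm x.
Proof.
by move=> a0; rewrite /nrm enormZ gtr0_norm// scalerA invfM mulrAC mulVf ?gt_eqF// mul1r.
Qed.

Lemma nrm_id x : enorm x = 1 -> nrm x = x.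
Proof. by move=> x1; rewrite /nrm x1 invr1 scale1r. Qed.

(* For a = |x|, b = |y|, c = x.y, this is 2 - 2c/(ab) <= a^2 + b^2 - 2c. *)
Lemma nrm_nonexpansive x y : 1 <= enorm x -> 1 <= enorm y ->
  enorm (nrm x - nrm y) <= enorm (x - y).
Proof.
move=> x1 y1; have cs := dotv_cauchy_schwarz x y.
rewrite -(@ler_pXn2r _ 2)// ?nnegrE ?enorm_ge0// !sqr_enorm /nrm.
rewrite !dotvDl !dotvDr !dotvNl !dotvNr !dotvZl !dotvZr (dotvC y x) -!sqr_enorm.
move: cs x1 y1; set a := enorm x; set b := enorm y; set c := dotv x y => cs a1 b1.
have a0 : a != 0 by rewrite gt_eqF// (lt_le_trans ltr01).
have b0 : b != 0 by rewrite gt_eqF// (lt_le_trans ltr01).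
have ab1 : 1 <= a * b by rewrite -[leLHS]mulr1 ler_pM.
rewrite (_ : a^-1 * _ + _ + _ = 2 * (a * b - c) / (a * b)); last first.
  by field; rewrite a0 b0.
apply: (@le_trans _ _ (2 * (a * b - c))).
  rewrite ler_pdivrMr ?(lt_le_trans ltr01)// ler_peMr//.
  by rewrite mulr_ge0// subr_ge0.
have := sqr_ge0 (a - b); rewrite sqrrB => h.
by apply: le_trans (_ : (a ^+ 2 - a * b *+ 2 + b ^+ 2) + 2 * (a * b - c) <= _); rewrite ?lerDr//; lra.
Qed.

Lemma measurable_nrm : measurable_fun setT nrm.
Proof.
apply: measurable_to_rV => i; under eq_fun do rewrite mxE.
apply: measurable_funM; last exact: measurable_coord.
under eq_fun do rewrite -powR_inv1 ?enorm_ge0//.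
exact: (measurableT_comp (measurable_powR _) measurable_enorm).
Qed.

Definition cone A : set 'rV[R]_n := [set x | 0 < enorm x < 1 /\ A (nrm x)].

Lemma measurable_cone A : measurable A -> measurable (cone A).
Proof.
move=> mA; rewrite (_ : cone A = (@enorm R n) @^-1` `]0, 1[%classic `&` nrm @^-1` A).
  apply: measurableI; rewrite -[X in measurable X]setTI.
    by apply: measurable_enorm.
  exact: measurable_nrm.
by apply/seteqP; split => x; rewrite /cone/= in_itv.
Qed.

End normalization.

(** Removes the multiplicative errors of the spherical estimates: the bound is used along d = 1 / (n
    + 2), which stays strictly below 1. *)
Lemma ler_onemX_limit (R : realType) (m : nat) (x y : R) :
  (forall d : R, 0 < d < 1 -> (1 - d) ^+ m * x <= y) -> x <= y.
Proof.
move=> xy.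
have cv : (1 - n.+2%:R^-1 : R) ^+ m * x @[n --> \oo] --> (1 - 0) ^+ m * x.
  apply: cvgM; last exact: cvg_cst.
  apply: (cvg_comp (fun n : nat => 1 - n.+2%:R^-1 : R) (fun y : R => y ^+ m)); last exact: exprn_continuous.
  apply: cvgB; first exact: cvg_cst.
  by have := @cvg_harmonic R; rewrite -(cvg_shiftS (harmonic : R^nat)).
move: cv; rewrite subr0 expr1n mul1r => cv.
rewrite -(cvg_lim _ cv)//; apply: limr_le; first by apply/cvg_ex; exists x.
apply: nearW => n; apply: xy; rewrite invr_gt0 ltr0Sn/=.
by rewrite invf_lt1 ?ltr0Sn// ltr1n.
Qed.

(** * Comparison of spherical pieces with cones *)

Section sphere.
Context {R : realType} (k : nat).
Local Notation H := (@raw_hausdorff R k.+1 k).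
Local Notation c := (raw_hausdorff k (@unit_cube R k)).
Local Notation S := [set x : 'rV[R]_k.+1 | enorm x = 1].
Local Notation e := (e_N k : 'rV[R]_k.+1).

(** The radial projection of the tangent hyperplane at the pole onto the sphere. Its inverse is the
    gnomonic chart [G]. *)
Let gam (z : 'rV[R]_k) : 'rV[R]_k.+1 := nrm (snoc z 1).

Let measurable_gam : measurable_fun setT gam.
Proof.
apply: (measurableT_comp measurable_nrm).
exact: (measurableT_comp (@measurable_snoc R k) (pair2_measurable (1 : R))).
Qed.

Let xlast_gt (d : R) (a : 'rV[R]_k.+1) : enorm (a - e) <= d -> 1 - d <= xlast a.
Proof.
move=> ad; have := le_trans (ler_xlast_enorm (a - e)) ad.
by rewrite xlastB e_NE xlast_snoc ler_norml => /andP[]; lra.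
Qed.

Let xpr_le (d : R) (a : 'rV[R]_k.+1) : enorm (a - e) <= d -> enorm (xpr a) <= d.
Proof.
move=> ad; apply: le_trans ad; apply: le_trans (ler_xpr_enorm _).
by rewrite xprB e_NE xpr_snoc subr0.
Qed.

Let G (a : 'rV[R]_k.+1) : 'rV[R]_k := (xlast a)^-1 *: xpr a.

Let snocG a : 0 < xlast a -> snoc (G a) 1 = (xlast a)^-1 *: a.
Proof. by move=> a0; rewrite -[X in _ = _ *: X](snoc_eta a) -snocZ mulVf ?gt_eqF. Qed.

Let gamG a : 0 < xlast a -> enorm a = 1 -> gam (G a) = a.
Proof. by move=> a0 a1; rewrite /gam snocG// nrmZ ?invr_gt0// nrm_id. Qed.

Let enorm_snoc1 z : 1 <= enorm (snoc z 1 : 'rV[R]_k.+1).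
Proof.
rewrite -(@ler_pXn2r _ 2)// ?nnegrE ?enorm_ge0// enorm_snoc expr1n.
by rewrite lerDr sqr_ge0.
Qed.

Let snoc1_gt0 z : 0 < enorm (snoc z 1 : 'rV[R]_k.+1).
Proof. exact: lt_le_trans ltr01 (enorm_snoc1 z). Qed.

Let gam_lip z w : enorm (gam z - gam w) <= enorm (z - w).
Proof.
apply: le_trans (nrm_nonexpansive (enorm_snoc1 z) (enorm_snoc1 w)) _.
by rewrite -snocB subrr enorm_snoc0.
Qed.

Let Ggam z : G (gam z) = z.
Proof.
rewrite /G /gam /nrm xprZ xlastZ xpr_snoc xlast_snoc mulr1 invrK scalerA divff ?scale1r//.
by rewrite gt_eqF ?snoc1_gt0.
Qed.

(** The increment of the quotient a' / a_N is split into that of the numerator and that of the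
    denominator, which contribute 1 / (1 - d) and d / (1 - d)^2 times |a - b|; the sum is exactly
    the stated constant. *)
Let G_lip (d : R) a b : 0 < d < 1 -> enorm (a - e) <= d -> enorm (b - e) <= d ->
  enorm (G a - G b) <= (1 - d)^-1 ^+ 2 * enorm (a - b).
Proof.
move=> /andP[d0 d1] ad bd; have sa := xlast_gt ad; have sb := xlast_gt bd.
have d'0 : 0 < 1 - d by lra.
have sa0 := lt_le_trans d'0 sa; have sb0 := lt_le_trans d'0 sb.
have -> : G a - G b = (xlast a)^-1 *: (xpr (a - b)) +
    ((xlast a)^-1 * (xlast b)^-1 * xlast (b - a)) *: xpr b.
  rewrite /G xprB xlastB scalerBr -addrA; congr (_ + _).
  rewrite -!scaleNr -scalerDl; congr (_ *: _).
  by field; rewrite !gt_eqF.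
apply: le_trans (ler_enormD _ _) _; rewrite !enormZ.
have ia : 0 < (xlast a)^-1 <= (1 - d)^-1.
  by rewrite invr_gt0 sa0/= lef_pV2 ?posrE.
have ib : 0 < (xlast b)^-1 <= (1 - d)^-1.
  by rewrite invr_gt0 sb0/= lef_pV2 ?posrE.
move: ia ib => /andP[ia0 ia] /andP[ib0 ib].
apply: (@le_trans _ _ ((1 - d)^-1 * enorm (a - b) + (1 - d)^-1 * (1 - d)^-1 * enorm (a - b) * d)).
  apply: lerD.
    by apply: ler_pM => //; rewrite ?normr_ge0 ?enorm_ge0 ?gtr0_norm// ler_xpr_enorm.
  apply: ler_pM; rewrite ?normr_ge0 ?enorm_ge0 ?xpr_le//.
  rewrite !normrM (gtr0_norm ia0) (gtr0_norm ib0); apply: ler_pM => //; first by rewrite mulr_ge0// ltW.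
    by apply: ler_pM => //; exact: ltW.
  by rewrite enorm_distC ler_xlast_enorm.
rewrite le_eqVlt; apply/orP; left; apply/eqP; field; rewrite gt_eqF//.
Qed.

(** The points (z, t) and (z / t, 1) lie on the same ray. At height t the cone is thus t times the
    chart image of A, cut by the unit ball. *)
Let slice_cone (A : set 'rV[R]_k.+1) (t : R) : 0 < t ->
  [set z | cone A (snoc z t)] = [set z | (gam @^-1` A) (t^-1 *: z) /\ enorm (snoc z t) < 1].
Proof.
move=> t0.
have gamE z : gam (t^-1 *: z) = nrm (snoc z t).
  by rewrite /gam -(nrmZ _ t0) -snocZ mulr1 scalerA divff ?gt_eqF// scale1r.
have pos (z : 'rV[R]_k) : 0 < enorm (snoc z t).
  by apply: lt_le_trans (ler_xlast_enorm _); rewrite xlast_snoc gtr0_norm.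
apply/seteqP; split => z; rewrite /cone/= gamE pos/=; first by case.
by case.
Qed.

Local Open Scope ereal_scope.

(* Near the pole e, the gnomonic chart a |-> a' / a_N is almost an isometry and
   turns the cone over A into an almost exact Euclidean cone of height 1. *)
Let local_estimate_pole (d : R) (A : set 'rV[R]_k.+1) : (0 < d < 1)%R ->
  measurable A -> A `<=` S -> (forall a, A a -> (enorm (a - e) <= d)%R) ->
  ((1 - d) ^+ (2 * k.+1))%:E * H A <= c * (k.+1%:R%:E * leb k.+1 (cone A)) /\
  ((1 - d) ^+ (2 * k.+1))%:E * (c * (k.+1%:R%:E * leb k.+1 (cone A))) <= H A.
Proof.
move=> d01 mA AS Ad; have /andP[d0 d1] := d01; have d'0 : (0 < 1 - d)%R by lra.
have d'1 : (1 - d <= 1)%R by lra.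
pose GA := gam @^-1` A.
have mGA : measurable GA by rewrite -[X in measurable X]setTI; exact: measurable_gam.
have Apos a : A a -> (0 < xlast a)%R.
  by move=> /Ad /xlast_gt; apply: lt_le_trans.
have c0 : 0 <= c by exact: raw_hausdorff_ge0.
have HA_le : H A <= c * leb k GA.
  rewrite -raw_hausdorff_leb// (_ : A = gam @` GA); last first.
    apply/seteqP; split => [a Aa|_ [z Az <-]//].
    by exists (G a); rewrite /GA/= gamG ?Apos//; exact: AS.
  rewrite -[leRHS]mul1e -[1%R](expr1n _ k).
  by apply: raw_hausdorff_lipschitz => // x y _ _; rewrite mul1r gam_lip.
have HA_ge : ((1 - d) ^+ (2 * k))%:E * (c * leb k GA) <= H A.
  rewrite -raw_hausdorff_leb// -lee_pdivlMl; last exact: exprn_gt0.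
  rewrite -exprVn exprM.
  apply: (@le_trans _ _ (raw_hausdorff k (G @` A))).
    by apply: subset_raw_hausdorff => z Az; exists (gam z); last exact: Ggam.
  apply: raw_hausdorff_lipschitz; first by rewrite exprn_gt0// invr_gt0.
  by move=> x y Ax Ay; apply: G_lip => //; exact: Ad.
pose F (t : R) := leb k [set z | cone A (snoc z t)].
have mcone : measurable (cone A) by exact: measurable_cone.
have mslice (t : R) : measurable [set z | cone A (snoc z t)].
  rewrite (_ : [set _ | _] = (fun z => snoc z t) @^-1` cone A)//.
  rewrite -[X in measurable X]setTI.
  suff : measurable_fun setT (fun z : 'rV[R]_k => snoc z t) by exact.
  exact: (measurableT_comp (@measurable_snoc R k) (pair2_measurable t)).
have mscale (t : R) : measurable ((fun z : 'rV[R]_k => t^-1 *: z)%R @^-1` GA).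
  rewrite -[X in measurable X]setTI.
  suff : measurable_fun setT (fun z : 'rV[R]_k => t^-1 *: z)%R by exact.
  by have := measurable_rV_affine t^-1 (0%R : 'rV[R]_k); under eq_fun do rewrite addr0.
have mF : measurable_fun [set: R] F.
  rewrite (_ : F = fun t => leb k (ysection ((fun z : 'rV[R]_k * measurableTypeR R =>
      snoc z.1 z.2) @^-1` cone A) t)).
    apply: measurable_fun_ysection; rewrite -[X in measurable X]setTI.
    exact: measurable_snoc.
  apply/funext => t; congr (leb k _).
  by apply/seteqP; split => z; rewrite /ysection/= inE.
have F_le (t : R) : (0 < t)%R -> F t <= (t ^+ k)%:E * leb k GA.
  move=> t0; rewrite -leb_scale// /F slice_cone//.
  apply: le_measure; rewrite ?inE//; last by move=> z [].
  by rewrite -slice_cone.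
(* Below height 1 - d the ball cuts nothing off: directions in A have last coordinate at least 1 -
   d, so |(z, t)| <= t / (1 - d) < 1. *)
have F_ge (t : R) : (0 < t < 1 - d)%R -> F t = (t ^+ k)%:E * leb k GA.
  move=> /andP[t0 td]; rewrite -leb_scale// /F slice_cone//; congr (leb k _).
  apply/seteqP; split => z /=; [by case|move=> Az; split => //].
  have s0 : (0 < enorm (snoc z t))%R.
    by apply: lt_le_trans (ler_xlast_enorm _); rewrite xlast_snoc gtr0_norm.
  have := xlast_gt (Ad _ Az); rewrite /gam -(nrmZ _ t0) -snocZ mulr1 scalerA divff ?gt_eqF//.
  rewrite scale1r /nrm xlastZ xlast_snoc mulrC ler_pdivlMr// => h.
  rewrite -(ltr_pM2l d'0) mulr1; exact: le_lt_trans h td.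
have F_out (t : R) : ~~ (0 < t < 1)%R -> F t = 0.
  move=> t01; rewrite /F (_ : [set _ | _] = set0) ?measure0//.
  apply/seteqP; split => // z [/andP[s0 s1] Az]; apply: (negP t01).
  have := Apos _ Az; rewrite /nrm xlastZ xlast_snoc pmulr_rgt0 ?invr_gt0// => t0.
  rewrite t0/=; apply: le_lt_trans s1; apply: le_trans (ler_xlast_enorm _).
  by rewrite xlast_snoc ler_norm.
have int_k (a : R) : (0 <= a)%R ->
    \int[@lebesgue_measure R]_(t in `]0%R, a[) ((t ^+ k)%:E * leb k GA) =
    (a ^+ k.+1 / k.+1%:R)%:E * leb k GA.
  move=> a0; rewrite ge0_integralZr//; first by rewrite integral_exprn.
  - by apply/measurable_EFinP; exact: measurable_funX.
  - by move=> t; rewrite /= in_itv/= => /andP[/ltW t0 _]; rewrite lee_fin exprn_ge0.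
have vol_le : k.+1%:R%:E * leb k.+1 (cone A) <= leb k GA.
  rewrite leb_slice//; apply: (@le_trans _ _ (k.+1%:R%:E *
      (\int[@lebesgue_measure R]_(t in `]0%R, 1%R[) ((t ^+ k)%:E * leb k GA)))).
    rewrite lee_pmul2l// [leRHS]integral_mkcond; apply: ge0_le_integral => //.
    - have mI : measurable (`]0%R, 1%R[%classic : set (measurableTypeR R)) by [].
      apply/(measurable_restrictT _ mI); apply: emeasurable_funM => //.
      by apply/measurable_EFinP; exact: measurable_funX.
    - move=> t _; rewrite patchE; case: ifPn; rewrite ?inE ?notin_setE/= in_itv/=.
        by move=> /andP[t0 _]; exact: F_le.
      by move=> /negP /F_out; rewrite /F => ->.
  by rewrite int_k// expr1n muleA -EFinM mulrA mulr1 divff// mul1e.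
have vol_ge : ((1 - d) ^+ k.+1)%:E * leb k GA <= k.+1%:R%:E * leb k.+1 (cone A).
  rewrite leb_slice//; apply: (@le_trans _ _ (k.+1%:R%:E *
      (\int[@lebesgue_measure R]_(t in `]0%R, (1 - d)%R[) ((t ^+ k)%:E * leb k GA)))).
    by rewrite (int_k _ (ltW d'0)) muleA -EFinM mulrCA divff// mulr1 lexx.
  rewrite lee_pmul2l//.
  have -> : \int[@lebesgue_measure R]_(t in `]0%R, (1 - d)%R[) ((t ^+ k)%:E * leb k GA) =
      \int[@lebesgue_measure R]_(t in `]0%R, (1 - d)%R[) F t.
    by apply: eq_integral => t; rewrite inE/= in_itv/= => /F_ge ->.
  by apply: ge0_subset_integral => // t _; exact: measure_ge0.
have q0 m : (0 <= (1 - d) ^+ m)%R by rewrite exprn_ge0// ltW.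
have qle m1 m2 : (m1 <= m2)%N -> ((1 - d) ^+ m2 <= (1 - d) ^+ m1)%R.
  by apply: ler_wiXn2l => //; exact: ltW.
(* The chart costs the factor (1 - d)^(2 k) in one direction and the slices cost (1 - d)^(k + 1) in
   the other; both are absorbed into the common exponent 2 (k + 1). *)
split.
  apply: (@le_trans _ _ (((1 - d) ^+ k.+1)%:E * H A)).
    by apply: lee_wpmul2r; rewrite ?raw_hausdorff_ge0// lee_fin qle// leq_pmull.
  apply: (@le_trans _ _ (((1 - d) ^+ k.+1)%:E * (c * leb k GA))).
    by apply: lee_wpmul2l; rewrite ?lee_fin.
  by rewrite muleCA; apply: lee_wpmul2l.
apply: (@le_trans _ _ (((1 - d) ^+ (2 * k))%:E * (c * leb k GA))) => //.
apply: lee_pmul; rewrite ?lee_fin// ?mule_ge0//; first by rewrite qle// leq_mul2l leqnSn orbT.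
exact: lee_wpmul2l.
Qed.

(** The reflection commutes with [nrm] and so carries cones to cones; it preserves H as an isometry
    and Lebesgue measure by [leb_isometry]. *)
Let local_estimate (d : R) (A : set 'rV[R]_k.+1) : (0 < d < 1)%R ->
  measurable A -> A `<=` S -> (forall a b, A a -> A b -> (enorm (a - b) <= d)%R) ->
  ((1 - d) ^+ (2 * k.+1))%:E * H A <= c * (k.+1%:R%:E * leb k.+1 (cone A)) /\
  ((1 - d) ^+ (2 * k.+1))%:E * (c * (k.+1%:R%:E * leb k.+1 (cone A))) <= H A.
Proof.
move=> d01 mA AS Ad.
have [A0|/set0P[p Ap]] := eqVneq A set0.
  have cone0 : cone (set0 : set 'rV[R]_k.+1) = set0.
    by apply/seteqP; split => x // [].
  by rewrite A0 cone0 raw_hausdorff0 measure0 !mule0.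
pose T := householder p e.
have Tp : T p = e by apply: householder_map; [exact: AS|exact: enorm_e_N].
have TD : {morph T : x y / (x + y)%R} by exact: householderD.
have TK : involutive T by exact: householderK.
have Tn x : enorm (T x) = enorm x by exact: enorm_householder.
have mT : measurable_fun setT T by exact: measurable_householder.
have T0 : T 0%R = 0%R by apply/eqP; rewrite -enorm_eq0 Tn enorm0.
have TN x : T (- x)%R = (- T x)%R.
  by apply/eqP; rewrite -subr_eq0 opprK -TD addNr T0.
have Tdist x y : enorm (T x - T y) = enorm (x - y) by rewrite -TN -TD Tn.
have Tnrm x : nrm (T x) = T (nrm x).
  rewrite /nrm Tn; set a := (_^-1)%R; rewrite /T /householder dotvZr.
  by rewrite scalerBr scalerA; congr (_ - _ *: _)%R; ring.
pose B := T @^-1` A.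
have mB : measurable B by rewrite -[X in measurable X]setTI; exact: mT.
have BA : H B = H A.
  apply/eqP; rewrite eq_le; apply/andP; split.
    rewrite (_ : B = T @` A); first by apply: raw_hausdorff_isometry => x y _ _; exact: Tdist.
    by apply/seteqP; split => [x Bx|_ [x Ax <-]]; [exists (T x)|rewrite /B/= TK].
  rewrite -[X in H X <= _](_ : T @` B = A); first by apply: raw_hausdorff_isometry => x y _ _; exact: Tdist.
  by apply/seteqP; split => [_ [x Bx <-]//|x Ax]; exists (T x) => //; rewrite /B/= TK.
have coneBA : leb k.+1 (cone B) = leb k.+1 (cone A).
  rewrite -(leb_isometry TD TK Tn mT (measurable_cone mA)); congr (leb _ _).
  by apply/seteqP; split => x; rewrite /cone/= Tn Tnrm.
rewrite -BA -coneBA; apply: local_estimate_pole => //.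
  by move=> x Bx; rewrite /= -Tn; exact: AS.
by move=> x Bx; rewrite -Tp -Tdist TK; exact: Ad.
Qed.

Lemma measurable_sphere : measurable S.
Proof.
rewrite (_ : S = (@enorm R k.+1) @^-1` [set 1%R])//.
by rewrite -[X in measurable X]setTI; apply: measurable_enorm.
Qed.

Lemma leb_cone_sphere : leb k.+1 (cone S) = leb k.+1 (eball 1).
Proof.
have m0 : measurable [set (0%R : 'rV[R]_k.+1)].
  rewrite (_ : [set _] = (@enorm R k.+1) @^-1` [set 0%R]).
    by rewrite -[X in measurable X]setTI; apply: measurable_enorm.
  by apply/seteqP; split => x /= => [->|/eqP]; [rewrite enorm0|rewrite enorm_eq0 => /eqP].
have -> : eball 1 = cone S `|` [set (0%R : 'rV[R]_k.+1)].
  apply/seteqP; split => x; rewrite /eball/cone/=.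
    move=> x1; have [->|x0] := eqVneq x 0%R; first by right.
    by left; rewrite enorm_gt0 x0 x1; split => //; exact: enorm_nrm.
  by move=> [[/andP[]]//|->]; rewrite enorm0.
have leb0 : leb k.+1 [set (0%R : 'rV[R]_k.+1)] = 0.
  rewrite (_ : [set _] = box (fun=> [set 0%R])).
    by rewrite [LHS](@leb_box _ _ (fun=> [set 0%R]))// big_ord_recr/= lebesgue_measure_set1 mule0.
  by apply/seteqP; split => x /= => [-> i|h]; [rewrite mxE|apply/rowP => i; rewrite h mxE].
have mc : measurable (cone S) by apply: measurable_cone; exact: measurable_sphere.
rewrite measureU//; first by rewrite [X in (_ + X)%R]leb0; exact/esym/adde0.
by apply/seteqP; split => // x [[/andP[x0 _] _]] /= xx; rewrite xx enorm0 ltxx in x0.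
Qed.

(** Rational boxes, made disjoint, cut the sphere into countably many Borel pieces of diameter at
    most d; both quantities are countably additive over these pieces. *)
Let global_estimate (d : R) : (0 < d < 1)%R ->
  ((1 - d) ^+ (2 * k.+1))%:E * H S <= c * (k.+1%:R%:E * leb k.+1 (cone S)) /\
  ((1 - d) ^+ (2 * k.+1))%:E * (c * (k.+1%:R%:E * leb k.+1 (cone S))) <= H S.
Proof.
move=> d01; have /andP[d0 d1] := d01.
(* Two points of a box of radius r differ by less than 2 r in each of the k + 1 coordinates, and 2 r
   (k + 1) = d. *)
pose r : R := (d / (k.+1 * 2)%:R)%R.
have r0 : (0 < r)%R by rewrite divr_gt0// ltr0n.
pose V (i : nat) : set 'rV[R]_k.+1 :=
  if @unpickle ('rV[rat]_k.+1) i is Some q then rat_box q r else set0.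
have mV i : measurable (V i).
  by rewrite /V; case: unpickle => [q|]; [exact: measurable_rat_box|exact: measurable0].
pose D i := S `&` seqDU V i.
have mD i : measurable (D i).
  by apply: measurableI; [exact: measurable_sphere|exact: seqDU_measurable].
have DS i : D i `<=` S by move=> x [].
have tD : trivIset setT D by apply: trivIset_setIl; exact: trivIset_seqDU.
have SD : S = \bigcup_i D i.
  rewrite -setI_bigcupr -seqDU_bigcup_eq; apply/esym/setIidPl => x _.
  have [q qx] := rat_box_cover x r0.
  by exists (pickle q) => //; rewrite /V pickleK.
have Dd i a b : D i a -> D i b -> (enorm (a - b) <= d)%R.
  move=> [_ Da] [_ Db]; have := subset_seqDU Db; have := subset_seqDU Da; rewrite /V.
  case: (unpickle i) => [q qa qb|//]; apply: le_trans (ler_enorm_sum _) _.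
  apply: (@le_trans _ _ (\sum_(j < k.+1) (r *+ 2))%R).
    by apply: ler_sum => j _; have := rat_box_dist qa qb j; rewrite !mxE => /ltW.
  rewrite sumr_const card_ord -mulrnA -[leLHS]mulr_natr /r.
  by rewrite mulnC divfK.
have est i := local_estimate d01 (mD i) (@DS i) (@Dd i).
have HS : H S = \sum_(i <oo) H (D i).
  rewrite [in LHS]SD.
  have := @measure_bigcup _ _ _ [the measure _ _ of H] setT D (fun i _ => mD i) tD.
  by move=> /= ->; apply: eq_eseriesl => i; rewrite in_setT.
have coneS : leb k.+1 (cone S) = \sum_(i <oo) leb k.+1 (cone (D i)).
  rewrite (_ : cone S = \bigcup_i cone (D i)).
    rewrite measure_bigcup; first by apply: eq_eseriesl => i; rewrite in_setT.
      by move=> i _; exact: measurable_cone.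
    apply/trivIsetP => i j _ _ ij; apply/seteqP; split => // x [[_ Dix] [_ Djx]].
    by move/trivIsetP : tD => /(_ i j I I ij)/seteqP[/(_ (nrm x)) + _]; apply; split; [exact: Dix|exact: Djx].
  apply/seteqP; split => x.
    by move=> [x01 Sx]; move: (Sx); rewrite SD => -[i _ Dx]; exists i.
  by move=> [i _ [x01 /DS Sx]].
have c0 : 0 <= c by exact: raw_hausdorff_ge0.
have cfin : c \is a fin_num by exact: raw_hausdorff_unit_cube_fin.
have q0 m : (0 <= (1 - d) ^+ m)%R by rewrite exprn_ge0//; lra.
have nuE : c * (k.+1%:R%:E * leb k.+1 (cone S)) =
    \sum_(i <oo) (c * (k.+1%:R%:E * leb k.+1 (cone (D i)))).
  rewrite coneS -nneseriesZl// -(fineK cfin) -nneseriesZl// => i _.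
  by rewrite mule_ge0.
rewrite nuE HS -!nneseriesZl => [|i _|i _]; last 2 first.
- by rewrite !mule_ge0.
- exact: raw_hausdorff_ge0.
split; apply: lee_nneseries => i _; rewrite ?mule_ge0 ?lee_fin ?raw_hausdorff_ge0//.
- by have [] := est i.
- by have [] := est i.
Qed.

Lemma raw_hausdorff_sphere : H S = c * (k.+1%:R%:E * leb k.+1 (eball 1)).
Proof.
rewrite -leb_cone_sphere.
have cfin : c \is a fin_num by exact: raw_hausdorff_unit_cube_fin.
set b := _ * (_ * _); have bfin : b \is a fin_num.
  by rewrite /b !fin_numM// leb_cone_sphere leb_eball_fin.
have b0 : 0 <= b by rewrite !mule_ge0 ?raw_hausdorff_ge0.
(* The estimate at d = 1/2 already gives finiteness, which turns the inequalities into real ones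
   before the limit is taken. *)
have hfin : H S \is a fin_num.
  have d01 : (0 < 2^-1 :> R)%R && (2^-1 < 1 :> R)%R by apply/andP; split; lra.
  have [+ _] := global_estimate d01.
  rewrite -/b -lee_pdivlMl ?exprn_gt0//; last by lra.
  move=> h; rewrite ge0_fin_numE ?raw_hausdorff_ge0//; apply: le_lt_trans h _.
  by rewrite -(fineK bfin) -EFinM ltry.
have h0 : 0 <= H S by exact: raw_hausdorff_ge0.
move: global_estimate; rewrite -/b -(fineK bfin) -(fineK hfin) => est.
congr EFin; apply/eqP; rewrite eq_le; apply/andP; split; apply: (@ler_onemX_limit _ (2 * k.+1)); rewrite ?fine_ge0// => d /est[].
  by rewrite -EFinM lee_fin.
by rewrite -EFinM lee_fin.
Qed.

(** The constant c of [raw_hausdorff_sphere] is the one by which [hausdorff] divides. For k = 0 the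
    value is 2, the length of the interval from -1 to 1. *)
Lemma sphere_areaE : sphere_area k.+1 = (k.+1%:R * fine (leb k.+1 (eball 1)))%R :> R.
Proof.
have cfin : c \is a fin_num by exact: raw_hausdorff_unit_cube_fin.
have fc0 : fine c != 0%R.
  by rewrite gt_eqF// fine_gt0// raw_hausdorff_unit_cube_gt0 -ge0_fin_numE ?raw_hausdorff_ge0.
rewrite /sphere_area /hausdorff/= raw_hausdorff_sphere -(fineK cfin).
rewrite -(fineK (leb_eball_fin : leb k.+1 (eball 1) \is a fin_num)) -!EFinM/=.
by rewrite mulrA mulVf// mul1r.
Qed.

End sphere.

(** * Concentration of the profiles on the axis *)

Section bounded_integrable.
Context dd (T : measurableType dd) (R : realType) (mu : {measure set T -> \bar R}).

Lemma bounded_integrable (D : set T) (f : T -> R) (M : R) : measurable D ->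
  (mu D < +oo)%E -> measurable_fun D f -> (forall x, D x -> `|f x| <= M) ->
  mu.-integrable D (EFin \o f).
Proof.
move=> mD Doo mf fM; apply: measurable_bounded_integrable => //.
exists M; split; first exact: num_real.
by move=> K MK x Dx; apply: le_trans (fM x Dx) _; exact: ltW.
Qed.

Lemma integrable_EFinZ (D : set T) (r : R) (f : T -> R) : measurable D ->
  mu.-integrable D (EFin \o f) -> mu.-integrable D (EFin \o (fun x => r * f x)).
Proof. by move=> mD /(integrableZl mD r); apply: eq_integrable. Qed.

Lemma integrable_EFinB (D : set T) (f g : T -> R) : measurable D ->
  mu.-integrable D (EFin \o f) -> mu.-integrable D (EFin \o g) ->
  mu.-integrable D (EFin \o (fun x => f x - g x)).
Proof.
move=> mD fi gi; apply: eq_integrable (integrableB mD fi gi) => // x _.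
Qed.

End bounded_integrable.

(** * Moments of the radial profile *)

Section moments.
Context {R : realType} (d : nat).
Local Notation B := (@eball R d 1).
Local Notation w := (fine (leb d B)).
Local Notation mu := (@lebesgue_measure R).

Lemma leb_eball (r : R) : 0 <= r -> (0 < d)%N ->
  (leb d (eball r) = (r ^+ d * w)%:E)%E.
Proof.
rewrite le_eqVlt => /predU1P[<-|r0] d0.
  rewrite (_ : eball 0 = set0) ?measure0 ?expr0n ?gtn_eqF// ?mul0r//.
  by apply/seteqP; split => // x; rewrite /eball/= ltNge enorm_ge0.
rewrite EFinM fineK ?leb_eball_fin// -leb_scale//; last exact: measurable_eball.
congr (leb d _); apply/seteqP; split => x; rewrite /eball/= enormZ gtr0_norm ?invr_gt0//.
  by rewrite mulrC ltr_pdivrMr// mul1r.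
by rewrite mulrC ltr_pdivrMr// mul1r.
Qed.

Lemma eball_oo : (leb d B < +oo)%E.
Proof. by rewrite -ge0_fin_numE// leb_eball_fin. Qed.

Lemma eball_profile_itv x : B x -> 0 <= 1 - enorm x <= 1.
Proof. by rewrite /eball/= => x1; have := enorm_ge0 x; lra. Qed.

Lemma measurable_profile_enorm k (D : set 'rV[R]_d) :
  measurable_fun D (fun x : 'rV[R]_d => (1 - enorm x) ^+ k).
Proof.
apply: measurable_funTS; apply: measurable_funX; apply: measurable_funB => //.
exact: measurable_enorm.
Qed.

Definition moment (k : nat) : R := \int[leb d]_(x in B) ((1 - enorm x) ^+ k).

(* Layer cake: (1 - |x|)^(n+1) is the integral of (n+1) (1 - t)^n over
   |x| < t < 1, and the ball of radius t has volume t^d w. *)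
Lemma moment_layer_cake (n : nat) : (0 < d)%N ->
  (\int[leb d]_(x in B) ((1 - enorm x) ^+ n.+1)%:E =
   \int[mu]_(t in `]0%R, 1%R[) (n.+1%:R * (1 - t) ^+ n * (t ^+ d * w))%:E)%E.
Proof.
move=> d0.
pose E := [set z : 'rV[R]_d * measurableTypeR R | enorm z.1 < z.2 < 1].
pose h (z : 'rV[R]_d * measurableTypeR R) : \bar R :=
  ((fun z => (n.+1%:R * (1 - z.2) ^+ n)%:E) \_ E) z.
have m2 : measurable_fun setT (fun z : 'rV[R]_d * measurableTypeR R => z.2 : R).
  exact: measurable_snd.
have mE : measurable E.
  have m1 : measurable_fun setT (fun z : 'rV[R]_d * measurableTypeR R => z.2 - enorm z.1).
    apply: measurable_funB; first exact: measurable_snd.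
    exact: (measurableT_comp measurable_enorm measurable_fst).
  rewrite (_ : E = (fun z => z.2 - enorm z.1) @^-1` `]0, +oo[ `&` (fun z => z.2) @^-1` `]-oo, 1[).
    apply: measurableI; rewrite -[X in measurable X]setTI.
      exact: m1.
    exact: m2.
  apply/seteqP; split => z; rewrite /E/= !in_itv/= andbT subr_gt0.
    by move/andP.
  by move=> [-> ->].
have mh : measurable_fun setT h.
  apply/(measurable_restrictT _ mE); apply/measurable_EFinP; apply: measurable_funTS.
  apply: measurable_funM => //; apply: measurable_funX; exact: measurable_funB.
have h0 z : (0 <= h z)%E.
  rewrite /h patchE; case: ifPn => //; rewrite inE /E/= => /andP[_ z1].
  by rewrite lee_fin mulr_ge0// exprn_ge0// subr_ge0 ltW.
transitivity (\int[leb d]_x \int[mu]_t h (x, t))%E.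
  rewrite [LHS]integral_mkcond; apply: eq_integral => x _; rewrite patchE; case: ifPn => xB.
    rewrite -integral_onemXn; last by apply: ltW; rewrite inE in xB.
    rewrite integral_mkcond; apply: eq_integral => t _; rewrite /h !patchE.
    have <- : (t \in `]enorm x, 1[%classic) = ((x, t) \in E).
      by apply/idP/idP => /set_mem tI; apply/mem_set; move: tI; rewrite /E/= in_itv.
    by [].
  rewrite integral0_eq// => t _; rewrite /h patchE; case: ifPn => //.
  rewrite inE /E/= => /andP[xt t1]; move: xB; rewrite notin_setE.
  by case; rewrite /eball/=; exact: lt_trans xt t1.
rewrite (fubini_tonelli h)// [RHS]integral_mkcond.
apply: eq_integral => t _; rewrite patchE; case: ifPn => [|tI].
  rewrite inE/= in_itv/= => /andP[t0 t1].
  rewrite EFinM -leb_eball//; last exact: ltW.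
  transitivity (\int[leb d]_(x in eball t) (n.+1%:R * (1 - t) ^+ n)%:E)%E; last first.
    by rewrite integral_cst//; exact: measurable_eball.
  rewrite [RHS]integral_mkcond; apply: eq_integral => x _; rewrite /h !patchE.
  have <- : (x \in eball t) = ((x, t) \in E).
    by apply/idP/idP; rewrite !inE /E/eball/= t1 andbT.
  by [].
rewrite integral0_eq// => x _; rewrite /h patchE; case: ifPn => //.
rewrite inE /E/= => /andP[xt t1]; move: tI; rewrite notin_setE/= in_itv/= t1 andbT.
by case; exact: le_lt_trans (enorm_ge0 _) xt.
Qed.

(** After the layer cake formula the integral over t is the Beta function B(d + 1, n + 1) = d! n! /
    (d + n + 1)!. That formula concerns exponents n + 1, so exponent 0 is computed directly. *)
Lemma momentE (k : nat) : (0 < d)%N -> moment k = w * (d`! * k`!)%:R / (k + d)`!%:R.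
Proof.
move=> d0; case: k => [|n].
  rewrite /moment; under eq_Rintegral do rewrite expr0.
  rewrite Rintegral_cst ?mul1r; last exact: measurable_eball.
  by rewrite fact0 muln1 add0n mulfK// pnatr_eq0 -lt0n fact_gt0.
rewrite /moment /Rintegral moment_layer_cake//.
have -> : (\int[mu]_(t in `]0%R, 1%R[) (n.+1%:R * (1 - t) ^+ n * (t ^+ d * w))%:E =
    (n.+1%:R * w)%:E * \int[mu]_(t in `]0%R, 1%R[) (t ^+ d * (1 - t) ^+ n)%:E)%E.
  rewrite -ge0_integralZl//.
  - by apply: eq_integral => t _; rewrite -EFinM; congr EFin; ring.
  - apply/measurable_EFinP; apply: measurable_funTS; apply: measurable_funM => //.
    by apply: measurable_funX; apply: measurable_funB.
  - move=> t /=; rewrite in_itv/= => /andP[t0 t1].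
    by rewrite lee_fin mulr_ge0// exprn_ge0// ?subr_ge0 ltW.
  - by rewrite lee_fin mulr_ge0// fine_ge0.
have -> : (\int[mu]_(t in `]0%R, 1%R[) (t ^+ d * (1 - t) ^+ n)%:E = (beta_fun d.+1 n.+1)%:E)%E.
  rewrite EFin_beta_fun -(@integral_itv_bndoo _ _ _ _ true false).
    rewrite integral_mkcond; apply: eq_integral => t _.
    by rewrite !patchE; case: ifPn.
  apply/measurable_EFinP; apply: measurable_funTS; apply: measurable_funM => //.
  by apply: measurable_funX; apply: measurable_funB.
have fS : n.+1`! = (n.+1 * n`!)%N by exact: factS.
have fA : (n.+1 + d)`! = (d + n).+1`! by rewrite addSn addnC.
rewrite -EFinM [LHS]/= beta_fun_fact fS fA !natrM.
by rewrite !mulrA; congr (_ / _); ring.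
Qed.

Lemma natr_ratio_cvg (i : nat) : (n.+1%:R / (n + i.+1)%:R : R) @[n --> \oo] --> (1 : R).
Proof.
have -> : (fun n => n.+1%:R / (n + i.+1)%:R : R) = fun n => 1 - i%:R * harmonic (n + i)%N.
  apply/funext => n; rewrite /harmonic/= addnS.
  have ni : n.+1%:R + i%:R != 0 :> R by rewrite -natrD pnatr_eq0.
  by rewrite -addSn natrD -[X in X - _](divff ni); field.
rewrite -[X in _ --> X]subr0 -[X in _ - X](mulr0 i%:R).
apply: cvgB; first exact: cvg_cst.
apply: cvgM; first exact: cvg_cst.
by rewrite (cvg_shiftn i (harmonic : R^nat)); exact: cvg_harmonic.
Qed.

Lemma moment_cvg : (0 < d)%N -> (n.+1%:R ^+ d * moment n) @[n --> \oo] --> w * d`!%:R.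
Proof.
move=> d0.
(* Raising j by one multiplies the quotient by (n + 1) / (n + j + 1), which tends to 1. *)
have r : forall j, (n.+1%:R ^+ j * n`!%:R / (n + j)`!%:R : R) @[n --> \oo] --> (1 : R).
  elim=> [|j IH].
    rewrite (_ : (fun n => _) = fun=> 1); first exact: cvg_cst.
    by apply/funext => n; rewrite expr0 mul1r addn0 divff// pnatr_eq0 -lt0n fact_gt0.
  rewrite (_ : (fun n => _) = fun n => (n.+1%:R ^+ j * n`!%:R / (n + j)`!%:R : R) *
      (n.+1%:R / (n + j.+1)%:R)).
    by rewrite -[X in _ --> X]mulr1; apply: cvgM => //; exact: natr_ratio_cvg.
  apply/funext => n; rewrite addnS.
  have fS : (n + j).+1`! = ((n + j).+1 * (n + j)`!)%N by exact: factS.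
  by rewrite fS natrM exprS invfM; ring.
rewrite (_ : (fun n => _) = fun n => (w * d`!%:R) * (n.+1%:R ^+ d * n`!%:R / (n + d)`!%:R)).
  by rewrite -[X in _ --> X]mulr1; apply: cvgM => //; exact: cvg_cst.
by apply/funext => n; rewrite momentE// natrM; ring.
Qed.

(** Together with [moment_cvg] it makes n^d times the difference of two consecutive moments tend to
    0, which is the error term in [concentration]. *)
Lemma moment_next_cvg : (0 < d)%N -> (n.+1%:R ^+ d * moment n.+1) @[n --> \oo] --> w * d`!%:R.
Proof.
move=> d0.
rewrite (_ : (fun n => _) = fun n => (n.+1%:R / (n + 2)%:R) ^+ d * (n.+2%:R ^+ d * moment n.+1)).
  rewrite -[X in _ --> X]mul1r -[X in X * _](expr1n _ d).
  apply: cvgM.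
    apply: (cvg_comp (fun n : nat => n.+1%:R / (n + 2)%:R : R) (fun y : R => y ^+ d)); last exact: exprn_continuous.
    exact: natr_ratio_cvg.
  by rewrite (cvg_shiftS (fun n => n.+1%:R ^+ d * moment n)); exact: moment_cvg.
apply/funext => n; rewrite mulrA; congr (_ * _).
by rewrite -exprMn addn2 divfK.
Qed.

Lemma integrable_profile k : (leb d).-integrable B (EFin \o (fun x => (1 - enorm x) ^+ k)).
Proof.
apply: (bounded_integrable (M := 1)); [exact: measurable_eball|exact: eball_oo| |].
  exact: measurable_profile_enorm.
by move=> x /eball_profile_itv /andP[x0 x1]; rewrite normrX exprn_ile1// ger0_norm.
Qed.

(* The error is controlled by |g - L| <= e + (C / delta) |x|, and the integral of
   (1 - |x|)^k |x| is the difference of two consecutive moments. *)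
Lemma concentration (g : 'rV[R]_d -> R) (L C : R) : (0 < d)%N ->
  measurable_fun B g -> (forall x, B x -> `|g x| <= C) ->
  (forall e, 0 < e -> exists2 delta, 0 < delta & forall x, B x -> enorm x < delta -> `|g x - L| <= e) ->
  (n.+1%:R ^+ d * \int[leb d]_(x in B) ((1 - enorm x) ^+ n * g x)) @[n --> \oo] -->
    w * d`!%:R * L.
Proof.
move=> d0 mg gC gL; have mB : measurable B by exact: measurable_eball.
have C0 : 0 <= C by apply: le_trans (gC 0 _); rewrite /eball/= ?enorm0.
have ig n : (leb d).-integrable B (EFin \o (fun x => (1 - enorm x) ^+ n * (g x - L))).
  apply: (bounded_integrable (M := 1 * (C + `|L|))) => //; first exact: eball_oo.
    apply: measurable_funM; first exact: measurable_profile_enorm.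
    exact: measurable_funB.
  move=> x Bx; have /andP[x0 x1] := eball_profile_itv Bx.
  rewrite normrM; apply: ler_pM => //.
    by rewrite normrX exprn_ile1// ger0_norm.
  by apply: le_trans (ler_normB _ _) _; rewrite lerD2r gC.
have split_g n : \int[leb d]_(x in B) ((1 - enorm x) ^+ n * g x) =
    \int[leb d]_(x in B) ((1 - enorm x) ^+ n * (g x - L)) + L * moment n.
  rewrite /moment -RintegralZl//; last exact: integrable_profile.
  rewrite -RintegralD//.
    by apply: eq_Rintegral => x _; ring.
  by apply: integrable_EFinZ => //; exact: integrable_profile.
have small : (n.+1%:R ^+ d * \int[leb d]_(x in B) ((1 - enorm x) ^+ n * (g x - L))) @[n --> \oo] --> 0.
  apply/cvgrPdist_le => /= e e0.
  pose D := w * d`!%:R; have D0 : 0 <= D by rewrite mulr_ge0// fine_ge0.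
  (* After multiplication by n^d the bound tends to e1 D < e; D + 1 keeps the denominator
     positive. *)
  pose e1 := e / (2 * (D + 1)).
  have e10 : 0 < e1 by rewrite divr_gt0// mulr_gt0//; lra.
  have [delta delta0 gdelta] := gL _ e10.
  pose K := (C + `|L|) / delta.
  have K0 : 0 <= K by rewrite divr_ge0 ?addr_ge0// ltW.
  have gK x : B x -> `|g x - L| <= e1 + K * enorm x.
    move=> Bx; have [xd|dx] := ltP (enorm x) delta.
      by apply: le_trans (gdelta x Bx xd) _; rewrite lerDl mulr_ge0// enorm_ge0.
    apply: (@le_trans _ _ (C + `|L|)); first by apply: le_trans (ler_normB _ _) _; rewrite lerD2r gC.
    apply: (@le_trans _ _ (K * enorm x)); last by rewrite lerDr ltW.
    by rewrite /K -mulrA ler_peMr ?addr_ge0// mulrC ler_pdivlMr// mul1r.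
  have bound n : `|\int[leb d]_(x in B) ((1 - enorm x) ^+ n * (g x - L))| <=
      e1 * moment n + K * (moment n - moment n.+1).
    apply: le_trans (le_normr_Rintegral mB (ig n)) _.
    apply: (@le_trans _ _ (\int[leb d]_(x in B)
        ((e1 + K) * (1 - enorm x) ^+ n - K * (1 - enorm x) ^+ n.+1))).
      apply: le_Rintegral => //.
      - by apply: integrable_norm (ig n).
      - by apply: integrable_EFinB => //; apply: integrable_EFinZ => //; exact: integrable_profile.
      - move=> x Bx; have /andP[x0 x1] := eball_profile_itv Bx.
        rewrite normrM (ger0_norm (exprn_ge0 n x0)).
        apply: (@le_trans _ _ ((1 - enorm x) ^+ n * (e1 + K * enorm x))).
          by rewrite ler_wpM2l ?exprn_ge0// gK.
        by rewrite le_eqVlt; apply/orP; left; apply/eqP; rewrite exprS; ring.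
    rewrite RintegralB//; [|by apply: integrable_EFinZ => //; exact: integrable_profile..].
    rewrite !RintegralZl//; [|exact: integrable_profile..].
    by rewrite -!/(moment _); rewrite le_eqVlt; apply/orP; left; apply/eqP; ring.
  have lim : (e1 * (n.+1%:R ^+ d * moment n) + K * (n.+1%:R ^+ d * moment n - n.+1%:R ^+ d * moment n.+1))
      @[n --> \oo] --> e1 * D + K * (D - D).
    have c1 := moment_cvg d0; have c2 := moment_next_cvg d0.
    by apply: (cvgD (cvgM (cvg_cst e1) c1) (cvgM (cvg_cst K) (cvgB c1 c2))).
  have e1D : e1 * D + K * (D - D) < e.
    rewrite subrr mulr0 addr0 /e1 mulrAC ltr_pdivrMr ?mulr_gt0//; last by lra.
    by rewrite ltr_pM2l//; lra.
  have ev : \forall n \near \oo, e1 * (n.+1%:R ^+ d * moment n) +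
      K * (n.+1%:R ^+ d * moment n - n.+1%:R ^+ d * moment n.+1) < e.
    exact: (cvgr_lt _ lim).
  apply: filterS ev => n /ltW; apply: le_trans.
  rewrite sub0r normrN normrM ger0_norm ?exprn_ge0//.
  apply: le_trans (ler_wpM2l _ (bound n)) _; first exact: exprn_ge0.
  by rewrite le_eqVlt; apply/orP; left; apply/eqP; ring.
rewrite (_ : (fun n => _) = fun n =>
   n.+1%:R ^+ d * \int[leb d]_(x in B) ((1 - enorm x) ^+ n * (g x - L)) +
   (n.+1%:R ^+ d * moment n) * L).
  rewrite -[X in _ --> X]add0r; apply: cvgD => //.
  by apply: cvgM; [exact: moment_cvg|exact: cvg_cst].
by apply/funext => n; rewrite split_g; ring.
Qed.

End moments.

Section real_dominated_convergence.
Context dd (T : measurableType dd) (R : realType) (mu : {measure set T -> \bar R}).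

Lemma Rintegral_dominated_convergence (D : set T) (f_ : nat -> T -> R) (f g : T -> R) :
  measurable D -> (forall n, measurable_fun D (f_ n)) -> measurable_fun D f ->
  {ae mu, forall x, D x -> f_ n x @[n --> \oo] --> f x} ->
  mu.-integrable D (EFin \o g) ->
  (forall n x, D x -> `|f_ n x| <= g x) ->
  (\int[mu]_(x in D) f_ n x) @[n --> \oo] --> \int[mu]_(x in D) f x.
Proof.
move=> mD mf_ mf cvf ig fg.
have [||||| fint _] := @dominated_convergence _ _ _ mu D mD
  (fun n => EFin \o f_ n) (EFin \o f) (EFin \o g).
- by move=> n; exact/measurable_EFinP.
- exact/measurable_EFinP.
- apply: filterS cvf => x h Dx; apply: cvg_comp (h Dx) _; exact: cvg_id.
- exact: ig.
- by apply/aeW => x n Dx; rewrite /= lee_fin fg.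
move=> cv; apply: fine_cvg; rewrite fineK; last exact: integrable_fin_num.
exact: cv.
Qed.

End real_dominated_convergence.

(** * Fubini on the cylinder *)

Section omega.
Context {R : realType} (d : nat).
Local Notation B := (@eball R d 1).
Local Notation Om := (Omega R d).
Local Notation mu := (@lebesgue_measure R).
Local Notation I01 := (`]0%R, 1%R[%classic : set (measurableTypeR R)).

Lemma measurable_xpr : measurable_fun setT (@xpr R d).
Proof. exact: (measurableT_comp measurable_fst (@measurable_unsnoc R d)). Qed.

Lemma measurable_xlast : measurable_fun setT (@xlast R d).
Proof. exact: measurable_coord. Qed.

Lemma measurable_Omega : measurable Om.
Proof.
rewrite (_ : Om = @xpr R d @^-1` B `&` @xlast R d @^-1` I01).
  apply: measurableI; rewrite -[X in measurable X]setTI.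
    by apply: measurable_xpr => //; exact: measurable_eball.
  by apply: measurable_xlast.
by apply/seteqP; split => x; rewrite /Omega/eball/= in_itv.
Qed.

Lemma Omega_snoc z t : Om (snoc z t) = (B z /\ I01 t).
Proof. by rewrite /Omega/eball/= xpr_snoc xlast_snoc in_itv. Qed.

Lemma Omega_oo : (leb d.+1 Om < +oo)%E.
Proof.
apply: (@le_lt_trans _ _ (leb d.+1 (cube 1))); last by rewrite leb_cube ltry.
apply: le_measure; rewrite ?inE; [exact: measurable_Omega|exact: measurable_cube|].
move=> x [x1 /andP[t0 t1]] i /=; rewrite in_itv/= -ler_norml.
case: (unliftP ord_max i) => [j|] ->.
  have := ler_coord_enorm (xpr x) j; rewrite mxE => h.
  by apply: le_trans h _; exact: ltW.
by rewrite ger0_norm ltW.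
Qed.

Lemma I01_oo : (mu I01 < +oo)%E.
Proof. by rewrite lebesgue_measure_itv/= lte_fin ltr01 ltry. Qed.

Lemma Rintegral_I01_cst (c : R) : \int[mu]_(t in I01) c = c.
Proof. by rewrite Rintegral_cst//= lebesgue_measure_itv/= lte_fin ltr01/= oppr0 addr0 mulr1. Qed.

Lemma measurable_slice (f : 'rV[R]_d.+1 -> R) (z : 'rV[R]_d) :
  measurable_fun Om f -> B z -> measurable_fun I01 (fun t => f (snoc z t)).
Proof.
move=> mf Bz; apply: (@measurable_comp _ _ _ _ _ _ Om) => //; first exact: measurable_Omega.
  by move=> _ [t It <-]; rewrite Omega_snoc.
apply: measurable_funTS.
exact: (measurableT_comp (@measurable_snoc R d) (pair1_measurable z)).
Qed.

Lemma integrable_slice (f : 'rV[R]_d.+1 -> R) (M : R) (z : 'rV[R]_d) :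
  measurable_fun Om f -> (forall x, Om x -> `|f x| <= M) -> B z ->
  mu.-integrable I01 (EFin \o (fun t => f (snoc z t))).
Proof.
move=> mf fM Bz; apply: (bounded_integrable (M := M)) => //.
- exact: I01_oo.
- exact: measurable_slice.
- by move=> t It; apply: fM; rewrite Omega_snoc.
Qed.

(** Lebesgue measure is by construction the image of a product under [snoc], so the extension of f
    by 0 is pulled back to the product space. Measurability of the inner integral is part of the
    conclusion because [concentration] is applied to it. *)
Lemma Omega_fubini (f : 'rV[R]_d.+1 -> R) (M : R) :
  measurable_fun Om f -> (forall x, Om x -> `|f x| <= M) ->
  measurable_fun B (fun z => \int[mu]_(t in I01) f (snoc z t)) /\
  \int[leb d.+1]_(x in Om) f x =
  \int[leb d]_(z in B) \int[mu]_(t in I01) f (snoc z t).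
Proof.
move=> mf fM.
pose sn (z : 'rV[R]_d * measurableTypeR R) : 'rV[R]_d.+1 := snoc z.1 z.2.
have msn : measurable_fun setT sn by exact: measurable_snoc.
pose E := sn @^-1` Om.
have mE : measurable E.
  by rewrite -[X in measurable X]setTI; apply: msn => //; exact: measurable_Omega.
pose h : 'rV[R]_d * measurableTypeR R -> \bar R := (EFin \o (f \o sn)) \_ E.
have ih : (leb d \x mu)%E.-integrable setT h.
  apply/(integrable_mkcond _ mE); apply: (bounded_integrable (M := M)) => //.
  - exact: Omega_oo.
  - apply: (@measurable_comp _ _ _ _ _ _ Om) => //; first exact: measurable_Omega.
      by move=> _ [z Ez <-].
    exact: measurable_funTS.
  - by move=> z Ez; exact: fM.
have FE z : fubini_F mu h z = if z \in B then (\int[mu]_(t in I01) f (snoc z t))%:E else 0%E.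
  rewrite /fubini_F; case: ifPn => zB.
    rewrite /Rintegral fineK; last first.
      by apply: integrable_fin_num => //; apply: integrable_slice fM _ => //; rewrite inE in zB.
    rewrite [RHS]integral_mkcond; apply: eq_integral => t _; rewrite /h !patchE.
    have <- // : (t \in I01) = ((z, t) \in E).
    apply/idP/idP => /set_mem tI; apply/mem_set; move: tI; rewrite /E/sn/= Omega_snoc.
      by move=> ?; split => //; exact: set_mem.
    by case.
  rewrite integral0_eq// => t _; rewrite /h patchE; case: ifPn => //.
  by move=> /set_mem; rewrite /E/sn/= Omega_snoc => -[/mem_set]; rewrite (negbTE zB).
have mF := measurable_fubini_F ih.
split.
  apply/measurable_EFinP; have := measurable_funTS (D := B) mF.
  by apply: eq_measurable_fun => z zB; rewrite /= FE zB.
rewrite /Rintegral; congr fine.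
transitivity (\int[leb d \x mu]_z h z)%E.
  rewrite [RHS](_ : _ = \int[leb d \x mu]_(z in E) (EFin \o (f \o sn)) z)%E; last first.
    by rewrite [RHS]integral_mkcond.
  have -> : (\int[leb d.+1]_(x in Om) (f x)%:E = \int[leb d.+1]_(x in Om) ((f \_ Om) x)%:E)%E.
    by apply: eq_integral => x xO; rewrite patchE xO.
  have mfO : measurable_fun setT (EFin \o (f \_ Om)).
    by apply/measurable_EFinP; apply/(measurable_restrictT _ measurable_Omega).
  have eE z : E z -> ((EFin \o (f \_ Om)) \o sn) z = (EFin \o (f \o sn)) z.
    by move=> Ez; rewrite /= patchE mem_set.
  have ifE : (leb d \x mu)%E.-integrable E ((EFin \o (f \_ Om)) \o sn).
    have := (integrable_mkcond (EFin \o (f \o sn)) mE).2 ih.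
    by apply: eq_integrable => // z /set_mem Ez; exact: (esym (eE _ Ez)).
  have := @integral_pushforward _ _ _ _ _ sn msn (leb d \x mu)%E Om _ mfO ifE measurable_Omega.
  move=> /= ->.
  by apply: eq_integral => z /set_mem Ez; exact: (eE _ Ez).
rewrite -integral12_prod_meas1// [RHS]integral_mkcond.
by apply: eq_integral => z _; rewrite FE patchE.
Qed.

End omega.

Section line_concentration.
Context {R : realType} (d : nat).
Local Notation B := (@eball R d 1).
Local Notation Om := (Omega R d).
Local Notation w := (fine (leb d B)).
Local Notation mu := (@lebesgue_measure R).
Local Notation I01 := (`]0%R, 1%R[%classic : set (measurableTypeR R)).

Lemma eball0 : B 0.
Proof. by rewrite /eball/= enorm0. Qed.

Lemma eball_measurable : measurable B.
Proof. exact: measurable_eball. Qed.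

(** Continuity at the points of the axis only, at fixed height and without uniformity in t;
    dominated convergence in t does the rest. *)
Definition slice_continuous (theta : 'rV[R]_d.+1 -> R) := forall t, I01 t ->
  forall e, 0 < e -> exists2 delta, 0 < delta & forall z, B z -> enorm z < delta ->
    `|theta (snoc z t) - theta (snoc 0 t)| <= e.

(** Dominated convergence speaks of sequences, so a failure of continuity is first turned into a
    sequence of points z n tending to 0. *)
Lemma slice_integral_continuous (theta : 'rV[R]_d.+1 -> R) (M : R) :
  measurable_fun Om theta -> (forall x, Om x -> `|theta x| <= M) ->
  slice_continuous theta -> forall e, 0 < e ->
  exists2 delta, 0 < delta & forall z, B z -> enorm z < delta ->
    `|\int[mu]_(t in I01) theta (snoc z t) - \int[mu]_(t in I01) theta (snoc 0 t)| <= e.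
Proof.
move=> mt tM ct e e0; apply: contrapT => H.
have bad n : exists z, [/\ B z, enorm z < n.+1%:R^-1 & e <
    `|\int[mu]_(t in I01) theta (snoc z t) - \int[mu]_(t in I01) theta (snoc 0 t)|].
  apply: contrapT => Hn; apply: H; exists n.+1%:R^-1; first by rewrite invr_gt0 ltr0Sn.
  move=> z Bz zn; rewrite leNgt; apply/negP => ez; apply: Hn.
  by exists z.
have [z zP] := choice bad.
have cv : (\int[mu]_(t in I01) theta (snoc (z n) t)) @[n --> \oo] -->
    \int[mu]_(t in I01) theta (snoc 0 t).
  apply: (Rintegral_dominated_convergence (g := fun=> M)) => //.
  - by move=> n; apply: measurable_slice => //; have [] := zP n.
  - by apply: measurable_slice => //; exact: eball0.
  - apply/aeW => t It; apply/cvgrPdist_le => /= e' e'0.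
    have [delta delta0 dP] := ct t It e' e'0.
    have ev : \forall n \near \oo, n.+1%:R^-1 < delta.
      exact: (cvgr_lt _ (@cvg_harmonic R)).
    apply: filterS ev => n nd; rewrite distrC; have [Bz zn _] := zP n.
    by apply: dP => //; exact: lt_trans zn nd.
  - apply: (bounded_integrable (M := `|M|)) => //; exact: I01_oo.
  - by move=> n t It; apply: tM; rewrite Omega_snoc; have [] := zP n.
have /cvgrPdist_lt/(_ _ e0)[n _ /(_ n (leqnn n))] := cv.
by rewrite distrC; have [_ _ /ltW] := zP n; rewrite leNgt => /negP.
Qed.

Lemma slice_integral_bound (theta : 'rV[R]_d.+1 -> R) (M : R) z :
  measurable_fun Om theta -> (forall x, Om x -> `|theta x| <= M) -> B z ->
  `|\int[mu]_(t in I01) theta (snoc z t)| <= M.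
Proof.
move=> mt tM Bz; have it := integrable_slice mt tM Bz.
apply: le_trans (le_normr_Rintegral _ it) _ => //.
rewrite -[leRHS]Rintegral_I01_cst; apply: le_Rintegral => //.
- exact: integrable_norm it.
- by apply: (bounded_integrable (M := `|M|)) => //; exact: I01_oo.
- by move=> t It; apply: tM; rewrite Omega_snoc.
Qed.

Lemma measurable_profile_Omega k :
  measurable_fun Om (fun x : 'rV[R]_d.+1 => (1 - enorm (xpr x)) ^+ k).
Proof.
apply: measurable_funTS.
have h := @measurable_profile_enorm R d k setT.
exact: (measurableT_comp h (@measurable_xpr R d)).
Qed.

Lemma Omega_profile_itv x k : Om x -> 0 <= (1 - enorm (xpr x)) ^+ k <= 1.
Proof.
move=> [x1 _]; have /andP[x0 x1'] := eball_profile_itv x1.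
by rewrite exprn_ge0// exprn_ile1.
Qed.

Lemma line_concentration (theta : 'rV[R]_d.+1 -> R) (M : R) : (0 < d)%N ->
  measurable_fun Om theta -> (forall x, Om x -> `|theta x| <= M) ->
  slice_continuous theta ->
  (n.+1%:R ^+ d * \int[leb d.+1]_(x in Om) ((1 - enorm (xpr x)) ^+ n * theta x))
    @[n --> \oo] --> w * d`!%:R * \int[mu]_(t in I01) theta (snoc 0 t).
Proof.
move=> d0 mt tM ct; have [mpsi _] := Omega_fubini mt tM.
have := concentration d0 mpsi (fun z Bz => slice_integral_bound mt tM Bz)
  (slice_integral_continuous mt tM ct).
rewrite (_ : (fun n => _ * \int[leb d.+1]_(x in _) _) = (fun n => n.+1%:R ^+ d *
    \int[leb d]_(z in B) ((1 - enorm z) ^+ n * \int[mu]_(t in I01) theta (snoc z t))))//.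
apply/funext => n; congr (_ * _).
have [|x Ox|_ ->] := @Omega_fubini R d (fun x => (1 - enorm (xpr x)) ^+ n * theta x) M.
- by apply: measurable_funM => //; exact: measurable_profile_Omega.
- have /andP[p0 p1] := Omega_profile_itv n Ox.
  by rewrite normrM ger0_norm// -[leRHS]mul1r ler_pM// tM.
apply: eq_Rintegral => z /set_mem Bz; rewrite -RintegralZl//; last exact: integrable_slice tM Bz.
by apply: eq_Rintegral => t _; rewrite xpr_snoc.
Qed.

(** Lebesgue measure on R^d is invariant under negation, so after Fubini the substitution z -> -z
    shows that the integral equals its own opposite. *)
Lemma Rintegral_odd (f : 'rV[R]_d.+1 -> R) (M : R) :
  measurable_fun Om f -> (forall x, Om x -> `|f x| <= M) ->
  (forall z t, f (snoc (- z) t) = - f (snoc z t)) ->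
  \int[leb d.+1]_(x in Om) f x = 0.
Proof.
move=> mf fM fodd; have [mF ->] := Omega_fubini mf fM.
set F := fun z => _; have mB := eball_measurable.
have iF : (leb d).-integrable B (EFin \o F).
  apply: (bounded_integrable (M := M)) => //; first exact: eball_oo.
  by move=> z Bz; exact: slice_integral_bound.
have Fodd z : B z -> F (- z) = - F z.
  move=> Bz; rewrite /F -mulN1r -RintegralZl//; last exact: integrable_slice fM Bz.
  by apply: eq_Rintegral => t _; rewrite fodd mulN1r.
suff e : \int[leb d]_(z in B) F z = - \int[leb d]_(z in B) F z by lra.
have preB : (-%R : 'rV[R]_d -> 'rV[R]_d) @^-1` B = B.
  by apply/seteqP; split => z; rewrite /eball/= enormN.
have mFB : measurable_fun setT (EFin \o (F \_ B)).
  by apply/measurable_EFinP; apply/(measurable_restrictT _ mB).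
have iFB : (leb d).-integrable ((-%R : 'rV[R]_d -> 'rV[R]_d) @^-1` B) ((EFin \o (F \_ B)) \o -%R).
  rewrite preB; have := integrable_EFinZ (-1) mB iF; apply: eq_integrable => // z /set_mem Bz.
  by rewrite /= patchE mem_set ?Fodd ?mulN1r// /eball/= enormN.
have := @integral_pushforward _ _ _ _ _ _ (@measurable_rVN R d) (leb d) B _ mFB iFB mB.
rewrite preB => H.
rewrite -mulN1r -RintegralZl// /Rintegral; congr fine.
transitivity (\int[leb d]_(z in B) ((EFin \o (F \_ B)) \o -%R) z)%E; last first.
  apply: eq_integral => z /set_mem Bz; rewrite /= patchE mem_set ?Fodd ?mulN1r//.
  by rewrite /eball/= enormN.
rewrite -H; transitivity (\int[leb d]_(z in B) (EFin \o (F \_ B)) z)%E.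
  by apply: eq_integral => z zB; rewrite /= patchE zB.
apply: (@eq_measure_integral _ _ _ _ (push_measure (leb d) (@measurable_rVN R d)) (leb d)) => A mA _.
by rewrite -[LHS](leb_oppr mA).
Qed.

End line_concentration.

(** * Weak limits *)

Section omega_topology.
Context {R : realType} (d : nat).
Local Notation Om := (Omega R d).

Lemma enorm_continuous n : continuous (@enorm R n).
Proof.
move=> x; apply/(@cvg_ballP _ _ _ _ (nbhs_filter x)) => e e0.
have de0 : 0 < e / n.+1%:R by rewrite divr_gt0.
apply/nbhs_ballP; exists (e / n.+1%:R) => //= y [_ xy]; rewrite /ball/=.
apply: le_lt_trans (ler_dist_enorm _ _) _; apply: le_lt_trans (ler_enorm_sum _) _.
apply: (@le_lt_trans _ _ (\sum_(i < n) (e / n.+1%:R))).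
  by apply: ler_sum => i _; have := xy 0 i; rewrite /ball/= !mxE => /ltW.
rewrite sumr_const card_ord -[ltLHS]mulr_natr -mulrA -[ltRHS]mulr1 ltr_pM2l//.
by rewrite mulrC ltr_pdivrMr// mul1r ltr_nat.
Qed.

Lemma xpr_continuous : continuous (@xpr R d).
Proof.
move=> x; apply/(@cvg_ballP _ _ _ _ (nbhs_filter x)) => e e0; apply/nbhs_ballP; exists e => //= y [_ xy].
by split => // i j; rewrite (ord1 i) !mxE; exact: xy.
Qed.

Lemma xlast_continuous : continuous (@xlast R d).
Proof. exact: coord_continuous. Qed.

Lemma open_Omega : open Om.
Proof.
rewrite (_ : Om = (@enorm R d \o @xpr R d) @^-1` [set r : R | r < 1] `&`
    @xlast R d @^-1` `]0%R, 1%R[).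
  apply: openI.
    apply: open_comp; last exact: open_lt.
    by move=> x _; apply: continuous_comp; [exact: xpr_continuous|exact: enorm_continuous].
  apply: open_comp; last exact: itv_open.
  by move=> x _; exact: xlast_continuous.
by apply/seteqP; split => x; rewrite /Omega/= in_itv.
Qed.

Lemma C0_measurable phi : C0 Om phi -> measurable_fun Om phi.
Proof. by move=> [cphi _]; apply: continuous_on_measurable => //; exact: open_Omega. Qed.

Lemma C0_bounded phi : C0 Om phi -> exists2 M, 0 <= M & forall x, Om x -> `|phi x| <= M.
Proof.
move=> [cphi /(_ 1 ltr01)[K [cK KO phi1]]].
have cphiK : {within K, continuous phi} by exact: continuous_subspaceW cphi.
have /compact_bounded[M [_ bM]] := continuous_compact cphiK cK.
have M0 : M < `|M| + 1 by rewrite (le_lt_trans (ler_norm M))// ltrDl.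
exists (`|M| + 1); first by rewrite addr_ge0.
move=> x Ox; have [Kx|nKx] := pselect (K x).
  by apply: (bM _ M0); exists x.
by rewrite (le_trans (ltW (phi1 x Ox nKx)))// lerDr.
Qed.

Lemma C0_slice_continuous phi : C0 Om phi -> slice_continuous phi.
Proof.
move=> [+ _]; rewrite continuous_open_subspace//; last exact: open_Omega.
move=> cphi t It e e0.
have O0 : (snoc 0 t : 'rV[R]_d.+1) \in Om by rewrite inE Omega_snoc; split => //; exact: eball0.
have /cvgrPdist_le/(_ _ e0)/nbhs_ballP[r /= r0 rphi] := cphi _ O0.
exists r => // z _ zr; rewrite distrC; apply: rphi; split => // i j; rewrite (ord1 i) /ball/=.
apply: le_lt_trans zr; case: (unliftP ord_max j) => [l|] ->.
  by rewrite !snoc_lift mxE sub0r normrN ler_coord_enorm.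
by rewrite !snoc_ordmax subrr normr0 enorm_ge0.
Qed.

Lemma C0_profile_slice phi M : C0 Om phi -> (forall x, Om x -> `|phi x| <= M) ->
  slice_continuous (fun x : 'rV[R]_d.+1 => (1 - enorm (xpr x)) * phi x).
Proof.
move=> C0phi phiM t It e e0.
have M0 : 0 <= M.
  by apply: le_trans (phiM (snoc 0 t) _); rewrite ?normr_ge0// Omega_snoc; split => //; exact: eball0.
have e20 : 0 < e / 2 by lra.
have [r r0 rP] := C0_slice_continuous C0phi It e20.
exists (Num.min r (e / 2 / (M + 1))); first by rewrite lt_min r0 divr_gt0//; lra.
move=> z Bz; rewrite lt_min => /andP[zr zM]; rewrite !xpr_snoc enorm0 subr0 mul1r.
rewrite (_ : _ - _ = (phi (snoc z t) - phi (snoc 0 t)) - enorm z * phi (snoc z t)); last by ring.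
apply: le_trans (ler_normB _ _) _; rewrite [leRHS](splitr e) lerD ?rP//.
rewrite normrM ger0_norm ?enorm_ge0//; apply: (@le_trans _ _ (e / 2 / (M + 1) * M)).
  by apply: ler_pM => //; [exact: enorm_ge0|exact: ltW|apply: phiM; rewrite Omega_snoc].
by rewrite mulrAC ler_pdivrMr//; [rewrite ler_pM2l//; lra|lra].
Qed.

End omega_topology.

(** * Components and exponents of the two sequences *)

Section components.
Context {R : realType} (d : nat).
Implicit Types (x : 'rV[R]_d.+1) (p q : R).

Lemma e_N_ordmax : e_N d 0 ord_max = 1 :> R.
Proof. by rewrite mxE !eqxx. Qed.

Lemma e_N_lift j : e_N d 0 (lift ord_max j) = 0 :> R.
Proof. by rewrite mxE eqxx/= eq_sym (negbTE (neq_lift _ _)). Qed.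

Lemma sigma_seqE p n x i :
  sigma_seq d p n x 0 i = n%:R `^ (d%:R / p) * (1 - enorm (xpr x)) ^+ n * e_N d 0 i.
Proof. by rewrite /sigma_seq mxE. Qed.

Lemma eta_seq_ordmax p n x :
  eta_seq d p n x 0 ord_max = n%:R `^ exponent' d p * (1 - enorm (xpr x)) ^+ n.
Proof.
by rewrite /eta_seq !mxE !eqxx unlift_none/= mulr0 add0r mulr1.
Qed.

Lemma derive1_profile n (r : R) : derive1 (profile n.+1) r = - (n.+1%:R * (1 - r) ^+ n).
Proof. by rewrite derive1E (@derive_val _ _ _ _ _ _ _ (is_derive_onemXn n r)). Qed.

Lemma eta_seq_lift p n x j :
  eta_seq d p n.+1 x 0 (lift ord_max j) =
  - (n.+1%:R `^ exponent' d p * n.+1%:R * (1 - enorm (xpr x)) ^+ n *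
     (xlast x * ((enorm (xpr x))^-1 * x 0 (lift ord_max j)))).
Proof.
by rewrite /eta_seq !mxE liftK eq_sym (negbTE (neq_lift _ _))/= mulr0 addr0 derive1_profile !mxE; ring.
Qed.

(** The value prescribed at p = 1 is the one that this formula takes there. *)
Lemma exponentE p : 1 <= p -> exponent' d p = d%:R - d%:R / p.
Proof.
move=> p1; rewrite /exponent'; case: eqP => [->|/eqP p1']; first by rewrite divr1 subrr.
by field; rewrite subr_eq0 p1'/= gt_eqF// (lt_le_trans ltr01).
Qed.

(** Here the relation between p and q enters. Differentiating the profile brings out one more factor
    n, which turns n^(d/p') into n^(d/q), the scale at which the profile stays bounded in L^q. *)
Lemma exponentS p q : (0 < d)%N -> 1 <= p -> 1 <= q -> p^-1 + q^-1 = 1 + d%:R^-1 ->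
  exponent' d p + 1 = d%:R / q.
Proof.
move=> d0 p1 q1 h; rewrite exponentE// -[d%:R / q](addrK (d%:R / p)) -mulrDr (addrC q^-1) h.
by rewrite mulrDr mulr1 divff; [ring|rewrite pnatr_eq0 -lt0n].
Qed.

Lemma powR_natD n (a b : R) : n.+1%:R `^ a * n.+1%:R `^ b = n.+1%:R `^ (a + b) :> R.
Proof. by rewrite powRD//; apply/implyP => _; rewrite pnatr_eq0. Qed.

Lemma powR_exponentS p q n : (0 < d)%N -> 1 <= p -> 1 <= q -> p^-1 + q^-1 = 1 + d%:R^-1 ->
  n.+1%:R `^ exponent' d p * n.+1%:R = n.+1%:R `^ (d%:R / q) :> R.
Proof.
by move=> d0 p1 q1 h; rewrite -(exponentS d0 p1 q1 h) -powR_natD powRr1.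
Qed.

Lemma measurable_eta_dir j : measurable_fun setT
  (fun x : 'rV[R]_d.+1 => xlast x * ((enorm (xpr x))^-1 * x 0 (lift ord_max j))).
Proof.
apply: measurable_funM; first exact: measurable_xlast.
apply: measurable_funM; last exact: measurable_coord.
under eq_fun do rewrite -powR_inv1 ?enorm_ge0//.
apply: (measurableT_comp (measurable_powR _)).
exact: (measurableT_comp (@measurable_enorm R d) (@measurable_xpr R d)).
Qed.

Lemma eta_dir_le1 j x : Omega R d x ->
  `|xlast x * ((enorm (xpr x))^-1 * x 0 (lift ord_max j))| <= 1.
Proof.
move=> [x1 /andP[t0 t1]]; rewrite normrM -[leRHS]mulr1; apply: ler_pM => //.
  by rewrite gtr0_norm// ltW.
rewrite normrM ger0_norm ?invr_ge0 ?enorm_ge0//.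
have := ler_coord_enorm (xpr x) j; rewrite mxE => h.
(* On the axis the inverse of 0 is 0, so the bound holds there too. *)
have [->|x0] := eqVneq (enorm (xpr x)) 0; first by rewrite invr0 mul0r.
by rewrite mulrC ler_pdivrMr ?mul1r// lt_def x0 enorm_ge0.
Qed.

(** The field [sigma_seq] is vertical, so only the last components meet, and the exponents d / p and
    d - d / p add up to d. *)
Lemma dotv_sigma_eta p n x : 1 <= p ->
  dotv (sigma_seq d p n.+1 x) (eta_seq d p n.+1 x) =
  n.+1%:R ^+ d * (1 - enorm (xpr x)) ^+ (n.+1 * 2).
Proof.
move=> p1; rewrite /dotv (bigD1 ord_max)//= big1 ?addr0; last first.
  move=> i; case: (unliftP ord_max i) => [j|] ->; last by rewrite eqxx.
  by rewrite sigma_seqE e_N_lift mulr0 mul0r.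
rewrite sigma_seqE e_N_ordmax mulr1 eta_seq_ordmax mulrACA -exprD muln2 addnn.
by rewrite powR_natD exponentE// subrKC powR_mulrn.
Qed.

End components.

Lemma eq_cvgn (R : realType) (u v : nat -> R) (l m : R) :
  u n @[n --> \oo] --> l -> v =1 u -> m = l -> v n @[n --> \oo] --> m.
Proof. by move=> ul /funext -> ->. Qed.

Lemma cvgn_mull (R : realType) (c l : R) (u : nat -> R) :
  u n @[n --> \oo] --> l -> (c * u n) @[n --> \oo] --> c * l.
Proof. by move=> ul; apply: cvgM => //; exact: cvg_cst. Qed.

(** * Weak-star limits *)

Section weak_star.
Context {R : realType} (d : nat).
Hypothesis d0 : (0 < d)%N.
Local Notation B := (@eball R d 1).
Local Notation Om := (Omega R d).
Local Notation w := (fine (leb d B)).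
Local Notation mu := (@lebesgue_measure R).
Local Notation I01 := (`]0%R, 1%R[%classic : set (measurableTypeR R)).
Local Notation r x := (enorm (xpr x)).

Lemma in_L1_bounded (f : 'rV[R]_d.+1 -> R) (M : R) : measurable_fun Om f ->
  (forall x, Om x -> `|f x| <= M) -> in_Lp Om 1 f.
Proof.
move=> mf fM; apply/Lfun1_integrable.
have := bounded_integrable (@measurable_Omega R d) (@Omega_oo R d) mf fM.
move/(integrable_mkcond _ (@measurable_Omega R d)); apply: eq_integrable => // x _.
by rewrite /= !patchE; case: ifPn.
Qed.

Let line_phi (phi : 'rV[R]_d.+1 -> R) : \int[mu]_(t in I01) (phi (snoc 0 t)) = line_measure phi.
Proof. by []. Qed.

(* The factor 1 - |x'| turns the power n of the profile into n + 1. *)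
Lemma profile_concentration phi : C0 Om phi ->
  (n.+1%:R ^+ d * \int[leb d.+1]_(x in Om) ((1 - r x) ^+ n.+1 * phi x)) @[n --> \oo] -->
    w * d`!%:R * line_measure phi.
Proof.
move=> C0phi; have [M M0 phiM] := C0_bounded C0phi.
have mphi := C0_measurable C0phi.
have mth : measurable_fun Om (fun x : 'rV[R]_d.+1 => (1 - r x) * phi x).
  apply: measurable_funM => //.
  by have := @measurable_profile_Omega R d 1; under eq_fun do rewrite expr1.
have thM x : Om x -> `|(1 - r x) * phi x| <= M.
  move=> Ox; have /andP[p0 p1] := Omega_profile_itv 1 Ox; rewrite expr1 in p0 p1.
  by rewrite normrM ger0_norm// -[leRHS]mul1r ler_pM// phiM.
apply: eq_cvgn (line_concentration d0 mth thM (C0_profile_slice C0phi phiM)) _ _.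
  by move=> n; congr (_ * _); apply: eq_Rintegral => x _; rewrite mulrA -exprSr.
congr (_ * _); rewrite -line_phi; apply: eq_Rintegral => t _.
by rewrite xpr_snoc enorm0 subr0 mul1r.
Qed.

Lemma cvg_subseq_odd (u : nat -> R) (l : R) : u n @[n --> \oo] --> l ->
  u (n * 2).+1 @[n --> \oo] --> l.
Proof.
move=> ul; apply: (cvg_comp (fun n => (n * 2).+1) u) ul.
by apply/cvgnyPge => A; exists A => // n /= An; rewrite (leq_trans An)// ltnW// ltnS leq_pmulr.
Qed.

Lemma integrable_profile_phi n phi : C0 Om phi ->
  (leb d.+1).-integrable Om (EFin \o (fun x => (1 - r x) ^+ n * phi x)).
Proof.
move=> C0phi; have [M M0 phiM] := C0_bounded C0phi.
apply: (bounded_integrable (M := 1 * M)); [exact: measurable_Omega|exact: Omega_oo| |].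
  by apply: measurable_funM; [exact: measurable_profile_Omega|exact: C0_measurable].
move=> x Ox; have /andP[p0 p1] := Omega_profile_itv n Ox.
by rewrite normrM ger0_norm// ler_pM// phiM.
Qed.

Lemma integrable_sigma n (c : R) phi : C0 Om phi ->
  (leb d.+1).-integrable Om (EFin \o (fun x => c * (1 - r x) ^+ n * phi x)).
Proof.
move=> C0phi.
have := integrable_EFinZ c (@measurable_Omega R d) (integrable_profile_phi n C0phi).
by apply: eq_integrable => [|x _]; [exact: measurable_Omega|rewrite /= mulrA].
Qed.

Lemma sigma_weakstar phi : C0 Om phi ->
  (\int[leb d.+1]_(x in Om) (n.+1%:R ^+ d * (1 - r x) ^+ n.+1 * phi x)) @[n --> \oo] -->
    w * d`!%:R * line_measure phi.
Proof.
move=> C0phi; apply: eq_cvgn (profile_concentration C0phi) _ _ => // n.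
rewrite -RintegralZl; [|exact: measurable_Omega|exact: integrable_profile_phi].
by apply: eq_Rintegral => x _; rewrite mulrA.
Qed.

(** The term of index 2 n + 1 in [sigma_weakstar] has exponent 2 (n + 1) and scale (2 n + 2)^d = 2^d
    (n + 1)^d. *)
Lemma sigma_eta_weakstar phi : C0 Om phi ->
  (\int[leb d.+1]_(x in Om) (n.+1%:R ^+ d * (1 - r x) ^+ (n.+1 * 2) * phi x)) @[n --> \oo] -->
    w * d`!%:R / 2 ^+ d * line_measure phi.
Proof.
move=> C0phi; have H := cvg_subseq_odd (sigma_weakstar C0phi).
apply: eq_cvgn (cvgn_mull (c := (2 ^+ d)^-1) H) _ _; last by ring.
move=> n; rewrite /= -RintegralZl//; first last.
- exact: integrable_sigma.
- exact: measurable_Omega.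
apply: eq_Rintegral => x _.
have -> : (n * 2).+2 = (n.+1 * 2)%N by rewrite mulSn.
have : (2 : R) ^+ d != 0 by rewrite expf_neq0.
rewrite natrM exprMn; move: (n.+1%:R ^+ d) (2%:R ^+ d) ((1 - r x) ^+ _) (phi x) => a b c e b0.
by field.
Qed.

Lemma eta_last_weakstar phi : C0 Om phi ->
  (\int[leb d.+1]_(x in Om) (n.+1%:R ^+ d / n.+1%:R * (1 - r x) ^+ n.+1 * phi x))
    @[n --> \oo] --> (0 : R).
Proof.
move=> C0phi.
have H : (harmonic n * \int[leb d.+1]_(x in Om) (n.+1%:R ^+ d * (1 - r x) ^+ n.+1 * phi x))
    @[n --> \oo] --> 0 * (w * d`!%:R * line_measure phi).
  by apply: cvgM; [exact: cvg_harmonic|exact: sigma_weakstar].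
apply: eq_cvgn H _ _; last by rewrite mul0r.
move=> n; rewrite /= -RintegralZl//; first last.
- exact: integrable_sigma.
- exact: measurable_Omega.
by apply: eq_Rintegral => x _; rewrite /harmonic/=; ring.
Qed.

(* Since x_j / |x'| is odd in x', phi(x', t) may be replaced by
   phi(x', t) - phi(0, t), which vanishes on the axis. *)
Lemma eta_dir_weakstar phi (j : 'I_d) : C0 Om phi ->
  (\int[leb d.+1]_(x in Om) (- (n.+1%:R ^+ d * (1 - r x) ^+ n *
     (xlast x * ((r x)^-1 * x 0 (lift ord_max j)))) * phi x)) @[n --> \oo] --> (0 : R).
Proof.
move=> C0phi; have [M M0 phiM] := C0_bounded C0phi.
have mphi := C0_measurable C0phi.
pose dir (x : 'rV[R]_d.+1) := xlast x * ((r x)^-1 * x 0 (lift ord_max j)).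
have mdir : measurable_fun Om dir by apply: measurable_funTS; exact: measurable_eta_dir.
pose axis (x : 'rV[R]_d.+1) := phi (snoc 0 (xlast x)).
have Oaxis x : Om x -> Om (snoc 0 (xlast x)).
  by move=> [_ x1]; rewrite Omega_snoc; split; [exact: eball0|rewrite /= in_itv].
have maxis : measurable_fun Om axis.
  apply: (@measurable_comp _ _ _ _ _ _ Om phi) => //; first exact: measurable_Omega.
    by move=> _ [x Ox <-]; exact: Oaxis.
  apply: measurable_funTS; apply: measurable_to_rV => i.
  case: (unliftP ord_max i) => [l|] ->.
    by under eq_fun do rewrite snoc_lift mxE; exact: measurable_cst.
  by under eq_fun do rewrite snoc_ordmax; exact: measurable_xlast.
pose theta x := dir x * (phi x - axis x).
have mtheta : measurable_fun Om theta.
  by apply: measurable_funM => //; exact: measurable_funB.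
have phiaxisM x : Om x -> `|phi x - axis x| <= M + M.
  by move=> Ox; apply: le_trans (ler_normB _ _) _; rewrite lerD ?phiM//; exact: Oaxis.
have thetaM x : Om x -> `|theta x| <= M + M.
  by move=> Ox; rewrite normrM -[leRHS]mul1r ler_pM ?eta_dir_le1 ?phiaxisM.
have ctheta : slice_continuous theta.
  move=> t It e e0; have [delta delta0 dP] := C0_slice_continuous C0phi It e0.
  exists delta => // z Bz zd.
  rewrite /theta /axis !xlast_snoc subrr mulr0 subr0 normrM -[leRHS]mul1r.
  by rewrite ler_pM ?dP// eta_dir_le1// Omega_snoc.
have axis0 : \int[mu]_(t in I01) theta (snoc 0 t) = 0.
  under eq_Rintegral do rewrite /theta /axis xlast_snoc subrr mulr0.
  exact: Rintegral_I01_cst.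
have odd n : \int[leb d.+1]_(x in Om) ((1 - r x) ^+ n * dir x * axis x) = 0.
  apply: (Rintegral_odd (M := 1 * 1 * M)).
  - apply: measurable_funM => //; apply: measurable_funM => //.
    exact: measurable_profile_Omega.
  - move=> x Ox; have /andP[p0 p1] := Omega_profile_itv n Ox.
    rewrite normrM [X in X * _]normrM (ger0_norm p0); apply: ler_pM; rewrite ?mulr_ge0//.
      by apply: ler_pM => //; exact: eta_dir_le1.
    by apply: phiM; exact: Oaxis.
  - move=> z t; rewrite /dir /axis !xlast_snoc !xpr_snoc enormN !snoc_lift mxE.
    by ring.
have H := line_concentration d0 mtheta thetaM ctheta.
apply: eq_cvgn (cvgn_mull (c := -1) H) _ _; last by rewrite axis0 !mulr0.
move=> n /=; set P := fun x : 'rV[R]_d.+1 => (1 - r x) ^+ n.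
have mP : measurable_fun Om P by exact: measurable_profile_Omega.
have i1 : (leb d.+1).-integrable Om (EFin \o (fun x => P x * theta x)).
  apply: (bounded_integrable (M := 1 * (M + M))); [exact: measurable_Omega|exact: Omega_oo| |].
    exact: measurable_funM.
  move=> x Ox; have /andP[p0 p1] := Omega_profile_itv n Ox.
  by rewrite normrM ger0_norm// ler_pM// thetaM.
have i2 : (leb d.+1).-integrable Om (EFin \o (fun x => P x * dir x * axis x)).
  apply: (bounded_integrable (M := 1 * 1 * M)); [exact: measurable_Omega|exact: Omega_oo| |].
    by apply: measurable_funM => //; exact: measurable_funM.
  move=> x Ox; have /andP[p0 p1] := Omega_profile_itv n Ox.
  rewrite normrM [X in X * _]normrM (ger0_norm p0); apply: ler_pM; rewrite ?mulr_ge0//.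
    by apply: ler_pM => //; exact: eta_dir_le1.
  by apply: phiM; exact: Oaxis.
have mO := @measurable_Omega R d.
transitivity (\int[leb d.+1]_(x in Om) ((- n.+1%:R ^+ d) * (P x * theta x + P x * dir x * axis x))).
  by apply: eq_Rintegral => x _; rewrite /theta /P /dir; ring.
rewrite RintegralZl//; last by apply: eq_integrable (integrableD mO i1 i2).
by rewrite RintegralD// odd addr0 mulN1r mulNr.
Qed.

End weak_star.

(** * Weak limits in L^s for s > 1 *)

Section weak_Lp.
Context {R : realType} (d : nat).
Hypothesis d0 : (0 < d)%N.
Local Notation Om := (Omega R d).
Local Notation r x := (enorm (xpr x)).

(** The axis lies in a hyperplane where one horizontal coordinate vanishes, which is a box of
    measure 0; d > 0 provides that coordinate. *)
Lemma axis_negligible : {ae leb d.+1, forall x : 'rV[R]_d.+1, xpr x != 0}.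
Proof.
pose i0 : 'I_d.+1 := lift ord_max (Ordinal d0).
pose A (i : 'I_d.+1) : set R := if i == i0 then [set 0] else setT.
have mA i : measurable (A i : set (measurableTypeR R)).
  by rewrite /A; case: ifP => _; [exact: measurable_set1|exact: measurableT].
exists (box A); split; first exact: measurable_box.
  by rewrite [LHS](leb_box mA) (bigD1 i0)//= {1}/A eqxx lebesgue_measure_set1 mul0e.
move=> x /negP; rewrite negbK => /eqP x0 i; rewrite /A; case: eqP => // -> /=.
by have := congr1 (fun z : 'rV[R]_d => z 0 (Ordinal d0)) x0; rewrite !mxE.
Qed.

Lemma in_Lp_bounded (f : 'rV[R]_d.+1 -> R) (s M : R) : 0 < s -> measurable_fun Om f ->
  (forall x, Om x -> `|f x| <= M) -> in_Lp Om s f.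
Proof.
move=> s0 mf fM; have mO := @measurable_Omega R d.
have mfO : measurable_fun setT (f \_ Om) by apply/(measurable_restrictT _ mO).
rewrite /in_Lp inE; apply/andP; split; rewrite inE/=; first exact: mfO.
rewrite /finite_norm unlock; apply: poweR_lty.
have i : (leb d.+1).-integrable Om (EFin \o (fun x => `|f x| `^ s)).
  apply: (bounded_integrable (M := M `^ s)) => //; first exact: Omega_oo.
    by apply: (measurableT_comp (measurable_powR _)); exact: measurableT_comp.
  move=> x Ox; rewrite ger0_norm ?powR_ge0//; have M0 := le_trans (normr_ge0 _) (fM x Ox).
  by apply: ge0_ler_powR; [exact: ltW|rewrite nnegrE|rewrite nnegrE|exact: fM].
have /integrableP[_] := i; apply: le_lt_trans; rewrite [leRHS]integral_mkcond.
rewrite le_eqVlt; apply/orP; left; apply/eqP; apply: eq_integral => x _.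
rewrite /= !patchE; case: ifPn => _ /=; first by rewrite (ger0_norm (powR_ge0 _ _)).
by rewrite normr0 powR0// gt_eqF.
Qed.

Lemma in_Lp_measurable (s : R) h : in_Lp Om s h -> measurable_fun Om h.
Proof.
rewrite /in_Lp inE => /andP[+ _]; rewrite inE/= => mh.
exact/(measurable_restrictT _ (@measurable_Omega R d)).
Qed.

Lemma in_Lp_integrable (s : R) h : 1 <= s -> in_Lp Om s h ->
  (leb d.+1).-integrable Om (EFin \o (fun x => `|h x| `^ s)).
Proof.
move=> s1 /(Lfun_integrable s1) ih.
apply: eq_integrable (integrableS _ (@measurable_Omega R d) (@subsetT _ _) ih) => //.
  exact: measurable_Omega.
by move=> x xO; rewrite /= patchE xO.
Qed.

Lemma Rintegral_Omega_profile n :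
  \int[leb d.+1]_(x in Om) ((1 - r x) ^+ n) = @moment R d n.
Proof.
have [|x Ox|_ ->] := @Omega_fubini R d (fun x => (1 - r x) ^+ n) 1.
- exact: measurable_profile_Omega.
- by have /andP[p0 p1] := Omega_profile_itv n Ox; rewrite ger0_norm.
apply: eq_Rintegral => z _; under eq_Rintegral do rewrite xpr_snoc.
exact: Rintegral_I01_cst.
Qed.

Lemma moment_bounded : exists2 K, 0 <= K & forall n, n.+1%:R ^+ d * @moment R d n <= K.
Proof.
have cv := @moment_cvg R d d0.
have [M [_ HM]] : bounded_fun (fun n => n.+1%:R ^+ d * @moment R d n).
  by apply: cvg_seq_bounded; apply/cvg_ex; eexists; exact: cv.
exists (`|M| + 1); first by rewrite addr_ge0.
move=> n; apply: le_trans (ler_norm _) _; apply: (HM (`|M| + 1)) => //.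
by rewrite (le_lt_trans (ler_norm M))// ltrDl.
Qed.

(** Young's inequality for l a and b / l with l^s = e; the factors 1 / s and 1 / s' are at most 1
    and are dropped. *)
Lemma young_scaled (s s' e : R) : 0 < s -> 0 < s' -> 1 <= s -> 1 <= s' ->
  s^-1 + s'^-1 = 1 -> 0 < e -> exists2 c, 0 <= c & forall a b : R, 0 <= a -> 0 <= b ->
    a * b <= e * a `^ s + c * b `^ s'.
Proof.
move=> s0 s'0 s1 s'1 ss' e0; pose l := e `^ s^-1.
have l0 : 0 < l by exact: powR_gt0.
exists (l^-1 `^ s'); first exact: powR_ge0.
move=> a b a0 b0.
have -> : a * b = (l * a) * (l^-1 * b) by field; rewrite gt_eqF.
have l0' := ltW l0; have li0 : 0 <= l^-1 by rewrite invr_ge0.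
apply: le_trans (conjugate_powR (mulr_ge0 l0' a0) (mulr_ge0 li0 b0) s0 s'0 ss') _.
rewrite !powRM//.
have -> : l `^ s = e by rewrite -powRrM mulVf ?gt_eqF// powRr1// ltW.
have div1 (x t : R) : 0 <= x -> 1 <= t -> x / t <= x.
  by move=> x0 t1; rewrite ler_pdivrMr ?(lt_le_trans ltr01)// ler_peMr.
by apply: lerD; apply: div1 => //; rewrite mulr_ge0 ?powR_ge0// ltW.
Qed.

(* (1 - |x'|)^k is split evenly between the two factors in Young's inequality: the
   first half keeps f_k bounded in L^s and the second makes h (1 - |x'|)^(k/2)
   tend to 0 in the dual space, off the axis. *)
Lemma weak_Lp_cvg0 (s C : R) (f : nat -> 'rV[R]_d.+1 -> R) : 1 < s -> 0 <= C ->
  (forall k, measurable_fun Om (f k)) ->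
  (forall k x, Om x -> `|f k x| <= C * k.+1%:R `^ (d%:R / s) * (1 - r x) ^+ k) ->
  weak_Lp_cvg Om s f (fun=> 0).
Proof.
move=> s1 C0 mf fC; have s0 : 0 < s by exact: lt_trans ltr01 s1.
have mO := @measurable_Omega R d.
have fM k x : Om x -> `|f k x| <= C * k.+1%:R `^ (d%:R / s).
  move=> Ox; apply: le_trans (fC k x Ox) _; have /andP[_ p1] := Omega_profile_itv k Ox.
  by rewrite -[leRHS]mulr1 ler_wpM2l// mulr_ge0// powR_ge0.
split.
- by move=> k; exact: in_Lp_bounded (fM k).
- by apply: (in_Lp_bounded (M := 0)) => // x _; rewrite normr0.
set s' := s / (s - 1) => h Lh.
have s'1 : 1 <= s' by rewrite /s' ler_pdivlMr ?subr_gt0// mul1r; lra.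
have s'0 : 0 < s' by exact: lt_le_trans ltr01 s'1.
have ss' : s^-1 + s'^-1 = 1.
  by rewrite /s'; field; rewrite subr_eq0 !gt_eqF.
have ih := in_Lp_integrable s'1 Lh; have mh := in_Lp_measurable Lh.
pose a k (x : 'rV[R]_d.+1) := k.+1%:R `^ (d%:R / s) * (1 - r x) ^+ uphalf k.
pose b k (x : 'rV[R]_d.+1) := (1 - r x) ^+ k./2 * `|h x|.
have mprof k : measurable_fun Om (fun x : 'rV[R]_d.+1 => (1 - r x) ^+ k).
  exact: measurable_profile_Omega.
have mb k : measurable_fun Om (fun x => b k x `^ s').
  apply: (measurableT_comp (measurable_powR _)); apply: measurable_funM => //.
  exact: measurableT_comp.
have b_ge0 k x : Om x -> 0 <= b k x.
  by move=> Ox; have /andP[p0 _] := Omega_profile_itv k./2 Ox; rewrite mulr_ge0.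
have bh k x : Om x -> b k x <= `|h x|.
  by move=> Ox; have /andP[p0 p1] := Omega_profile_itv k./2 Ox; rewrite -[leRHS]mul1r ler_wpM2r.
have bhs k x : Om x -> b k x `^ s' <= `|h x| `^ s'.
  by move=> Ox; apply: ge0_ler_powR; rewrite ?nnegrE ?b_ge0 ?bh//; exact: ltW.
have ib k : (leb d.+1).-integrable Om (EFin \o (fun x => b k x `^ s')).
  apply: (le_integrable mO _ _ ih); first exact/measurable_EFinP.
  by move=> x Ox; rewrite /= lee_fin (ger0_norm (powR_ge0 (b k x) s')) (ger0_norm (powR_ge0 `|h x| s')) bhs.
have b0 : (\int[leb d.+1]_(x in Om) (b k x `^ s')) @[k --> \oo] --> (0 : R).
  have -> : 0 = \int[leb d.+1]_(x in Om) (0 : R) by rewrite Rintegral_cst// mul0r.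
  apply: (Rintegral_dominated_convergence (g := fun x => `|h x| `^ s')) => //.
  - apply: filterS axis_negligible => x x0 Ox.
    have q01 : `|1 - r x| < 1.
      have [x1 _] := Ox; have x00 : 0 < r x by rewrite enorm_gt0.
      by rewrite ger0_norm; lra.
    have half_cvg : (1 - r x) ^+ k./2 * `|h x| @[k --> \oo] --> 0 * `|h x|.
      apply: cvgM; last exact: cvg_cst.
      apply: (cvg_comp (fun k => k./2) (fun k => (1 - r x) ^+ k)); last exact: cvg_expr.
      by apply/cvgnyPge => A; exists A.*2 => // k /= /half_leq; rewrite doubleK.
    rewrite mul0r in half_cvg.
    apply/cvgrPdist_lt => /= e e0.
    have e'0 : 0 < e `^ s'^-1 by exact: powR_gt0.
    have /cvgrPdist_lt/(_ _ e'0) := half_cvg; apply: filterS => k.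
    rewrite !sub0r !normrN (ger0_norm (powR_ge0 _ _)) (ger0_norm (b_ge0 k x Ox)) => be.
    have -> : e = (e `^ s'^-1) `^ s' by rewrite -powRrM mulVf ?gt_eqF// powRr1// ltW.
    by apply: gt0_ltr_powR; rewrite ?nnegrE ?b_ge0// ltW.
  - by move=> k x Ox; rewrite (ger0_norm (powR_ge0 (b k x) s')) bhs.
have [K K0 momK] := moment_bounded.
have ma k : measurable_fun Om (fun x => a k x `^ s).
  by apply: (measurableT_comp (measurable_powR _)); exact: measurable_funM.
have as_le k x : Om x -> a k x `^ s <= k.+1%:R ^+ d * (1 - r x) ^+ uphalf k.
  move=> Ox; have /andP[p0 p1] := Omega_profile_itv (uphalf k) Ox.
  rewrite powRM ?powR_ge0// -powRrM divfK ?gt_eqF// powR_mulrn// ler_wpM2l ?exprn_ge0//.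
  move: p0; rewrite le_eqVlt => /predU1P[<-|p0]; first by rewrite powR0// gt_eqF.
  by apply: ge1r_powR; [rewrite p0|exact: ltW].
have iprof k c : (leb d.+1).-integrable Om (EFin \o (fun x => c * (1 - r x) ^+ k)).
  apply: integrable_EFinZ => //; apply: (bounded_integrable (M := 1)) => //; first exact: Omega_oo.
  by move=> x Ox; have /andP[p0 p1] := Omega_profile_itv k Ox; rewrite ger0_norm.
have ia k : (leb d.+1).-integrable Om (EFin \o (fun x => a k x `^ s)).
  apply: (le_integrable mO _ _ (iprof (uphalf k) (k.+1%:R ^+ d))); first exact/measurable_EFinP.
  move=> x Ox; rewrite /= lee_fin (ger0_norm (powR_ge0 (a k x) s)); apply: le_trans (as_le k x Ox) _.
  exact: ler_norm.
have a_bd k : \int[leb d.+1]_(x in Om) (a k x `^ s) <= 2 ^+ d * K.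
  apply: le_trans (le_Rintegral mO (ia k) (iprof _ _) (as_le k)) _.
  rewrite RintegralZl//; last by have := iprof (uphalf k) 1; apply: eq_integrable => // x _; rewrite /= mul1r.
  rewrite Rintegral_Omega_profile; apply: le_trans (ler_wpM2l _ (momK (uphalf k))); last by rewrite exprn_ge0.
  (* The factor 2^d pays for replacing k + 1 by 2 (uphalf k + 1), the scale that goes with the
     moment of order [uphalf k]. *)
  rewrite mulrA -exprMn ler_wpM2r//.
    by apply: Rintegral_ge0 => x Bx; have /andP[? ?] := eball_profile_itv Bx; rewrite exprn_ge0.
  rewrite lerXn2r ?nnegrE ?mulr_ge0// -natrM ler_nat.
  by rewrite uphalf_half; have := odd_double_half k; lia.
have ifh k : (leb d.+1).-integrable Om (EFin \o (fun x => f k x * h x)).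
  (* Since s' >= 1, |h| is at most 1 + |h|^s', which is integrable on the cylinder. *)
  have i1 : (leb d.+1).-integrable Om (EFin \o (fun x => C * k.+1%:R `^ (d%:R / s) * (1 + `|h x| `^ s'))).
    apply: integrable_EFinZ => //.
    have i1 : (leb d.+1).-integrable Om (EFin \o (fun _ : 'rV[R]_d.+1 => 1 : R)).
      by apply: (bounded_integrable (M := 1)) => //; [exact: Omega_oo|move=> *; rewrite normr1].
    by apply: eq_integrable (integrableD mO i1 ih).
  apply: (le_integrable mO _ _ i1); first by apply/measurable_EFinP; exact: measurable_funM.
  move=> x Ox; rewrite /= lee_fin normrM [leRHS]ger0_norm; last first.
    by rewrite !mulr_ge0 ?addr_ge0 ?powR_ge0.
  apply: ler_pM => //; first exact: fM.
  have [h1|h1] := leP `|h x| 1; first by rewrite (le_trans h1)// lerDl powR_ge0.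
  by rewrite (le_trans (le1r_powR (ltW h1) s'1))// lerDr.
have bound e : 0 < e -> exists2 c, 0 <= c & forall k,
    `|\int[leb d.+1]_(x in Om) (f k x * h x)| <=
    C * (e * (2 ^+ d * K) + c * \int[leb d.+1]_(x in Om) (b k x `^ s')).
  move=> e0; have [c c0 cP] := young_scaled s0 s'0 (ltW s1) s'1 ss' e0; exists c => // k.
  apply: le_trans (le_normr_Rintegral mO (ifh k)) _.
  have isum : (leb d.+1).-integrable Om (EFin \o (fun x => e * a k x `^ s + c * b k x `^ s')).
    have i1 := integrable_EFinZ e mO (ia k); have i2 := integrable_EFinZ c mO (ib k).
    by apply: eq_integrable (integrableD mO i1 i2).
  apply: (@le_trans _ _ (\int[leb d.+1]_(x in Om) (C * (e * a k x `^ s + c * b k x `^ s')))).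
    apply: le_Rintegral => //.
    - exact: integrable_norm (ifh k).
    - exact: integrable_EFinZ.
    - move=> x Ox; have /andP[p0 p1] := Omega_profile_itv (uphalf k) Ox.
      apply: (@le_trans _ _ (C * (a k x * b k x))); last first.
        by rewrite ler_wpM2l// cP ?b_ge0// mulr_ge0 ?powR_ge0.
      rewrite normrM; apply: le_trans (ler_wpM2r (normr_ge0 _) (fC k x Ox)) _.
      rewrite le_eqVlt; apply/orP; left; apply/eqP.
      have -> : (1 - r x) ^+ k = (1 - r x) ^+ uphalf k * (1 - r x) ^+ k./2.
        by rewrite -exprD uphalf_half -addnA addnn odd_double_half.
      by rewrite /a /b; ring.
  rewrite RintegralZl// ler_wpM2l// RintegralD//; [|exact: integrable_EFinZ..].
  rewrite !RintegralZl//; apply: lerD => //.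
  by apply: ler_wpM2l; [exact: ltW|exact: a_bd].
rewrite (_ : \int[_]_(x in _) _ = 0); last first.
  by under eq_Rintegral do rewrite mul0r; rewrite Rintegral_cst// mul0r.
apply/cvgrPdist_le => /= e e0.
(* Each term of [bound] gets e / 2: the first through e1, uniformly in k, the second for k large.
   The summands 1 keep the denominators positive. *)
pose e1 := e / (2 * (C * (2 ^+ d * K) + 1)).
have CK0 : 0 <= C * (2 ^+ d * K) by rewrite !mulr_ge0// exprn_ge0.
have e10 : 0 < e1 by rewrite divr_gt0// mulr_gt0//; lra.
have [c c0 cP] := bound _ e10.
have e2 : 0 < e / 2 / (C * c + 1) by rewrite !divr_gt0//; have := mulr_ge0 C0 c0; lra.
have /cvgrPdist_le/(_ _ e2) := b0; apply: filterS => k.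
rewrite !sub0r !normrN => bk; apply: le_trans (cP k) _.
have bk' := le_trans (ler_norm _) bk; rewrite mulrDr [leRHS](splitr e); apply: lerD.
  rewrite /e1 mulrCA mulrAC ler_pdivrMr; last by rewrite mulr_gt0//; lra.
  rewrite (_ : e / 2 * _ = e * (C * (2 ^+ d * K) + 1)); last by field.
  by rewrite ler_pM2l//; lra.
rewrite mulrA; have Cc := mulr_ge0 C0 c0.
apply: le_trans (ler_wpM2l Cc bk') _; rewrite mulrCA ler_piMr//; first by lra.
by rewrite ler_pdivrMr ?mul1r; lra.
Qed.

End weak_Lp.

(** * Divergence and curl *)

Section difference_quotients.
Context {R : realType} (m : nat).
Local Notation V := 'rV[R]_m.
Implicit Types (x v : V) (f : V -> R).

Definition dq (v : V) (h : R) f (x : V) : R := h^-1 * (f (h *: v + x) - f x).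

Lemma is_derive_line f x v (t : R) : (forall y, derivable f y v) ->
  is_derive t 1 (fun s : R => f (s *: v + x)) ('D_v f (t *: v + x)).
Proof.
move=> df.
have eqf : (fun h : R => h^-1 *: (((fun s : R => f (s *: v + x)) \o shift t) (h *: 1) - f (t *: v + x)))
    = (fun h : R => h^-1 *: ((f \o shift (t *: v + x)) (h *: v) - f (t *: v + x))).
  apply/funext => h; congr (_ *: (f _ - _)).
  by rewrite /= scalerDl addrA /GRing.scale/= mulr1.
split; first by rewrite /derivable eqf; exact: df.
by rewrite /derive eqf.
Qed.

Lemma dq_bound f x v (M h : R) : (forall y, derivable f y v) ->
  (forall y, `|'D_v f y| <= M) -> `|f (h *: v + x) - f x| <= M * `|h|.
Proof.
move=> df fM; pose g (s : R) := f (s *: v + x).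
have dg (t : R) : is_derive t (1 : R) g ('D_v f (t *: v + x)) by exact: is_derive_line.
have cg : continuous g.
  by move=> t; apply: differentiable_continuous; apply/derivable1_diffP; exact: ex_derive.
have g0 : g 0 = f x by rewrite /g scale0r add0r.
rewrite -g0; have [h0|/ltW h0] := leP 0 h.
  have [c _ ->] := MVT_segment h0 (fun t _ => dg t) (continuous_subspaceT cg).
  by rewrite subr0 normrM ler_wpM2r.
have [c _ e] := MVT_segment h0 (fun t _ => dg t) (continuous_subspaceT cg).
by rewrite distrC e sub0r normrM normrN ler_wpM2r.
Qed.

Lemma dq_cvg f x v (h : nat -> R) : derivable f x v -> (forall n, h n != 0) ->
  h n @[n --> \oo] --> (0 : R) -> dq v (h n) f x @[n --> \oo] --> 'D_v f x.
Proof.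
move=> df h0 hcv.
have /cvgr_dnbhsP : (fun s : R => s^-1 *: ((f \o shift x) (s *: v) - f x)) s @[s --> 0^'] --> 'D_v f x.
  exact: df.
by apply; split.
Qed.

Lemma is_derive_dq_cvg f x v (a : R) (h : nat -> R) :
  is_derive (0 : R) 1 (fun t : R => f (t *: v + x)) a -> (forall n, h n != 0) ->
  h n @[n --> \oo] --> (0 : R) -> dq v (h n) f x @[n --> \oo] --> a.
Proof.
move=> [dg ga] h0 hcv.
have /cvgr_dnbhsP H : (fun s : R => s^-1 *: (((fun t : R => f (t *: v + x)) \o shift 0) (s *: 1) -
    f (0 *: v + x))) s @[s --> 0^'] --> a.
  by rewrite -ga; exact: dg.
apply: eq_cvgn (H h (conj h0 hcv)) _ erefl => n.
rewrite /dq /= addr0 scale0r add0r.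
by have -> : h n *: (1 : R) = h n by exact: mulr1.
Qed.

Lemma measurable_shift (b : V) : measurable_fun setT (fun x : V => b + x).
Proof.
by have := measurable_rV_affine 1 b; under eq_fun do rewrite scale1r addrC.
Qed.

Lemma measurable_dq (v : V) (h : R) f : measurable_fun setT f -> measurable_fun setT (dq v h f).
Proof.
move=> mf; apply: measurable_funM => //; apply: measurable_funB => //.
exact: (measurableT_comp mf (measurable_shift (h *: v))).
Qed.

Lemma Rintegral_translate (G : V -> R) (b : V) : measurable_fun setT G ->
  (leb m).-integrable setT (EFin \o (fun x => G (b + x))) ->
  \int[leb m]_x G (b + x) = \int[leb m]_x G x.
Proof.
move=> mG iG; rewrite /Rintegral; congr fine; apply/esym.
have mEG : measurable_fun setT (EFin \o G) by exact/measurable_EFinP.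
have H := @integral_pushforward _ _ _ _ _ _ (measurable_shift b) (leb m) setT _ mEG iG measurableT.
rewrite -[RHS]H.
apply: (@eq_measure_integral _ _ _ _ (push_measure (leb m) (measurable_shift b)) (leb m)) => A mA _.
rewrite -[LHS](leb_translate b mA) /= /pushforward; congr (leb m _).
by apply/seteqP; split => x /=; rewrite addrC.
Qed.

End difference_quotients.

Section test_functions.
Context {R : realType} (d : nat).
Local Notation V := 'rV[R]_d.+1.
Local Notation Om := (Omega R d).
Local Notation dl i := (delta_mx 0 i : V).
Variables (phi : V -> R) (tphi : test_fun Om phi).

Lemma test_fun_C0 : C0 Om phi.
Proof.
have [sphi [K [cK KO phi0]]] := tphi; split.
  by apply: continuous_subspaceT; have [] := sphi [::].
by move=> e e0; exists K; split => // x _ nKx; rewrite phi0// normr0.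
Qed.

Lemma test_fun_out x : ~ Om x -> phi x = 0.
Proof. by have [_ [K [_ KO phi0]]] := tphi => nOx; apply: phi0 => /KO. Qed.

Lemma test_fun_derivable i x : derivable phi x (dl i).
Proof. by have [sphi _] := tphi; have [_] := sphi [::]; exact. Qed.

(** The support is a compact subset of the cylinder, so phi vanishes in a neighbourhood of every
    outside point, boundary points included. *)
Lemma test_fun_partial_out i x : ~ Om x -> partial i phi x = 0.
Proof.
have [_ [K [cK KO phi0]]] := tphi => nOx.
have nKx : (~` K) x by move=> /KO.
have oK : open (~` K) by apply: closed_openC; exact: compact_closed (@norm_hausdorff _ V) cK.
rewrite /partial (@near_eq_derive _ _ _ phi (cst 0)) ?derive_cst//.
by near do apply: phi0; exact: open_nbhs_nbhs.
Unshelve. all: by end_near. Qed.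

Lemma test_fun_partial_C0 i : C0 Om (partial i phi).
Proof.
have [sphi [K [cK KO phi0]]] := tphi; split.
  by apply: continuous_subspaceT; have [] := sphi [:: i].
move=> e e0; exists K; split => // x _ nKx.
have oK : open (~` K) by apply: closed_openC; exact: compact_closed (@norm_hausdorff _ V) cK.
rewrite /partial (@near_eq_derive _ _ _ phi (cst 0)) ?derive_cst ?normr0//.
by near do apply: phi0; exact: open_nbhs_nbhs.
Unshelve. all: by end_near. Qed.

Lemma test_fun_measurable : measurable_fun setT phi.
Proof. by apply: continuous_measurable_rV; have [sphi _] := tphi; have [] := sphi [::]. Qed.

Lemma test_fun_partial_measurable i : measurable_fun setT (partial i phi).
Proof. by apply: continuous_measurable_rV; have [sphi _] := tphi; have [] := sphi [:: i]. Qed.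

Lemma test_fun_bounded : exists2 M, 0 <= M & forall x, `|phi x| <= M.
Proof.
have [M M0 phiM] := C0_bounded test_fun_C0; exists M => // x.
by have [/phiM//|/test_fun_out ->] := pselect (Om x); rewrite normr0.
Qed.

Lemma test_fun_partial_bounded i : exists2 M, 0 <= M & forall x, `|partial i phi x| <= M.
Proof.
have [M M0 phiM] := C0_bounded (test_fun_partial_C0 i); exists M => // x.
by have [/phiM//|/test_fun_partial_out ->] := pselect (Om x); rewrite normr0.
Qed.

End test_functions.

(** With [1 <= Q] the factor Q^(n-1) of the mean value theorem may be replaced by Q^n, which keeps
    predecessors out of the induction. *)
Lemma ler_dist_exprn (R : realDomainType) (n : nat) (Q a b : R) : 1 <= Q -> `|a| <= Q -> `|b| <= Q ->
  `|a ^+ n - b ^+ n| <= n%:R * Q ^+ n * `|a - b|.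
Proof.
move=> Q1 aQ bQ; have Q0 : 0 <= Q by exact: le_trans ler01 Q1.
elim: n => [|n IH]; first by rewrite !expr0 subrr normr0 !mul0r.
have -> : a ^+ n.+1 - b ^+ n.+1 = a * (a ^+ n - b ^+ n) + (a - b) * b ^+ n.
  by rewrite !exprS; ring.
apply: le_trans (ler_normD _ _) _; rewrite !normrM.
have bn : `|b ^+ n| <= Q ^+ n.+1.
  rewrite normrX; apply: le_trans (lerXn2r n _ _ bQ) _; rewrite ?nnegrE//.
  by rewrite exprS ler_peMl// exprn_ge0.
have := ler_pM (normr_ge0 a) (normr_ge0 _) aQ IH.
have := ler_wpM2l (normr_ge0 (a - b)) bn.
by rewrite -natr1 exprS; nra.
Qed.

Section cubes.
Context {R : realType} (d : nat).
Local Notation V := 'rV[R]_d.+1.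
Local Notation r x := (enorm (xpr x)).
Local Notation dl i := (delta_mx 0 i : V).

Lemma xprD x y : xpr (x + y) = xpr x + xpr y :> 'rV[R]_d.
Proof. by apply/rowP => i; rewrite !mxE. Qed.

Lemma xpr_shift_ordmax t x : xpr (t *: dl ord_max + x) = xpr x.
Proof.
apply/rowP => i; rewrite !mxE eqxx/= eq_sym (negbTE (neq_lift _ _))/=.
by rewrite mulr0 add0r.
Qed.

Lemma xlast_shift i t x : xlast (t *: dl i + x) = t * (ord_max == i)%:R + xlast x.
Proof. by rewrite /xlast !mxE eqxx. Qed.

Lemma enorm_delta i : enorm (dl i) = 1.
Proof.
rewrite /enorm /dotv (bigD1 i)//= big1 ?addr0.
  by rewrite mxE !eqxx/= mulr1 sqrtr1.
by move=> j ji; rewrite !mxE eqxx/= (negbTE ji) mulr0.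
Qed.

(** Along a horizontal line |x'| is the square root of a quadratic polynomial in t;
    [potential_dq_cvg] differentiates it in this form. *)
Lemma sqr_enorm_shift_lift j t x :
  r (t *: dl (lift ord_max j) + x) = Num.sqrt (r x ^+ 2 + t * (2 * x 0 (lift ord_max j) + t)).
Proof.
rewrite -[LHS]ger0_norm ?enorm_ge0// -sqrtr_sqr; congr Num.sqrt; rewrite !sqr_enorm xprD.
have -> : xpr (t *: dl (lift ord_max j)) = t *: (delta_mx 0 j : 'rV[R]_d).
  by apply/rowP => i; rewrite !mxE eqxx (inj_eq lift_inj).
have dj (z : 'rV[R]_d) : dotv (delta_mx 0 j) z = z 0 j.
  rewrite /dotv (bigD1 j)//= big1 ?addr0; first by rewrite mxE !eqxx mul1r.
  by move=> i ij; rewrite mxE eqxx/= (negbTE ij) mul0r.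
rewrite !dotvDl !dotvDr !dotvZl !dotvZr (dotvC (xpr x)) !dj.
by rewrite !mxE !eqxx/=; ring.
Qed.

Lemma cube_enorm k (x : V) : cube k x -> enorm x <= d.+1%:R * k%:R.
Proof.
move=> xk; apply: le_trans (ler_enorm_sum _) _.
apply: (@le_trans _ _ (\sum_(i < d.+1) k%:R)); last by rewrite sumr_const card_ord mulr_natl.
by apply: ler_sum => i _; have := xk i; rewrite /= in_itv/= ler_norml.
Qed.

Lemma cubeP k (x : V) : cube k x <-> forall i, `|x 0 i| <= k%:R.
Proof. by split => xk i; have := xk i; rewrite /= in_itv/= ler_norml. Qed.

Lemma cubeD k l (x y : V) : cube k x -> cube l y -> cube (k + l) (x + y).
Proof.
move=> /cubeP xk /cubeP yl; apply/cubeP => i; rewrite mxE natrD.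
exact: le_trans (ler_normD _ _) (lerD _ _).
Qed.

Lemma cubeN k (x : V) : cube k x -> cube k (- x).
Proof. by move=> /cubeP xk; apply/cubeP => i; rewrite mxE normrN. Qed.

Lemma cube0 k : cube k (0 : V).
Proof. by apply/cubeP => i; rewrite mxE normr0. Qed.

Lemma sub_cube k l : (k <= l)%N -> cube k `<=` (cube l : set V).
Proof. by move=> kl x /cubeP xk; apply/cubeP => i; rewrite (le_trans (xk i))// ler_nat. Qed.

Lemma cube_delta i (h : R) : `|h| <= 1 -> cube 1 (h *: dl i).
Proof.
move=> h1; apply/cubeP => j; rewrite !mxE; case: (_ && _); rewrite ?mulr1//.
by rewrite mulr0 normr0.
Qed.

Lemma cube_shift k i (h : R) (x : V) : `|h| <= 1 -> cube k x -> cube k.+1 (h *: dl i + x).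
Proof. by move=> h1 xk; exact: (cubeD (cube_delta i h1) xk). Qed.

(** A crude bound for |1 - |x'|| on [cube k], at least 1 so that its powers increase with the
    exponent. *)
Definition profile_bound k : R := 1 + d.+1%:R * k%:R.

Lemma cube_profile k (x : V) : cube k x -> `|1 - r x| <= profile_bound k.
Proof.
move=> /cube_enorm xk; apply: le_trans (ler_normB _ _) _; rewrite normr1 lerD2l.
by rewrite ger0_norm ?enorm_ge0// (le_trans (ler_xpr_enorm x)).
Qed.

Lemma profile_bound_ge1 k : 1 <= profile_bound k.
Proof. by rewrite /profile_bound lerDl mulr_ge0. Qed.

Lemma cube_profileX_bounded l k (x : V) : cube k x -> `|(1 - r x) ^+ l| <= profile_bound k ^+ l.
Proof.
move=> xk; rewrite normrX lerXn2r ?nnegrE//; last exact: cube_profile.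
exact: le_trans ler01 (profile_bound_ge1 k).
Qed.

Lemma cube_xlast k (x : V) : cube k x -> `|xlast x| <= k%:R.
Proof. by move=> xk; have := xk ord_max; rewrite /= in_itv/= -ler_norml. Qed.

End cubes.

(** * The potential of eta_n *)

Section potentials.
Context {R : realType} (d n : nat).
Local Notation V := 'rV[R]_d.+1.
Local Notation r x := (enorm (xpr x)).
Local Notation dl i := (delta_mx 0 i : V).

(* eta_(n+1) is, up to the factor n^((N-1)/p'), the gradient of
   u(x) = x_N (1 - |x'|)^(n+1) away from the axis. *)
Definition potential (x : V) : R := xlast x * (1 - r x) ^+ n.+1.

Definition potential_grad (i : 'I_d.+1) (x : V) : R :=
  if unlift ord_max i is Some j
  then - (n.+1%:R * (1 - r x) ^+ n * (xlast x * ((r x)^-1 * x 0 (lift ord_max j))))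
  else (1 - r x) ^+ n.+1.

Lemma eta_seq_grad p i x :
  eta_seq d p n.+1 x 0 i = n.+1%:R `^ exponent' d p * potential_grad i x.
Proof.
rewrite /potential_grad; case: (unliftP ord_max i) => [j|] ->.
  by rewrite eta_seq_lift; ring.
by rewrite eta_seq_ordmax.
Qed.

Lemma measurable_profile_setT k : measurable_fun setT (fun x : V => (1 - r x) ^+ k).
Proof. exact: (measurableT_comp (@measurable_profile_enorm R d k setT) (@measurable_xpr R d)). Qed.

Lemma measurable_potential : measurable_fun setT potential.
Proof. by apply: measurable_funM; [exact: measurable_xlast|exact: measurable_profile_setT]. Qed.

Lemma measurable_potential_grad i : measurable_fun setT (potential_grad i).
Proof.
rewrite /potential_grad; case: unliftP => [j _|_]; last exact: measurable_profile_setT.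
apply: measurable_funN.
apply: measurable_funM; last exact: measurable_eta_dir.
by apply: measurable_funM => //; exact: measurable_profile_setT.
Qed.

Lemma potential_grad_bounded i x : Omega R d x -> `|potential_grad i x| <= n.+1%:R.
Proof.
move=> Ox; rewrite /potential_grad; case: unliftP => [j _|_].
  have /andP[p0 p1] := Omega_profile_itv n Ox.
  rewrite normrN -[leRHS]mulr1; rewrite normrM; apply: ler_pM => //; last exact: eta_dir_le1.
  by rewrite normrM (ger0_norm p0) ger0_norm// -[leRHS]mulr1 ler_wpM2l.
have /andP[p0 p1] := Omega_profile_itv n.+1 Ox.
by rewrite ger0_norm// (le_trans p1)// ler1n.
Qed.

Lemma potential_dq_cvg i x (h : nat -> R) : xpr x != 0 -> (forall k, h k != 0) ->
  h k @[k --> \oo] --> (0 : R) -> dq (dl i) (h k) potential x @[k --> \oo] --> potential_grad i x.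
Proof.
move=> x0 h0 hcv; rewrite /potential_grad; case: (unliftP ord_max i) => [j|] ->; last first.
  (* In the vertical direction the potential is affine, so the difference quotient is constant. *)
  have := cvg_cst ((1 - r x) ^+ n.+1); move=> /(_ nat \oo _) H.
  apply: eq_cvgn H _ erefl => k.
  rewrite /dq /potential xpr_shift_ordmax xlast_shift eqxx mulr1 mulrDl addrK mulrA mulVf ?mul1r//.
apply: is_derive_dq_cvg => //.
have r0 : 0 < r x by rewrite enorm_gt0.
pose q (t : R) := r x ^+ 2 + t * (2 * x 0 (lift ord_max j) + t).
have dq0 : is_derive (0 : R) (1 : R) q (2 * x 0 (lift ord_max j)).
  have := is_deriveD (is_derive_cst (r x ^+ 2) (0 : R) (1 : R))
    (is_deriveM (is_derive_id (0 : R) (1 : R))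
      (is_deriveD (is_derive_cst (2 * x 0 (lift ord_max j)) (0 : R) (1 : R)) (is_derive_id (0 : R) (1 : R)))).
  move=> H; apply: is_derive_eq H _.
  by rewrite fctE /GRing.scale/= addr0 mulr1 mul0r !add0r.
have q0 : q 0 = r x ^+ 2 by rewrite /q mul0r addr0.
have dsqrt : is_derive (q 0) 1 (Num.sqrt : R -> R) (2 * r x)^-1.
  rewrite q0; have := @is_derive1_sqrt R (r x ^+ 2) (exprn_gt0 2 r0).
  by rewrite sqrtr_sqr gtr0_norm.
have dr := is_derive1_comp dsqrt dq0.
have sq0 : Num.sqrt (q 0) = r x by rewrite q0 sqrtr_sqr gtr0_norm.
have dp : is_derive ((Num.sqrt \o q) 0) 1 (fun y : R => (1 - y) ^+ n.+1) (- (n.+1%:R * (1 - r x) ^+ n)).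
  by rewrite /= sq0; exact: is_derive_onemXn.
have dpr := is_derive1_comp dp dr.
have := is_deriveZ (xlast x) dpr.
rewrite (_ : (xlast x \*: _) = (fun t : R => potential (t *: dl (lift ord_max j) + x))); last first.
  apply/funext => t; rewrite /potential xlast_shift (negbTE (neq_lift _ _)) mulr0 add0r.
  by rewrite sqr_enorm_shift_lift.
move=> H; apply: is_derive_eq H _.
by rewrite /GRing.scale/=; field; rewrite gt_eqF.
Qed.

Lemma potential_bounded k (x : V) : cube k x -> `|potential x| <= k%:R * profile_bound d k ^+ n.+1.
Proof.
by move=> xk; rewrite normrM ler_pM//; [exact: cube_xlast|exact: cube_profileX_bounded].
Qed.

(** The kink on the axis is harmless because |x'| is 1-Lipschitz. The first summand comes from the
    increment of x_N, the second from that of the profile, with |x_N| <= 2; the shifted point lies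
    in [cube 3]. *)
Lemma potential_dq_bounded i (h : R) (x : V) : h != 0 -> `|h| <= 1 -> cube 2 x ->
  `|dq (dl i) h potential x| <=
  profile_bound d 3 ^+ n.+1 + 2 * (n.+1%:R * profile_bound d 3 ^+ n.+1).
Proof.
move=> h0 h1 x2; have y3 := cube_shift i h1 x2; set y := h *: dl i + x in y3 *.
have x3 : cube 3 x by exact: sub_cube x2.
have h'0 : 0 < `|h| by rewrite normr_gt0.
rewrite /dq -/y normrM normfV ler_pdivrMl//.
have -> : potential y - potential x =
    (xlast y - xlast x) * (1 - r y) ^+ n.+1 + xlast x * ((1 - r y) ^+ n.+1 - (1 - r x) ^+ n.+1).
  by rewrite /potential; ring.
apply: le_trans (ler_normD _ _) _; rewrite [leRHS]mulrDr; apply: lerD; rewrite normrM.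
  apply: ler_pM => //; last exact: cube_profileX_bounded.
  by rewrite /y xlast_shift addrK; case: eqP => _; rewrite ?mulr1 ?mulr0 ?normr0.
have := ler_dist_exprn n.+1 (profile_bound_ge1 d 3) (cube_profile y3) (cube_profile x3).
have rr : `|(1 - r y) - (1 - r x)| <= `|h|.
  have -> : (1 - r y) - (1 - r x) = r x - r y by ring.
  apply: le_trans (ler_dist_enorm _ _) _; rewrite -xprB; apply: le_trans (ler_xpr_enorm _) _.
  by rewrite enorm_distC /y addrK enormZ enorm_delta mulr1.
move=> H; rewrite mulrCA; apply: ler_pM => //; first exact: cube_xlast.
apply: le_trans H _; rewrite mulrC ler_wpM2r// mulr_ge0// exprn_ge0//.
exact: le_trans ler01 (profile_bound_ge1 d 3).
Qed.

End potentials.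

(** * Discrete summation by parts *)

Section shifted_products.
Context {R : realType} (d : nat).
Local Notation V := 'rV[R]_d.+1.
Local Notation leb := (leb d.+1).
Local Notation dl i := (delta_mx 0 i : V).
Variables (u phi : V -> R) (M : R).
Hypothesis mu : measurable_fun setT u.
Hypothesis ubd : forall k, exists C, forall x, cube k x -> `|u x| <= C.
Hypothesis mphi : measurable_fun setT phi.
Hypothesis phiM : forall x, `|phi x| <= M.
Hypothesis phi0 : forall x, ~ cube 1 x -> phi x = 0.

Lemma cube_oo k : (leb (cube k : set V) < +oo)%E.
Proof. by rewrite [X in (X < _)%E]leb_cube ltry. Qed.

Lemma integrable_cube k C (f : V -> R) : measurable_fun setT f ->
  (forall x, cube k x -> `|f x| <= C) -> (forall x, ~ cube k x -> f x = 0) ->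
  leb.-integrable setT (EFin \o f).
Proof.
move=> mf fC f0; have i : leb.-integrable (cube k) (EFin \o f).
  apply: (bounded_integrable (M := C)) => //; [exact: measurable_cube|exact: cube_oo|].
  exact: measurable_funTS.
have := iffLR (integrable_mkcond _ (@measurable_cube R d.+1 k)) i; apply: eq_integrable => // x _.
by rewrite patchE; case: ifPn => // /negP; rewrite inE => /f0 /= ->.
Qed.

Definition shift_mul (v w x : V) : R := u (v + x) * phi (w + x).

Definition shift_pairing (v w : V) : R := \int[leb]_x shift_mul v w x.

Lemma measurable_shift_mul v w : measurable_fun setT (shift_mul v w).
Proof.
by apply: measurable_funM; apply: measurableT_comp => //; exact: measurable_shift.
Qed.

Lemma cube_subl k l (v x : V) : cube k v -> cube l (v + x) -> cube (k + l) x.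
Proof. by move=> /cubeN kv /(cubeD kv); rewrite addKr. Qed.

Lemma integrable_shift_mul v w : cube 1 v -> cube 1 w ->
  leb.-integrable setT (EFin \o shift_mul v w).
Proof.
move=> v1 w1; have [C uC] := ubd 3.
apply: (@integrable_cube 2 (C * M)); first exact: measurable_shift_mul.
  by move=> x x2; rewrite normrM ler_pM//; exact/uC/(cubeD v1).
by move=> x x2; rewrite /shift_mul phi0 ?mulr0// => /(cube_subl w1).
Qed.

(** Translation invariance of the integral, for shifts in [cube 1], where [integrable_shift_mul]
    applies. Integrals of products of difference quotients are combinations of pairings, so
    summation by parts becomes algebra. *)
Lemma shift_pairingD b v w : cube 1 v -> cube 1 w -> cube 1 (v + b) -> cube 1 (w + b) ->
  shift_pairing (v + b) (w + b) = shift_pairing v w.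
Proof.
move=> v1 w1 vb1 wb1; rewrite /shift_pairing -[RHS](@Rintegral_translate _ _ _ b).
- by apply: eq_Rintegral => x _; rewrite /shift_mul !addrA.
- exact: measurable_shift_mul.
- have := integrable_shift_mul vb1 wb1; apply: eq_integrable => // x _.
  by rewrite /= /shift_mul !addrA.
Qed.

Lemma Rintegral_mul_dq (w : V) g : cube 1 (g *: w) ->
  \int[leb]_x (u x * dq w g phi x) = g^-1 * (shift_pairing 0 (g *: w) - shift_pairing 0 0).
Proof.
move=> w1; have c0 := @cube0 R d 1.
rewrite /shift_pairing -RintegralB//; try exact: integrable_shift_mul.
rewrite -RintegralZl//; last by apply: integrable_EFinB => //; exact: integrable_shift_mul.
by apply: eq_Rintegral => x _; rewrite /shift_mul /dq !add0r; ring.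
Qed.

Lemma Rintegral_dq_dq (v w : V) h g : cube 1 (h *: v) -> cube 1 (g *: w) ->
  \int[leb]_x (dq v h u x * dq w g phi x) =
  (h^-1 * g^-1) * (shift_pairing (h *: v) (g *: w) - shift_pairing (h *: v) 0
                  - (shift_pairing 0 (g *: w) - shift_pairing 0 0)).
Proof.
move=> v1 w1; have c0 := @cube0 R d 1.
have iB a : cube 1 a -> leb.-integrable setT
    (EFin \o (fun x => shift_mul a (g *: w) x - shift_mul a 0 x)).
  by move=> a1; apply: integrable_EFinB => //; exact: integrable_shift_mul.
rewrite /shift_pairing -!RintegralB//; try exact: integrable_shift_mul; try exact: iB.
rewrite -RintegralZl//; last by apply: integrable_EFinB => //; exact: iB.
by apply: eq_Rintegral => x _; rewrite /shift_mul /dq !add0r; ring.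
Qed.

(* Summation by parts moves both difference quotients to the other factor,
   which is the discrete form of the symmetry of second derivatives. *)
Lemma Rintegral_dq_swap i j (h : R) : `|h| <= 1 ->
  \int[leb]_x (dq (dl j) h u x * dq (dl i) h phi x) =
  \int[leb]_x (dq (dl i) (- h) u x * dq (dl j) (- h) phi x).
Proof.
move=> h1; have hN1 : `|- h| <= 1 by rewrite normrN.
have [ci cj] := (cube_delta i h1, cube_delta j h1).
have [cNi cNj] := (cube_delta i hN1, cube_delta j hN1).
have c0 := @cube0 R d 1.
rewrite !Rintegral_dq_dq// invrN mulrNN; congr (_ * _).
have e1 : shift_pairing (h *: dl j) (h *: dl i) = shift_pairing (- h *: dl i) (- h *: dl j).
  rewrite -(@shift_pairingD (h *: dl i + h *: dl j) (- h *: dl i))//.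
  - by rewrite addrA (addrC (h *: dl i)) addrA -!scalerDl addNr !scale0r !add0r.
  - by rewrite addrA -scalerDl addNr scale0r add0r.
  - by rewrite addrCA -scalerDl addNr scale0r addr0.
have e2 : shift_pairing (h *: dl j) 0 = shift_pairing 0 (- h *: dl j).
  by rewrite -(@shift_pairingD (h *: dl j) 0) ?add0r// -scalerDl addNr scale0r.
have e3 : shift_pairing 0 (h *: dl i) = shift_pairing (- h *: dl i) 0.
  by rewrite -(@shift_pairingD (h *: dl i) (- h *: dl i)) ?add0r// -scalerDl addNr scale0r.
by rewrite e1 e2 e3; ring.
Qed.

End shifted_products.

Section distributional_limits.
Context {R : realType} (d : nat).
Local Notation V := 'rV[R]_d.+1.
Local Notation leb := (leb d.+1).
Local Notation Om := (Omega R d).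
Local Notation dl i := (delta_mx 0 i : V).
Variables (phi : V -> R) (tphi : test_fun Om phi).

Lemma Omega_cube : Om `<=` (cube 1 : set V).
Proof.
move=> x [r1 /andP[l0 l1]]; apply/cubeP => i; case: (unliftP ord_max i) => [j|] ->.
  have := ler_coord_enorm (xpr x) j; rewrite !mxE => /le_trans; apply; exact: ltW.
by rewrite -/(xlast x) ger0_norm ltW.
Qed.

Lemma test_fun_out_cube x : ~ cube 1 x -> phi x = 0.
Proof. by move=> nx; apply: (test_fun_out tphi) => /Omega_cube. Qed.

Lemma Rintegral_Omega_partial (f : V -> R) i :
  \int[leb]_(x in Om) (f x * partial i phi x) = \int[leb]_x (f x * partial i phi x).
Proof.
rewrite Rintegral_mkcond; apply: eq_Rintegral => x _; rewrite patchE.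
case: ifPn => // /negP; rewrite inE => nOx.
by rewrite (test_fun_partial_out tphi i nOx) mulr0.
Qed.

(** The function phi vanishes outside [cube 1] and the steps are at most 1, so its difference
    quotients vanish outside [cube 2], and C M on that cube dominates. Convergence of W almost
    everywhere leaves room for the axis. *)
Lemma dq_pairing_cvg i (W : nat -> V -> R) (w : V -> R) (h : nat -> R) (C : R) :
  (forall k, measurable_fun setT (W k)) -> measurable_fun setT w ->
  (forall k x, cube 2 x -> `|W k x| <= C) ->
  {ae leb, forall x, W k x @[k --> \oo] --> w x} ->
  (forall k, h k != 0) -> (forall k, `|h k| <= 1) -> h k @[k --> \oo] --> (0 : R) ->
  \int[leb]_x (W k x * dq (dl i) (h k) phi x) @[k --> \oo] -->
  \int[leb]_(x in Om) (w x * partial i phi x).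
Proof.
move=> mW mw WC Ww h0 h1 hcv; rewrite Rintegral_Omega_partial.
have [M M0 pM] := test_fun_partial_bounded tphi i.
have C0 : 0 <= C by apply: le_trans (WC 0 0 _) => //; exact: cube0.
pose g : V -> R := (cst (C * M)) \_ (cube 2).
have mphi := test_fun_measurable tphi.
apply: (@Rintegral_dominated_convergence _ _ _ _ _ _ _ g) => //.
- by move=> k; apply: measurable_funM => //; exact: measurable_dq.
- by apply: measurable_funM => //; exact: test_fun_partial_measurable tphi i.
- apply: filterS Ww => x Wx _; apply: cvgM => //.
  by apply: dq_cvg => //; exact: test_fun_derivable.
- apply: (@integrable_cube _ _ 2 (C * M)).
  + by apply/(measurable_restrictT _ (@measurable_cube R d.+1 2)) => //; exact: measurable_cst.
  + by move=> x x2; rewrite /g patchE mem_set// ger0_norm// mulr_ge0.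
  + by move=> x nx; rewrite /g patchE memNset.
- move=> k x _; rewrite /g patchE; case: ifPn => [|/negP]; rewrite inE => x2.
    rewrite normrM; apply: ler_pM => //; first exact: WC.
    rewrite /dq normrM normfV ler_pdivrMl ?normr_gt0// mulrC.
    by apply: dq_bound => // y; exact: test_fun_derivable.
  rewrite /dq !test_fun_out_cube ?subrr ?mulr0 ?normr0// => x1; apply: x2.
    exact: sub_cube x1.
  exact: cube_subl (cube_delta i (h1 k)) x1.
Qed.

End distributional_limits.

Section differential_constraints.
Context {R : realType} (d : nat).
Local Notation V := 'rV[R]_d.+1.
Local Notation leb := (leb d.+1).
Local Notation Om := (Omega R d).
Local Notation r x := (enorm (xpr x)).
Local Notation dl i := (delta_mx 0 i : V).

Let h (k : nat) : R := k.+1%:R^-1.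

Let h_neq0 k : h k != 0. Proof. by rewrite invr_eq0 pnatr_eq0. Qed.

Let h_le1 k : `|h k| <= 1.
Proof. by rewrite ger0_norm ?invr_ge0// invf_le1 ?ltr0n// ler1n. Qed.

Let h_cvg : h k @[k --> \oo] --> (0 : R). Proof. exact: cvg_harmonic. Qed.

(** The two sides are the limits of the two members of [Rintegral_dq_swap], one along the steps h k
    and the other along -h k. *)
Lemma potential_grad_symm n i j phi : (0 < d)%N -> test_fun Om phi ->
  \int[leb]_(x in Om) (potential_grad n j x * partial i phi x) =
  \int[leb]_(x in Om) (potential_grad n i x * partial j phi x).
Proof.
move=> d0 tphi.
pose C : R := profile_bound d 3 ^+ n.+1 + 2 * (n.+1%:R * profile_bound d 3 ^+ n.+1).
have lim a b (s : nat -> R) : (forall k, s k != 0) -> (forall k, `|s k| <= 1) ->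
    s k @[k --> \oo] --> (0 : R) ->
    \int[leb]_x (dq (dl a) (s k) (potential n) x * dq (dl b) (s k) phi x) @[k --> \oo] -->
    \int[leb]_(x in Om) (potential_grad n a x * partial b phi x).
  move=> s0 s1 scv; apply: (@dq_pairing_cvg _ _ _ tphi b _ _ _ C) => //.
  - by move=> k; apply: measurable_dq; exact: measurable_potential.
  - exact: measurable_potential_grad.
  - by move=> k x; exact: potential_dq_bounded.
  - apply: filterS (axis_negligible d0) => x x0; exact: potential_dq_cvg.
have hN0 k : - h k != 0 by rewrite oppr_eq0.
have hN1 k : `|- h k| <= 1 by rewrite normrN.
have hNcv : - h k @[k --> \oo] --> (0 : R) by rewrite -[0]oppr0; exact: cvgN.
have [M _ phiM] := test_fun_bounded tphi.
have swap k := @Rintegral_dq_swap R d (potential n) phi M (@measurable_potential R d n)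
  (fun l => ex_intro _ _ (@potential_bounded R d n l)) (test_fun_measurable tphi) phiM
  (test_fun_out_cube tphi) i j (h k) (h_le1 k).
have := eq_cvgn (lim j i _ h_neq0 h_le1 h_cvg) (fun k => esym (swap k)) erefl.
by move=> /cvg_unique; apply=> //; exact: lim.
Qed.

Lemma eta_curl_free p n : (0 < d)%N -> curl_free Om (eta_seq d p n.+1).
Proof.
move=> d0 i j phi tphi; set c := n.+1%:R `^ exponent' d p.
have int a b : leb.-integrable Om
    (EFin \o (fun x => potential_grad n a x * partial b phi x)).
  have [M M0 pM] := test_fun_partial_bounded tphi b.
  apply: (bounded_integrable (M := n.+1%:R * M)).
  - exact: measurable_Omega.
  - exact: Omega_oo.
  - apply: measurable_funM; apply: measurable_funTS; first exact: measurable_potential_grad.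
    exact: test_fun_partial_measurable tphi b.
  - by move=> x Ox; rewrite normrM ler_pM//; exact: potential_grad_bounded.
have mO := @measurable_Omega R d.
transitivity (\int[leb]_(x in Om) (c * (potential_grad n j x * partial i phi x
                                - potential_grad n i x * partial j phi x))).
  by apply: eq_Rintegral => x _; rewrite !eta_seq_grad -/c; ring.
rewrite RintegralZl//; last by apply: integrable_EFinB.
by rewrite RintegralB// (potential_grad_symm n i j d0 tphi) subrr mulr0.
Qed.

(** The profile does not depend on x_N: once translation invariance has moved the vertical shift
    from phi to the profile, the integral against each difference quotient is 0. *)
Lemma profile_partial_N n phi : test_fun Om phi ->
  \int[leb]_(x in Om) ((1 - r x) ^+ n * partial ord_max phi x) = 0.
Proof.
move=> tphi; pose u (x : V) : R := (1 - r x) ^+ n.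
have [M _ phiM] := test_fun_bounded tphi.
have ubd l : exists C, forall x, cube l x -> `|u x| <= C.
  by eexists => x; exact: cube_profileX_bounded.
have mu : measurable_fun setT u by exact: measurable_profile_setT.
have := @dq_pairing_cvg _ _ _ tphi ord_max (fun=> u) u h _ (fun=> mu) mu
  (fun _ x => @cube_profileX_bounded R d n 2 x).
have uu : {ae leb, forall x, u x @[_ --> \oo] --> u x} by apply: aeW => x; exact: cvg_cst.
move=> /(_ uu h_neq0 h_le1 h_cvg) /cvg_unique; apply=> //.
apply: eq_cvgn (cvg_cst 0) _ erefl => k.
have tphim := test_fun_measurable tphi; have tphi0 := test_fun_out_cube tphi.
have cN := @cube_delta R d ord_max _ (h_le1 k).
rewrite (Rintegral_mul_dq mu ubd tphim phiM tphi0 cN).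
have c0 := @cube0 R d 1; have := cubeN cN; rewrite -scaleNr => cNN.
have -> : shift_pairing u phi 0 (h k *: dl ord_max) = shift_pairing u phi (- h k *: dl ord_max) 0.
  rewrite -(shift_pairingD mu ubd tphim phiM tphi0 (b := h k *: dl ord_max) cNN c0) ?add0r//;
  by rewrite -scalerDl addNr scale0r.
suff -> : shift_pairing u phi (- h k *: dl ord_max) 0 = shift_pairing u phi 0 0 by rewrite subrr mulr0.
by apply: eq_Rintegral => x _; rewrite /shift_mul /u xpr_shift_ordmax !add0r.
Qed.

Lemma sigma_div_free p n : div_free Om (sigma_seq d p n).
Proof.
move=> phi tphi; have mO := @measurable_Omega R d; set c := n%:R `^ (d%:R / p).
have [M M0 pM] := test_fun_partial_bounded tphi ord_max.
transitivity (\int[leb]_(x in Om) (c * ((1 - r x) ^+ n * partial ord_max phi x))).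
  apply: eq_Rintegral => x _; rewrite (bigD1 ord_max)//= big1 ?addr0 => [|i ne].
    by rewrite sigma_seqE e_N_ordmax -/c; ring.
  by rewrite !mxE eqxx (negbTE ne) !(mulr0, mul0r).
rewrite RintegralZl// ?profile_partial_N ?mulr0//.
apply: (bounded_integrable (M := M)) => //; first exact: Omega_oo.
  apply: measurable_funM; apply: measurable_funTS; first exact: measurable_profile_setT.
  exact: test_fun_partial_measurable tphi ord_max.
move=> x Ox; have /andP[p0 p1] := Omega_profile_itv n Ox.
by rewrite normrM -[leRHS]mul1r ler_pM// ger0_norm.
Qed.

End differential_constraints.

Section components.
Context {R : realType} (d : nat) (p q : R).
Hypotheses (d0 : (0 < d)%N) (p1 : 1 <= p) (q1 : 1 <= q).
Hypothesis pq : p^-1 + q^-1 = 1 + d%:R^-1.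
Local Notation Om := (Omega R d).
Local Notation r x := (enorm (xpr x)).

Lemma measurable_sigma_seq n i : measurable_fun Om (fun x => sigma_seq d p n x 0 i).
Proof.
under eq_fun do rewrite sigma_seqE; apply: measurable_funTS.
by apply: measurable_funM => //; apply: measurable_funM => //; exact: measurable_profile_setT.
Qed.

Lemma measurable_eta_seq n i : measurable_fun Om (fun x => eta_seq d p n.+1 x 0 i).
Proof.
under eq_fun do rewrite eta_seq_grad; apply: measurable_funTS.
by apply: measurable_funM => //; exact: measurable_potential_grad.
Qed.

(** The derivative of the profile has exponent n, so both sequences are bounded in that form, scale
    n + 1 with exponent n, as [weak_Lp_cvg0] expects. *)
Lemma ler_profileS n x : Om x -> (1 - r x) ^+ n.+1 <= (1 - r x) ^+ n.
Proof.
move=> Ox; have /andP[b0 b1] := Omega_profile_itv 1 Ox.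
have /andP[n0 _] := Omega_profile_itv n Ox.
by rewrite exprS ler_piMl.
Qed.

Lemma sigma_seq_bound n i x : Om x ->
  `|sigma_seq d p n.+1 x 0 i| <= n.+1%:R `^ (d%:R / p) * (1 - r x) ^+ n.
Proof.
move=> Ox; have /andP[a0 _] := Omega_profile_itv n.+1 Ox.
rewrite sigma_seqE normrM (ger0_norm (mulr_ge0 (powR_ge0 _ _) a0)) -[leRHS]mulr1.
apply: ler_pM => //; first exact: mulr_ge0 (powR_ge0 _ _) a0.
  by rewrite ler_wpM2l ?powR_ge0 ?ler_profileS.
by rewrite /e_N mxE; case: (_ && _); rewrite ?normr1 ?normr0.
Qed.

Lemma eta_seq_bound n i x : Om x ->
  `|eta_seq d p n.+1 x 0 i| <= n.+1%:R `^ (d%:R / q) * (1 - r x) ^+ n.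
Proof.
move=> Ox; have /andP[a0 _] := Omega_profile_itv n Ox.
have /andP[b0 _] := Omega_profile_itv n.+1 Ox.
rewrite -(powR_exponentS n d0 p1 q1 pq); have e0 := powR_ge0 (n.+1%:R : R) (exponent' d p).
case: (unliftP ord_max i) => [j|] ->.
  have c0 : 0 <= n.+1%:R `^ exponent' d p * n.+1%:R * (1 - r x) ^+ n.
    by rewrite !mulr_ge0.
  rewrite eta_seq_lift normrN normrM (ger0_norm c0) -[leRHS]mulr1.
  by rewrite ler_wpM2l// eta_dir_le1.
rewrite eta_seq_ordmax ger0_norm ?mulr_ge0//; apply: ler_pM => //; last exact: ler_profileS.
by rewrite ler_peMr// ler1n.
Qed.

Lemma sigma_weak_Lp : 1 < p -> weak_LpN_cvg Om p (fun n => sigma_seq d p n.+1) (fun=> 0).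
Proof.
move=> p_gt1 i; under [X in weak_Lp_cvg _ _ _ X]eq_fun do rewrite mxE.
apply: (@weak_Lp_cvg0 _ _ d0 _ 1) => // [k|k x Ox]; first exact: measurable_sigma_seq.
by rewrite mul1r sigma_seq_bound.
Qed.

Lemma eta_weak_Lp : 1 < q -> weak_LpN_cvg Om q (fun n => eta_seq d p n.+1) (fun=> 0).
Proof.
move=> q_gt1 i; under [X in weak_Lp_cvg _ _ _ X]eq_fun do rewrite mxE.
apply: (@weak_Lp_cvg0 _ _ d0 _ 1) => // [k|k x Ox]; first exact: measurable_eta_seq.
by rewrite mul1r eta_seq_bound.
Qed.

Lemma in_L1_profile_bound n (c : R) (f : 'rV[R]_d.+1 -> R) : 0 <= c -> measurable_fun Om f ->
  (forall x, Om x -> `|f x| <= c * (1 - r x) ^+ n) -> in_Lp Om 1 f.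
Proof.
move=> c0 mf fc; apply: (@in_L1_bounded _ _ _ c) => // x Ox; apply: le_trans (fc x Ox) _.
by have /andP[_ a1] := Omega_profile_itv n Ox; rewrite ler_piMr.
Qed.

(** With w the volume of the unit ball this reads d w (d-1)! = w d!; it converts the constant of the
    concentration lemmas into the stated one. *)
Lemma sphere_area_fact : sphere_area d * (d.-1)`!%:R = fine (leb d (eball 1)) * d`!%:R :> R.
Proof.
case: d d0 => // k _; rewrite sphere_areaE factS natrM /=; ring.
Qed.

Lemma sigma_weakstarN : p = 1 -> weakstarN_cvg Om (fun n => sigma_seq d p n.+1)
  (fun i phi => sphere_area d * (d.-1)`!%:R * line_measure phi * e_N d 0 i).
Proof.
move=> pE i; split=> [k|phi Cphi].
  apply: (@in_L1_profile_bound k _ _ (powR_ge0 _ _)); first exact: measurable_sigma_seq.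
  by move=> x; exact: sigma_seq_bound.
have := cvgn_mull (c := e_N d 0 i) (sigma_weakstar d0 Cphi).
move=> H; apply: eq_cvgn H _ _; last by rewrite sphere_area_fact mulrC.
move=> k; rewrite -RintegralZl; last 2 first.
- exact: measurable_Omega.
- exact: integrable_sigma.
by apply: eq_Rintegral => x _; rewrite sigma_seqE pE divr1 powR_mulrn//; ring.
Qed.

Lemma eta_weakstarN : q = 1 -> weakstarN_cvg Om (fun n => eta_seq d p n.+1) (fun _ _ => 0).
Proof.
move=> qE i; split=> [k|phi Cphi].
  apply: (@in_L1_profile_bound k _ _ (powR_ge0 _ _)); first exact: measurable_eta_seq.
  by move=> x; exact: eta_seq_bound.
have eE n : n.+1%:R `^ exponent' d p * n.+1%:R = n.+1%:R ^+ d :> R.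
  by rewrite (powR_exponentS n d0 p1 q1 pq) qE divr1 powR_mulrn.
case: (unliftP ord_max i) => [j|] ->.
  apply: eq_cvgn (eta_dir_weakstar d0 j Cphi) _ erefl => n.
  by apply: eq_Rintegral => x _; rewrite eta_seq_lift eE.
apply: eq_cvgn (eta_last_weakstar d0 Cphi) _ erefl => n.
by apply: eq_Rintegral => x _; rewrite eta_seq_ordmax -eE mulfK ?pnatr_eq0.
Qed.

Lemma sigma_eta_weakstar_cvg :
  weakstar_cvg Om (fun n x => dotv (sigma_seq d p n.+1 x) (eta_seq d p n.+1 x))
    (fun phi => sphere_area d * ((d.-1)`!%:R / 2 ^+ d) * line_measure phi).
Proof.
split=> [k|phi Cphi].
  apply: (@in_L1_profile_bound (k.+1 * 2) (k.+1%:R ^+ d)); first exact: exprn_ge0.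
    under eq_fun do rewrite dotv_sigma_eta//; apply: measurable_funTS.
    by apply: measurable_funM => //; exact: measurable_profile_setT.
  move=> x Ox; have /andP[a0 _] := Omega_profile_itv (k.+1 * 2) Ox.
  by rewrite dotv_sigma_eta// ger0_norm// mulr_ge0// exprn_ge0.
apply: eq_cvgn (sigma_eta_weakstar d0 Cphi) _ _; last by rewrite -sphere_area_fact; ring.
by move=> k; apply: eq_Rintegral => x _; rewrite dotv_sigma_eta.
Qed.

End components.

(* The sequences start at n = 1, hence the shifts n.+1. *)
Theorem proposition2p15 (R : realType) (N : nat) (p q : R)
    (hN : (2 <= N)%N) (hp : 1 <= p) (hq : 1 <= q)
    (hpq : p^-1 + q^-1 = 1 + (N.-1%:R)^-1) :
  let d := N.-1 in
  let Om := Omega R d in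
  let sigma_ n := sigma_seq d p n in
  let eta_ n := eta_seq d p n in
  (forall n : nat, (1 <= n)%N -> div_free Om (sigma_ n)) /\
  (forall n : nat, (1 <= n)%N -> curl_free Om (eta_ n)) /\
  (1 < p -> weak_LpN_cvg Om p (fun n => sigma_ n.+1) (fun=> 0)) /\
  (p = 1 -> weakstarN_cvg Om (fun n => sigma_ n.+1)
     (fun i phi => sphere_area d * ((N - 2)`!)%:R * line_measure phi
                   * e_N d 0 i)) /\
  (1 < q -> weak_LpN_cvg Om q (fun n => eta_ n.+1) (fun=> 0)) /\
  (q = 1 -> weakstarN_cvg Om (fun n => eta_ n.+1) (fun _ _ => 0)) /\
  weakstar_cvg Om (fun n x => dotv (sigma_ n.+1 x) (eta_ n.+1 x))
    (fun phi => sphere_area d * (((N - 2)`!)%:R / 2 ^+ N.-1)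
                * line_measure phi).
Proof.
case: N hN hpq => [|[|k]] // _ hpq; rewrite /= in hpq *.
have -> : (k.+2 - 2)%N = k by rewrite !subSS subn0.
split=> [n _|]; first exact: sigma_div_free.
split=> [[|n] // _|]; first exact: eta_curl_free.
split; first exact: sigma_weak_Lp.
split; first exact: sigma_weakstarN.
split; first exact: (@eta_weak_Lp _ _ p).
split; first exact: (@eta_weakstarN _ _ p).
exact: (@sigma_eta_weakstar_cvg _ k.+1 p).
Qed.
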